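(* Let $M,N,p\ge 1$ be integers and assume that in $\mathcal W_p(M|N)$ one has $\{{}^{\pm}\bar W^0_j,{}^{\pm}\bar W^0_k\}_*=0$ for all $j,k$, where ${}^{\pm}\bar W_j^0=\sum_{a=1}^{M+N}{}^{\pm}\bar W_j^{aa}$. Then the superalgebra $\mathcal W_p(M|N)=\mathcal W(gl(Mp|Np),(M+N)gl(p))$, equipped with its Dirac bracket, is (isomorphic as a Poisson superalgebra to) the classical truncated super-Yangian $Y_p(M|N)$.
   Context: Everything is over $\mathbb C$. Grading: $[a]=0$ for $1\le a\le M$, $[a]=1$ for $M<a\le M+N$; exponents of $(-1)$ are read mod 2. \textbf{Definition of $\mathcal W_p(M|N)$.} Let $e_\pm,e_0\in gl(p)$ span the principal $sl(2)$, with $[e_0,e_\pm]=\pm e_\pm$, $[e_+,e_-]=e_0$. For $0\le j\le p-1$ put $M_{jj}=2^je_+^j$ and $M_{j,m-1}=[e_-,M_{jm}]$ for $-j<m\le j$; the $M_{jm}$ form a basis of $gl(p)$, and $e_-=-\tfrac12M_{1,-1}$ if $p\ge 2$. Let $\mathcal P$ be the free supercommutative algebra on generators $x^{ab}_{kl}$ ($1\le a,b\le M+N$, $1\le k,l\le p$) of parity $[a]+[b]$, with the Lie–Poisson bracket of $gl(Mp|Np)$: $$\{x^{ab}_{kl},x^{cd}_{rs}\}=\delta^{bc}\delta_{lr}x^{ad}_{ks}-(-1)^{([a]+[b])([c]+[d])}\delta^{ad}\delta_{ks}x^{cb}_{rl}.$$ Define linear generators $J^{ab}_{jm}$ by $(x^{ab}_{kl})_{k,l}=\sum_{j=0}^{p-1}\sum_{m=-j}^jJ^{ab}_{jm}M_{jm}$.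 Impose the second class constraints $\Phi=\{\phi_\alpha\}$: $J^{ab}_{jm}=-\tfrac12(-1)^{[a]}\delta^{ab}\delta_{j,1}\delta_{m,-1}$ for all $a,b$, $j$ and $-j\le m<j$; equivalently $(x^{ab}_{kl})_{k,l}=(-1)^{[a]}\delta^{ab}e_-+\sum_jW^{ab}_jM_{jj}$ with $W_j^{ab}:=J_{jj}^{ab}$ left free ($0\le j\le p-1$). With $\Delta_{\alpha\beta}=\{\phi_\alpha,\phi_\beta\}$ (invertible on the constraints, inverse $\bar\Delta^{\alpha\beta}$), the Dirac bracket is $\{X,Y\}_*=\{X,Y\}-\sum_{\alpha,\beta}\{X,\phi_\alpha\}\bar\Delta^{\alpha\beta}\{\phi_\beta,Y\}$, the constraints being applied to the right hand side once the Poisson brackets are computed. $\mathcal W_p(M|N)$ is the free supercommutative algebra generated by the $W^{ab}_j$, $0\le j\le p-1$, with the Dirac bracket. \textbf{Generators ${}^\pm\bar W$.} Set $W_s^{ab}=0$ for $s\ge p$. The elements ${}^\pm\bar W_j^{ab}\in\mathcal W_p(M|N)$, $j\ge0$, are: ${}^\pm\bar W_0^{ab}=\bar W_0^{ab}=pW_0^{ab}$, ${}^\pm\bar W_1^{ab}=\pm\frac{p(p^2-1)}6W_1^{ab}+\frac{p(p\pm1)}2\sum_e(-1)^{[e]}W_0^{ae}W_0^{eb}$, and for $j>1$ $${}^\pm\bar W_j^{ab}=\sum_{n=1}^{j+1}\sum_{s_1+\dots+s_n=j+1-n}{}^\pm\alpha^{n,j}_{\vec s}\sum_{i_1,\dots,i_{n-1}}(-1)^{[i_1]+\dots+[i_{n-1}]}W_{s_1}^{ai_1}W_{s_2}^{i_1i_2}\cdots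 W_{s_n}^{i_{n-1}b}$$ ($s_i\ge0$), where the numbers ${}^\pm\alpha^{n,j}_{\vec s}$ are determined by requiring, for all $j\ge1$, $$\{{}^\pm\bar W_1^{ab},{}^\pm\bar W_j^{cd}\}_*=\delta^{cb}\,{}^\pm\bar W_{j+1}^{ad}-(-1)^{([a]+[b])([c]+[d])}\delta^{ad}\,{}^\pm\bar W_{j+1}^{cb}+(-1)^{[c]([a]+[b])+[a][b]}\big(\bar W_0^{cb}\,{}^\pm\bar W_j^{ad}-{}^\pm\bar W_j^{cb}\bar W_0^{ad}\big).$$ \textbf{Classical truncated super-Yangian.} The classical super-Yangian $Y(M|N)$ is the free supercommutative algebra on $T^{ab}_{(n)}$, $n\ge1$, of parity $[a]+[b]$, with $$\{T^{ab}_{(m)},T^{cd}_{(n)}\}=\delta^{cb}T^{ad}_{(m+n-1)}-(-1)^{([a]+[b])([c]+[d])}\delta^{ad}T^{cb}_{(m+n-1)}+(-1)^{[c]([a]+[b])+[a][b]}\sum_{r=1}^{\min(m,n)-1}\big(T^{cb}_{(r)}T^{ad}_{(m+n-1-r)}-T^{cb}_{(m+n-1-r)}T^{ad}_{(r)}\big).$$ $Y_p(M|N)$ is its quotient by the ideal generated by all $T^{ab}_{(n)}$ with $n>p$. *)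

(* Defs.v *)
From HB Require Import structures.
From mathcomp Require Import all_boot all_order all_algebra.
From mathcomp Require Import ring_quotient generic_quotient.
From mathcomp Require Import finmap complex monalg.
From mathcomp Require Import boolp classical_sets fsbigop reals.

Set Implicit Arguments.
Unset Strict Implicit.
Unset Printing Implicit Defensive.

Import GRing.Theory.
Local Open Scope ring_scope.
Local Open Scope quotient_scope.
Local Open Scope classical_set_scope.

(* mathcomp's [idealr] is closed under left multiplication only, and its ring
   quotients are restricted to commutative rings. *)
HB.mixin Record isMulrStable (R : nzRingType) (I : R -> bool) := {
  idealMl : forall u a, u \in I -> u * a \in I
}.

#[short(type="idealType")]
HB.structure Definition TwoSidedIdeal (R : nzRingType) :=
  {I of Idealr R I & isMulrStable R I}.

Section AlgQuotient.
Variables (K : comNzRingType) (A : algType K) (I : idealType A).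

Definition algQuot := Quotient.quot I.

HB.instance Definition _ := GRing.Zmodule.on algQuot.
HB.instance Definition _ := EqQuotient.on algQuot.

Lemma algQuotP (x y : A) : \pi_algQuot x = \pi_algQuot y <-> x - y \in I.
Proof. by rewrite (Quotient.idealrBE I); split=> /eqP. Qed.

Lemma repr_algQuot (x : A) : repr (\pi_algQuot x) - x \in I.
Proof. by apply/algQuotP; rewrite reprK. Qed.

Lemma algQuot_piD (x y : A) :
  \pi_algQuot (x + y) = \pi_algQuot x + \pi_algQuot y.
Proof. by rewrite (Quotient.pi_add I). Qed.

Definition algQuot_one : algQuot := \pi_algQuot 1.
Definition algQuot_mul := lift_op2 algQuot *%R.
Definition algQuot_scale (c : K) := lift_op1 algQuot ( *:%R c).

Lemma algQuot_mulE (x y : A) :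
  algQuot_mul (\pi_algQuot x) (\pi_algQuot y) = \pi_algQuot (x * y).
Proof.
unlock algQuot_mul; apply/algQuotP; set x' := repr _; set y' := repr _.
have -> : x' * y' - x * y = (x' - x) * y' + x * (y' - y).
  by rewrite mulrBl mulrBr addrA subrK.
by apply: rpredD; [apply: idealMl | apply: idealMr]; apply: repr_algQuot.
Qed.

Lemma algQuot_scaleE c (x : A) :
  algQuot_scale c (\pi_algQuot x) = \pi_algQuot (c *: x).
Proof.
unlock algQuot_scale; apply/algQuotP.
by rewrite -scalerBr -mulr_algl idealMr // repr_algQuot.
Qed.

Lemma algQuot_mulA : associative algQuot_mul.
Proof.
move=> x y z; elim/quotW: x => x; elim/quotW: y => y; elim/quotW: z => z.
by rewrite !algQuot_mulE mulrA.
Qed.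

Lemma algQuot_mul1 : left_id algQuot_one algQuot_mul.
Proof. by move=> x; elim/quotW: x => x; rewrite algQuot_mulE mul1r. Qed.

Lemma algQuot_mulr1 : right_id algQuot_one algQuot_mul.
Proof. by move=> x; elim/quotW: x => x; rewrite algQuot_mulE mulr1. Qed.

Lemma algQuot_mulDl : left_distributive algQuot_mul +%R.
Proof.
move=> x y z; elim/quotW: x => x; elim/quotW: y => y; elim/quotW: z => z.
by rewrite -algQuot_piD !algQuot_mulE -algQuot_piD mulrDl.
Qed.

Lemma algQuot_mulDr : right_distributive algQuot_mul +%R.
Proof.
move=> x y z; elim/quotW: x => x; elim/quotW: y => y; elim/quotW: z => z.
by rewrite -algQuot_piD !algQuot_mulE -algQuot_piD mulrDr.
Qed.

Lemma algQuot_pi0 : \pi_algQuot 0 = 0.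
Proof. by apply: (addrI (\pi_algQuot 0)); rewrite -algQuot_piD !addr0. Qed.

Lemma algQuot_nz : algQuot_one != 0.
Proof.
by apply/eqP; rewrite -algQuot_pi0 => /algQuotP; rewrite subr0 idealr1.
Qed.

HB.instance Definition _ := GRing.Zmodule_isNzRing.Build algQuot
  algQuot_mulA algQuot_mul1 algQuot_mulr1 algQuot_mulDl algQuot_mulDr
  algQuot_nz.

Lemma algQuot_scaleA a b x :
  algQuot_scale a (algQuot_scale b x) = algQuot_scale (a * b) x.
Proof. by elim/quotW: x => x; rewrite !algQuot_scaleE scalerA. Qed.

Lemma algQuot_scale1 : left_id 1 algQuot_scale.
Proof. by move=> x; elim/quotW: x => x; rewrite algQuot_scaleE scale1r. Qed.

Lemma algQuot_scaleDr : right_distributive algQuot_scale +%R.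
Proof.
move=> c x y; elim/quotW: x => x; elim/quotW: y => y.
by rewrite -algQuot_piD !algQuot_scaleE -algQuot_piD scalerDr.
Qed.

Lemma algQuot_scaleDl x : {morph algQuot_scale^~ x : a b / a + b}.
Proof.
move=> a b; elim/quotW: x => x.
by rewrite !algQuot_scaleE -algQuot_piD scalerDl.
Qed.

HB.instance Definition _ := GRing.Zmodule_isLmodule.Build K algQuot
  algQuot_scaleA algQuot_scale1 algQuot_scaleDr algQuot_scaleDl.

Lemma algQuot_scaleAl c (x y : algQuot) : c *: (x * y) = c *: x * y.
Proof.
elim/quotW: x => x; elim/quotW: y => y.
rewrite /GRing.scale /GRing.mul /=.
by rewrite !(algQuot_mulE, algQuot_scaleE) scalerAl.
Qed.

HB.instance Definition _ := GRing.Lmodule_isLalgebra.Build K algQuot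
  algQuot_scaleAl.

Lemma algQuot_scaleAr c (x y : algQuot) : c *: (x * y) = x * (c *: y).
Proof.
elim/quotW: x => x; elim/quotW: y => y.
rewrite /GRing.scale /GRing.mul /=.
by rewrite !(algQuot_mulE, algQuot_scaleE) scalerAr.
Qed.

HB.instance Definition _ := GRing.Lalgebra_isAlgebra.Build K algQuot
  algQuot_scaleAr.

Lemma algQuot_piM (x y : A) :
  \pi_algQuot (x * y) = \pi_algQuot x * \pi_algQuot y.
Proof. exact: esym (algQuot_mulE x y). Qed.

Lemma algQuot_piZ c (x : A) : \pi_algQuot (c *: x) = c *: \pi_algQuot x.
Proof. exact: esym (algQuot_scaleE c x). Qed.

End AlgQuotient.

Section IdealSpan.
Variables (R : nzRingType) (S : set R).

Inductive ideal_span : R -> Prop :=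
| ideal_span_gen x : S x -> ideal_span x
| ideal_span0 : ideal_span 0
| ideal_spanB x y : ideal_span x -> ideal_span y -> ideal_span (x - y)
| ideal_spanMl a x : ideal_span x -> ideal_span (a * x)
| ideal_spanMr a x : ideal_span x -> ideal_span (x * a).

Definition genIdeal : pred R := fun x => `[< ideal_span x >].

Lemma genIdealP x : reflect (ideal_span x) (x \in genIdeal).
Proof. exact: asboolP. Qed.

Lemma genIdeal_idealr_closed : ~ ideal_span 1 -> idealr_closed genIdeal.
Proof.
move=> I1; split=> [||a u v /genIdealP Iu /genIdealP Iv]; apply/genIdealP => //.
  exact: ideal_span0.
rewrite -[v]opprK -[- v]add0r; apply: ideal_spanB; first exact: ideal_spanMl.
by apply: ideal_spanB => //; apply: ideal_span0.
Qed.

Lemma genIdealMl u a : u \in genIdeal -> u * a \in genIdeal.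
Proof. by move=> /genIdealP Iu; apply/genIdealP; apply: ideal_spanMr. Qed.

End IdealSpan.

Section FreeAlgebra.
Variables (K : comNzRingType) (G : choiceType).

Definition freeAlg := {malg K[{fmonom G}]}.

HB.instance Definition _ := GRing.Lalgebra.on freeAlg.

Definition word (w : seq G) : freeAlg := << FMonom w >>.

Definition linext (V : lmodType K) (f : seq G -> V) (x : freeAlg) : V :=
  \sum_(w <- msupp x) x@_w *: f w.

Lemma linextEw (V : lmodType K) (f : seq G -> V) (x : freeAlg)
  (d : {fset {fmonom G}}) :
  (msupp x `<=` d)%fset -> linext f x = \sum_(w <- d) x@_w *: f w.
Proof.
move=> sxd; apply: big_fset_incl sxd _ => w _ xw.
by rewrite mcoeff_outdom ?scale0r.
Qed.

Lemma linext_is_linear (V : lmodType K) (f : seq G -> V) : linear (linext f).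
Proof.
move=> c x y; set d := fsetU (msupp x) (msupp y).
rewrite !(@linextEw _ f _ d) ?fsubsetUl ?fsubsetUr //.
  rewrite scaler_sumr -big_split; apply: eq_bigr => w _.
  by rewrite mcoeffD mcoeffZ scalerDl scalerA.
apply: fsubset_trans (msuppD_le _ _) _.
exact: fsetUSS (msuppZ_le _ _) (fsubset_refl _).
Qed.

HB.instance Definition _ (V : lmodType K) (f : seq G -> V) :=
  GRing.isLinear.Build K freeAlg V *:%R (linext f) (linext_is_linear f).

Lemma linextP (V : lmodType K) (f : seq G -> V) c (x y : freeAlg) :
  linext f (c *: x + y) = c *: linext f x + linext f y.
Proof. exact: linext_is_linear. Qed.

Lemma linextB (V : lmodType K) (f : seq G -> V) (x y : freeAlg) :
  linext f (x - y) = linext f x - linext f y.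
Proof. exact: linearB. Qed.

Lemma linextZ (V : lmodType K) (f : seq G -> V) c (x : freeAlg) :
  linext f (c *: x) = c *: linext f x.
Proof. exact: linearZ. Qed.

Lemma linext0 (V : lmodType K) (f : seq G -> V) : linext f 0 = 0.
Proof. exact: linear0. Qed.

Lemma linext_word (V : lmodType K) (f : seq G -> V) w : linext f (word w) = f w.
Proof.
rewrite /linext /word msuppU oner_eq0 big_seq_fset1 mcoeffUU.
by rewrite scale1r.
Qed.

Lemma freeAlgE (x : freeAlg) : x = \sum_(w <- msupp x) x@_w *: word w.
Proof.
rewrite [LHS]monalgE; apply: eq_bigr => w _.
apply/malgP => v; rewrite mcoeffZ !mcoeffU /=.
by case: w => w; case: eqP => _; rewrite ?mulr1 ?mulr0.
Qed.

Lemma wordM v w : word v * word w = word (v ++ w).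
Proof.
rewrite /word [LHS]fgmulUU mulr1; congr << _ >>.
by apply: val_inj; rewrite /= fmM.
Qed.

Lemma word0 : word [::] = 1.
Proof. by congr << _ >>; apply: val_inj; rewrite /= fm1. Qed.

Lemma freeAlg_scaleAr c (x y : freeAlg) : c *: (x * y) = x * (c *: y).
Proof.
have cC : x * c%:MP = c%:MP * x.
  rewrite mul_malgC malgM_def malgZ_def /malgC fgmulgU; apply: eq_bigr => k _.
  by rewrite mulm1 mulrC.
transitivity ((c%:MP * x) * y).
  by apply: etrans (mulrA _ _ _); apply/esym/mul_malgC.
rewrite -cC; apply: etrans (esym (mulrA _ _ _)) _.
by congr (x * _); apply: mul_malgC.
Qed.

HB.instance Definition _ :=
  GRing.Lalgebra_isAlgebra.Build K freeAlg freeAlg_scaleAr.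

Lemma freeAlgZl c (x y : freeAlg) : c *: x * y = c *: (x * y).
Proof. exact: esym (scalerAl _ _ _). Qed.

Lemma freeAlgZr c (x y : freeAlg) : x * (c *: y) = c *: (x * y).
Proof. exact: esym (scalerAr _ _ _). Qed.

Definition const_coef (x : freeAlg) : K := mcoeff (@mone {fmonom G}) x.

Lemma freeAlg_ind (P : freeAlg -> Prop) :
  (forall w, P (word w)) -> (forall c x y, P x -> P y -> P (c *: x + y)) ->
  forall x, P x.
Proof.
move=> Pw Pl x; rewrite [x]freeAlgE; apply: big_rec => [|w y _ Py].
  by rewrite -[0](addNr (word [::])) -scaleN1r; apply: Pl.
exact: Pl.
Qed.

End FreeAlgebra.

Section BilinearIdentities.
Variables (K : comNzRingType) (A : algType K) (W : Type) (word : W -> A).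
Hypothesis word_ind : forall P : A -> Prop, (forall w, P (word w)) ->
  (forall c x y, P x -> P y -> P (c *: x + y)) -> forall x, P x.

Lemma bilin_mul (B : algType K) (f : A -> B) :
  linear f ->
  (forall v w, f (word v * word w) = f (word v) * f (word w)) ->
  forall x y, f (x * y) = f x * f y.
Proof.
move=> fL fM x y; elim/word_ind: x => [v|c x1 x2 IH1 IH2]; last first.
  by rewrite mulrDl -scalerAl !fL IH1 IH2 mulrDl scalerAl.
elim/word_ind: y => [w|c y1 y2 IH1 IH2]; last first.
  by rewrite mulrDr -scalerAr !fL IH1 IH2 mulrDr scalerAr.
exact: fM.
Qed.

Lemma bilin_deriv (s D : A -> A) : linear s -> linear D ->
  (forall v w,
    D (word v * word w) = D (word v) * word w + s (word v) * D (word w)) ->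
  forall x y, D (x * y) = D x * y + s x * D y.
Proof.
move=> sL DL DM x y; elim/word_ind: x => [v|c x1 x2 IH1 IH2]; last first.
  rewrite mulrDl -scalerAl !DL !sL IH1 IH2 !mulrDl -!scalerAl scalerDr.
  by rewrite addrACA.
elim/word_ind: y => [w|c y1 y2 IH1 IH2]; last first.
  by rewrite mulrDr -scalerAr !DL IH1 IH2 !mulrDr -!scalerAr scalerDr addrACA.
exact: DM.
Qed.

Lemma bilin_rel (d1 d2 s1 s2 s12 : K) wg wk :
  d1 * (s12 * s2) = d1 -> d2 * s1 = d2 * s12 ->
  (d1 *: wk + s1 *: (wg * (d2 *: 1 + s2 *: (wk * 0))))
  - s12 *: (d2 *: wg + s2 *: (wk * (d1 *: 1 + s1 *: (wg * 0)))) = 0 :> A.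
Proof.
move=> h1 h2; rewrite !mulr0 !scaler0 !addr0 -!scalerAr !mulr1 scalerDr.
rewrite !scalerA.
rewrite [s1 * d2]mulrC h2 [s12 * d2]mulrC [s12 * s2 * d1]mulrC h1.
by rewrite [d2 * s12 *: wg + _]addrC subrr.
Qed.

Lemma bilin3 s1 s2 d wg wv ww Dv Dw :
  d *: (wv * ww) + s1 *: (wg * (Dv * ww + s2 *: wv * Dw))
  = (d *: wv + s1 *: (wg * Dv)) * ww + (s1 * s2) *: (wg * wv) * Dw :> A.
Proof.
by rewrite mulrDl mulrDr scalerDr -!scalerAl -!scalerAr scalerA !mulrA addrA.
Qed.

End BilinearIdentities.

Section FreeSuperAlgebra.
Variables (K : fieldType) (G : choiceType) (par : G -> bool).
Local Notation freeAlg := (freeAlg K G).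
Local Notation word := (@word K G).

Definition supercomm_rel (x : freeAlg) : Prop :=
  exists g h : G,
    x = word [:: g; h] - (-1) ^+ (par g && par h) *: word [:: h; g].

Definition supercomm_ideal : pred freeAlg := genIdeal supercomm_rel.

Definition word_par (w : seq G) : bool := odd (count par w).

Fixpoint word_lderiv (h : G) (w : seq G) : freeAlg :=
  if w is g :: w' then
    (g == h)%:R *: word w'
      + (-1) ^+ (par h && par g) *: (word [:: g] * word_lderiv h w')
  else 0.

Lemma supercomm_ideal_coef1 (x : freeAlg) :
  ideal_span supercomm_rel x -> const_coef x = 0.
Proof.
elim=> [_ [g [h ->]]||u v _ u0 _ v0|a u _ u0|a u _ u0].
- by rewrite /const_coef mcoeffB mcoeffZ !mcoeffU1 !fmP !fm1 /= mulr0 subr0.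
- exact: mcoeff0.
- by rewrite /const_coef mcoeffB [_@__]u0 [_@__]v0 subr0.
- by rewrite /const_coef (rmorphM (mcoeff _)) /= [X in _ * X]u0 mulr0.
- by rewrite /const_coef (rmorphM (mcoeff _)) /= [X in X * _]u0 mul0r.
Qed.

Lemma supercomm_ideal_idealr_closed : idealr_closed supercomm_ideal.
Proof.
apply: genIdeal_idealr_closed => /supercomm_ideal_coef1/eqP.
by rewrite /const_coef mcoeff1 eqxx oner_eq0.
Qed.

HB.instance Definition _ :=
  isIdealr.Build freeAlg supercomm_ideal supercomm_ideal_idealr_closed.
HB.instance Definition _ :=
  isMulrStable.Build freeAlg supercomm_ideal (@genIdealMl _ supercomm_rel).

(* The free supercommutative algebra: for odd g the relation gg = - gg forces
   g^2 = 0 as soon as 2 is invertible in K. *)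
Definition sfree := algQuot (supercomm_ideal : idealType freeAlg).

HB.instance Definition _ := GRing.Algebra.on sfree.
HB.instance Definition _ := EqQuotient.on sfree.

Definition sgen (g : G) : sfree := \pi_sfree (word [:: g]).

Lemma sfree_piP (x y : freeAlg) :
  \pi_sfree x = \pi_sfree y <-> ideal_span supercomm_rel (x - y).
Proof.
split=> [/algQuotP/genIdealP //|Ixy]; apply/algQuotP.
exact/genIdealP.
Qed.

Lemma sgen_comm g h :
  sgen g * sgen h = (-1) ^+ (par g && par h) *: (sgen h * sgen g).
Proof.
rewrite /sgen -!algQuot_piM -algQuot_piZ; apply/sfree_piP.
by apply: ideal_span_gen; exists g, h; rewrite !wordM.
Qed.

Definition word_sign (w : seq G) : freeAlg := (-1) ^+ word_par w *: word w.

(* The operations below are computed on representatives in the free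
   associative algebra; [sparity_pi], [slderiv_pi] and [seval_pi] show
   that the choice of the representative is immaterial. *)
Definition sparity (x : sfree) : sfree :=
  \pi_sfree (linext word_sign (repr x)).

Definition slderiv (h : G) (x : sfree) : sfree :=
  \pi_sfree (linext (word_lderiv h) (repr x)).

(* The right derivative, (xy)d_h = x(y d_h) + (-1)^([h][y]) (x d_h)y, equals
   (-1)^([h]([x] + [h])) d_h x on homogeneous x. *)
Definition srderiv (h : G) (x : sfree) : sfree :=
  iter (par h) sparity (slderiv h x).

(* The algebra morphism extending f, when the values of f supercommute. *)
Definition seval (B : algType K) (f : G -> B) (x : sfree) : B :=
  linext (fun w => \prod_(g <- w) f g) (repr x).

(* The bracket {x, y} = sum_(g, h) (x d_g) b(g, h) (d_h y), that is, the
   biderivation of the free supercommutative algebra with values b on the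
   generators; the sum over G * G has finite support. *)
Definition sbracket (b : G -> G -> sfree) (x y : sfree) : sfree :=
  \sum_(u \in [set: G * G]) srderiv u.1 x * b u.1 u.2 * slderiv u.2 y.

Lemma ideal_spanZ c x : ideal_span supercomm_rel x ->
  ideal_span supercomm_rel (c *: x).
Proof. by rewrite -mulr_algl; apply: ideal_spanMl. Qed.

Lemma ideal_spanD (x y : freeAlg) : ideal_span supercomm_rel x ->
  ideal_span supercomm_rel y -> ideal_span supercomm_rel (x + y).
Proof.
move=> Ix Iy; rewrite -[y]opprK -[- y]add0r; apply: ideal_spanB => //.
by apply: ideal_spanB => //; apply: ideal_span0.
Qed.

Lemma linext_signM (x y : freeAlg) :
  linext word_sign (x * y) = linext word_sign x * linext word_sign y.
Proof.
apply: (bilin_mul (@freeAlg_ind K G)) x y; first exact: linextP.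
move=> v w.
rewrite wordM !linext_word /word_sign /word_par count_cat oddD signr_addb.
by rewrite freeAlgZl freeAlgZr scalerA wordM.
Qed.

Lemma linext_sign_ideal (x : freeAlg) : ideal_span supercomm_rel x ->
  ideal_span supercomm_rel (linext word_sign x).
Proof.
elim=> [_ [g [h ->]]||u v _ Iu _ Iv|a u _ Iu|a u _ Iu].
- rewrite linextB linextZ /= !linext_word /word_sign /word_par /= !addn0.
  rewrite addnC scalerA mulrC -scalerA -scalerBr; apply: ideal_spanZ.
  by apply: ideal_span_gen; exists g, h.
- by rewrite linext0; apply: ideal_span0.
- by rewrite linextB; apply: ideal_spanB.
- by rewrite linext_signM; apply: ideal_spanMl.
- by rewrite linext_signM; apply: ideal_spanMr.
Qed.

Lemma sparity_pi (x : freeAlg) :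
  sparity (\pi_sfree x) = \pi_sfree (linext word_sign x).
Proof.
apply/sfree_piP; rewrite -linextB; apply: linext_sign_ideal.
by apply/sfree_piP; rewrite reprK.
Qed.

Lemma linext_lderivM h (x y : freeAlg) :
  linext (word_lderiv h) (x * y) = linext (word_lderiv h) x * y
    + iter (par h) (linext word_sign) x * linext (word_lderiv h) y.
Proof.
apply: (bilin_deriv (@freeAlg_ind K G)) x y => [c x y||v w].
- by case: (par h); rewrite //= linextP.
- exact: linextP.
rewrite wordM !linext_word.
have -> : iter (par h) (linext word_sign) (word v) =
    (-1) ^+ (par h && word_par v) *: word v.
  by case: (par h) => /=; rewrite ?linext_word ?scale1r.
elim: v => [|g v IH] /=.
  by rewrite andbF scale1r mul0r add0r word0 mul1r.
have -> : word (g :: v) = word [:: g] * word v by rewrite wordM.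
have -> : (-1) ^+ (par h && word_par (g :: v)) =
    (-1) ^+ (par h && par g) * (-1) ^+ (par h && word_par v) :> K.
  rewrite -signr_addb /word_par /= oddD oddb.
  by case: (par h).
rewrite IH -wordM; move: (word_lderiv h v) (word_lderiv h w) => Dv Dw.
move: (word v) (word w) (word [:: g]) => wv ww wg.
move: (_ ^+ _) (_ ^+ _) (_%:R) => s1 s2 d.
exact: bilin3.
Qed.

Lemma linext_lderiv_ideal h (x : freeAlg) : ideal_span supercomm_rel x ->
  ideal_span supercomm_rel (linext (word_lderiv h) x).
Proof.
elim=> [_ [g [k ->]]||u v _ Iu _ Iv|a u Iu IDu|a u Iu IDu].
- rewrite linextB linextZ !linext_word /= word0 bilin_rel.
  + exact: ideal_span0.
  + case: eqP => [->|_]; last by rewrite !mul0r.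
    by rewrite -signr_addb addbb mulr1.
  + case: eqP => [->|_]; last by rewrite !mul0r.
    by rewrite andbC.
- by rewrite linext0; apply: ideal_span0.
- by rewrite linextB; apply: ideal_spanB.
- by rewrite linext_lderivM; apply: ideal_spanD; apply: ideal_spanMl.
- rewrite linext_lderivM; apply: ideal_spanD; first exact: ideal_spanMr.
  apply: ideal_spanMr.
  by case: (par h); [apply: linext_sign_ideal | apply: Iu].
Qed.

Lemma slderiv_pi h (x : freeAlg) :
  slderiv h (\pi_sfree x) = \pi_sfree (linext (word_lderiv h) x).
Proof.
apply/sfree_piP; rewrite -linextB; apply: linext_lderiv_ideal.
by apply/sfree_piP; rewrite reprK.
Qed.

Lemma seval_pi (B : algType K) (f : G -> B) (x : freeAlg) :
  (forall g h, f g * f h = (-1) ^+ (par g && par h) *: (f h * f g)) ->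
  seval f (\pi_sfree x) = linext (fun w => \prod_(g <- w) f g) x.
Proof.
move=> fC; pose E := linext (fun w => \prod_(g <- w) f g).
have EM (y z : freeAlg) : E (y * z) = E y * E z.
  apply: (bilin_mul (@freeAlg_ind K G)) y z; first exact: linextP.
  move=> v w.
  by rewrite wordM /E !linext_word big_cat.
have E0 y : ideal_span supercomm_rel y -> E y = 0.
  elim=> [_ [g [h ->]]||u v _ Iu _ Iv|a u _ Iu|a u _ Iu].
  - rewrite /E linextB linextZ /= !linext_word !big_cons !big_nil !mulr1.
    by rewrite fC subrr.
  - exact: linext0.
  - by rewrite /E linextB -!/(E _) Iu Iv subrr.
  - by rewrite EM Iu mulr0.
  - by rewrite EM Iu mul0r.
apply/eqP; rewrite /seval -subr_eq0 -linextB; apply/eqP/E0/sfree_piP.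
by rewrite reprK.
Qed.

End FreeSuperAlgebra.

(* A superalgebra with a bracket.  Neither the parity nor the bracket axioms
   are bundled: an isomorphism of Poisson superalgebras is an isomorphism of
   the underlying data. *)
Record superBracketAlg (K : nzRingType) := SuperBracketAlg {
  sba_alg :> algType K;
  sba_parity : sba_alg -> sba_alg; (* x |-> (-1)^[x] x *)
  sba_bracket : sba_alg -> sba_alg -> sba_alg
}.

Definition poisson_isomorphic (K : nzRingType) (A B : superBracketAlg K) :
    Prop :=
  exists f : {lrmorphism A -> B},
    [/\ bijective f,
        {morph f : x / sba_parity x >-> sba_parity x} &
        {morph f : x y / sba_bracket x y >-> sba_bracket x y}].

(* Indices a = 1, ..., M + N of the text are 'I_(M + N) shifted down by one. *)
Definition grade (M N : nat) (a : 'I_(M + N)) : bool := (M <= a)%N.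

Definition grade2 (M N : nat) (a b : 'I_(M + N)) : bool := grade a (+) grade b.

Section Yangian.
Variables (K : fieldType) (M N : nat).
Local Notation I := 'I_(M + N).

(* (a, b, n) indexes T^{ab}_{(n+1)} *)
Definition yidx : Type := (I * I * nat)%type.
HB.instance Definition _ := Choice.on yidx.

Definition ypar (u : yidx) : bool := grade2 u.1.1 u.1.2.

Definition yangian := sfree K ypar.
HB.instance Definition _ := GRing.Algebra.on yangian.
HB.instance Definition _ := EqQuotient.on yangian.

(* Only used for 0 < n. *)
Definition ygen (a b : I) (n : nat) : yangian := sgen K ypar (a, b, n.-1).

Definition ygen_bracket (u v : yidx) : yangian :=
  let: (a, b, m') := u in let: (c, d, n') := v in
  let m := m'.+1 in let n := n'.+1 in
  (c == b)%:R *: ygen a d (m + n - 1)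
  - ((-1) ^+ (grade2 a b && grade2 c d) * (a == d)%:R) *: ygen c b (m + n - 1)
  + (-1) ^+ ((grade c && grade2 a b) (+) (grade a && grade b)) *:
    \sum_(1 <= r < minn m n)
      (ygen c b r * ygen a d (m + n - 1 - r)
       - ygen c b (m + n - 1 - r) * ygen a d r).

Definition yangian_bracket : yangian -> yangian -> yangian :=
  sbracket ygen_bracket.

Variable p : nat.

Definition ytrunc_gens (x : yangian) : Prop :=
  exists a b n, (p < n)%N /\ x = ygen a b n.

Definition ytrunc_ideal : pred yangian := genIdeal ytrunc_gens.

Lemma ytrunc_ideal_idealr_closed : idealr_closed ytrunc_ideal.
Proof.
apply: genIdeal_idealr_closed.
pose aug (x : yangian) : K := const_coef (repr x).
have augE (x : freeAlg K yidx) : aug (\pi_yangian x) = const_coef x.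
  apply/eqP; rewrite -subr_eq0 -[_ - _](mcoeffB _ (repr (\pi_yangian x)) x).
  by apply/eqP/(@supercomm_ideal_coef1 K _ ypar)/sfree_piP; rewrite reprK.
have augB x y : aug (x - y) = aug x - aug y.
  elim/quotW: x => x; elim/quotW: y => y.
  have -> : \pi_yangian x - \pi_yangian y = \pi_yangian (x - y).
    by rewrite -scaleN1r -(scaleN1r y) -algQuot_piZ -algQuot_piD.
  by rewrite !augE; apply: mcoeffB.
have augM x y : aug (x * y) = aug x * aug y.
  elim/quotW: x => x; elim/quotW: y => y.
  rewrite -[_ * _]algQuot_piM !augE; exact: (rmorphM (mcoeff _)).
suff I0 x : ideal_span ytrunc_gens x -> aug x = 0.
  move=> /I0/eqP; have -> : (1 : yangian) = \pi_yangian 1 by [].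
  by rewrite augE /const_coef mcoeff1 eqxx oner_eq0.
elim=> [_ [a [b [n [_ ->]]]]||u v _ u0 _ v0|a u _ u0|a u _ u0].
- by rewrite augE /const_coef mcoeffU1 fmP fm1.
- by rewrite -(subrr (0 : yangian)) augB subrr.
- by rewrite augB u0 v0 subrr.
- by rewrite augM u0 mulr0.
- by rewrite augM u0 mul0r.
Qed.

HB.instance Definition _ :=
  isIdealr.Build yangian ytrunc_ideal ytrunc_ideal_idealr_closed.
HB.instance Definition _ :=
  isMulrStable.Build yangian ytrunc_ideal (@genIdealMl _ ytrunc_gens).

Definition ytrunc := algQuot (ytrunc_ideal : idealType yangian).
HB.instance Definition _ := GRing.Algebra.on ytrunc.
HB.instance Definition _ := EqQuotient.on ytrunc.

(* The ideal is homogeneous and Poisson, so the choice of representatives made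
   by [repr] is immaterial in the next two definitions. *)
Definition ytrunc_parity (x : ytrunc) : ytrunc := \pi_ytrunc (sparity (repr x)).

Definition ytrunc_bracket (x y : ytrunc) : ytrunc :=
  \pi_ytrunc (yangian_bracket (repr x) (repr y)).

Definition truncated_yangian : superBracketAlg K :=
  SuperBracketAlg ytrunc_parity ytrunc_bracket.

End Yangian.

Section WAlgebra.
Variables (K : fieldType) (M N p : nat).
Local Notation I := 'I_(M + N).

(* p - 1 is the rank of a regular nilpotent matrix *)
Definition principal_sl2 (ep em e0 : 'M[K]_p) : Prop :=
  [/\ e0 * ep - ep * e0 = ep, e0 * em - em * e0 = - em,
      ep * em - em * ep = e0 & \rank ep = p.-1].

Variables (ep em : 'M[K]_p).

(* [sl2mx j i] is M_{j, j - i}. *)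
Definition sl2mx (j i : nat) : 'M[K]_p :=
  iter i (fun X => em * X - X * em) (2 ^+ j *: ep ^+ j).

(* The spin labels (j, m): [existT _ j i] stands for m = j - i. *)
Definition spin : Type := {j : 'I_p & 'I_(2 * j).+1}.
HB.instance Definition _ := Finite.on spin.

Definition highest (j : 'I_p) : spin := existT _ j ord0.

Definition sl2basis : #|{: spin}|.-tuple 'M[K]_p :=
  [tuple sl2mx (tag (enum_val t)) (tagged (enum_val t)) | t < #|{: spin}|].

Definition pidx : Type := (I * I * 'I_p * 'I_p)%type.
HB.instance Definition _ := Finite.on pidx.

Definition ppar (u : pidx) : bool := grade2 u.1.1.1 u.1.1.2.

Definition palg := sfree K ppar.
HB.instance Definition _ := GRing.Algebra.on palg.

Definition pgen (a b : I) (k l : 'I_p) : palg := sgen K ppar (a, b, k, l).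

Definition pgen_bracket (u v : pidx) : palg :=
  let: (a, b, k, l) := u in let: (c, d, r, s) := v in
  ((b == c) && (l == r))%:R *: pgen a d k s
  - ((-1) ^+ (grade2 a b && grade2 c d) * ((a == d) && (k == s))%:R) *:
      pgen c b r l.

Definition lie_poisson : palg -> palg -> palg := sbracket pgen_bracket.

(* J^{ab}_{jm}: since (x_kl) = sum_kl x_kl E_kl, expand the elementary matrices
   E_kl in the basis M_{jm}. *)
Definition Jgen (a b : I) (t : spin) : palg :=
  \sum_(k < p) \sum_(l < p)
    coord sl2basis (enum_rank t) (delta_mx k l) *: pgen a b k l.

Definition cidx : Type := {c : I * I * spin | (0 < tagged c.2)%N}.
HB.instance Definition _ := Finite.on cidx.

(* The constraint value is nonzero for j = 1, m = -1, that is i = j - m = 2. *)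
Definition constraint (c : cidx) : palg :=
  let: (a, b, t) := val c in
  Jgen a b t
  + (2^-1 * (-1) ^+ grade a
     * [&& a == b, tag t == 1%N :> nat & tagged t == 2 :> nat]%:R)%:A.

Definition widx : Type := (I * I * 'I_p)%type.
HB.instance Definition _ := Finite.on widx.

Definition wpar (u : widx) : bool := grade2 u.1.1 u.1.2.

Definition walg := sfree K wpar.
HB.instance Definition _ := GRing.Algebra.on walg.

(* The value of x^{ab}_{kl} on the constraints. *)
Definition constrained_gen (u : pidx) : walg :=
  let: (a, b, k, l) := u in
  ((-1) ^+ grade a * (a == b)%:R * em k l)%:A
  + \sum_(j < p) sl2mx j 0 k l *: sgen K wpar (a, b, j).

Definition on_constraints : palg -> walg := seval constrained_gen.

(* W^{ab}_j = J^{ab}_{jj} as an element of the unconstrained algebra *)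
Definition unconstrained : walg -> palg :=
  seval (fun u : widx => Jgen u.1.1 u.1.2 (highest u.2)).

Definition Delta : 'M[walg]_#|{: cidx}| :=
  \matrix_(i, j) on_constraints
    (lie_poisson (constraint (enum_val i)) (constraint (enum_val j))).

(* The two-sided inverse of Delta, unique when it exists; [xget] selects it. *)
Definition Delta_inv : 'M[walg]_#|{: cidx}| :=
  xget 0 [set D | Delta *m D = 1%:M /\ D *m Delta = 1%:M].

Definition dirac (X Y : walg) : walg :=
  on_constraints (lie_poisson (unconstrained X) (unconstrained Y))
  - \sum_(i < #|{: cidx}|) \sum_(j < #|{: cidx}|)
      on_constraints (lie_poisson (unconstrained X) (constraint (enum_val i)))
      * Delta_inv i j
      * on_constraints
          (lie_poisson (constraint (enum_val j)) (unconstrained Y)).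

Definition W_algebra : superBracketAlg K :=
  SuperBracketAlg (@sparity K _ wpar) dirac.

Definition W (j : nat) (a b : I) : walg :=
  if insub j is Some j' then sgen K wpar (a, b, j') else 0.

(* sum over i_1, ..., i_(n-1) of
   (-1)^([i_1] + ... + [i_(n-1)]) W_(s_1)^(a i_1) ... W_(s_n)^(i_(n-1) b),
   for s = [:: s_1; ...; s_n] nonempty *)
Fixpoint Wmonomial (s : seq nat) (a b : I) : walg :=
  match s with
  | [::] => 0
  | [:: j] => W j a b
  | j :: s' => \sum_(i : I) (-1) ^+ grade i *: (W j a i * Wmonomial s' i b)
  end.

(* The sign +- is (-1)^sgn; [alpha j s] stands for the number indexed by
   (n, j), s with n = size s. *)
Variables (sgn : bool) (alpha : nat -> seq nat -> K).
Local Notation pm1 := ((-1) ^+ sgn : K).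

Definition Wbar (j : nat) (a b : I) : walg :=
  match j with
  | 0 => p%:R *: W 0 a b
  | 1 => (pm1 * (p%:R * (p%:R ^+ 2 - 1) / 6%:R)) *: W 1 a b
         + (p%:R * (p%:R + pm1) / 2%:R) *:
           \sum_(e : I) (-1) ^+ grade e *: (W 0 a e * W 0 e b)
  | _ => \sum_(1 <= n < j.+2)
           \sum_(s : n.-tuple 'I_j.+1 | (\sum_(i <- s) i == j + 1 - n)%N)
             alpha j (map val s) *: Wmonomial (map val s) a b
  end.

(* The relation determining the numbers alpha. *)
Definition Wbar_recursion : Prop :=
  forall (j : nat) (a b c d : I), (1 <= j)%N ->
    dirac (Wbar 1 a b) (Wbar j c d) =
      (c == b)%:R *: Wbar j.+1 a d
      - ((-1) ^+ (grade2 a b && grade2 c d) * (a == d)%:R) *: Wbar j.+1 c b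
      + (-1) ^+ ((grade c && grade2 a b) (+) (grade a && grade b)) *:
        (Wbar 0 c b * Wbar j a d - Wbar j c b * Wbar 0 a d).

Definition Wbar_trace (j : nat) : walg := \sum_(a : I) Wbar j a a.

End WAlgebra.

(* Main.v *)
From HB Require Import structures.
Require Import Defs.
From mathcomp Require Import all_boot all_order all_algebra.
From mathcomp Require Import complex reals.
From mathcomp Require Import generic_quotient.
From mathcomp Require Import boolp classical_sets fsbigop.
From mathcomp Require Import ring zify.

Set Implicit Arguments.
Unset Strict Implicit.
Unset Printing Implicit Defensive.

Import Order.TTheory GRing.Theory Num.Theory.
Local Open Scope ring_scope.
Local Open Scope quotient_scope.

(** The truncated super-Yangian is realized inside the W-superalgebra by the
    powers of the matrix of generators of gl(Mp|Np).

    Write this matrix, of size (M + N)p, in a basis of C^p on which the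
    principal sl(2) acts by its standard formulas, the vectors being ordered by
    decreasing weight so that e_- is the shift matrix; absorb the sign (-1)^[b]
    of a column index in the entries, so that products of matrices can be
    formed without signs. Let r_n^(ab) be the entry of the n-th power in the
    row (a, last) and the column (b, first). In the adjoint action it commutes
    with all strictly lower triangular linear functions ([br_lower_corner]), in
    particular with the constraints J_(jm), m < 0. These are the first class
    constraints, and those with m >= 0 only fix a gauge: the matrix of the
    brackets of the constraints is antitriangular for the grading by m, so its
    inverse couples two constraints only if their weights add up to a negative
    number ([constraint_mx_inverse]). Every correction term of the Dirac
    bracket of two functions r_n then contains the bracket of one of them with
    a first class constraint. Hence their Dirac bracket is the restriction of
    their Lie-Poisson bracket ([beta_corner]).

    This Lie-Poisson bracket obeys a quadratic difference relation, which holds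
    for the powers of any matrix whose entries bracket like those of gl
    ([pw_rtt]). On the constraints the matrix is the sum of the shift matrix
    and an upper triangular part. Therefore r_n is 0 for n < p - 1 and 1 for n
    = p - 1, and the series R with coefficients R_n = r_(p-1+n) has an inverse
    S, which obeys the same relation with the opposite sign ([inverse_rtt]). Up
    to signs this is the relation of the super-Yangian in its difference form:
    the elements T_n^(ab) = (-1)^([b]+n) S_n^(ab) have exactly the brackets of
    the generators of Y(M|N) ([yser_bracketS]). The first block column is a
    cyclic vector for the restricted matrix, so the R_n obey a linear
    recurrence of length p, and S is a polynomial of degree at most p
    ([Rmx_inverse]). Thus T_n = 0 for n > p, and the generators of the
    super-Yangian have been mapped to the W-superalgebra compatibly with
    brackets and with the truncation.

    It remains to see that this map is bijective. The leading term of
    T_(j+1)^(ab) is a nonzero rational multiple of W_j^(ab), the other terms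
    being polynomials in the W_i with i < j ([yangian_generators], from
    [Rmx_lead]). So the T_n with n <= p are free generators of the
    W-superalgebra ([triangular_bij]), as are by definition those of the
    truncated super-Yangian ([truncation_iso]). *)

(** * Free supercommutative algebras and their brackets *)

(** The free supercommutative algebra as it is characterized by its generators,
    its parity involution, its left derivatives and its evaluation morphisms. All
    arguments below rest on these properties alone. *)
Record freeSuper (K : fieldType) (G : choiceType) (par : G -> bool) := FreeSuper {
  fs_alg :> algType K;
  gen : G -> fs_alg;
  prt : fs_alg -> fs_alg;
  der : G -> fs_alg -> fs_alg;
  ev : forall B : algType K, (G -> B) -> fs_alg -> B;
  gen_ind : forall Q : fs_alg -> Prop,
    Q 1 -> (forall g x, Q x -> Q (gen g * x)) ->
    (forall c x y, Q x -> Q y -> Q (c *: x + y)) -> forall x, Q x;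
  gen_comm : forall g h,
    gen g * gen h = (-1) ^+ (par g && par h) *: (gen h * gen g);
  prtP : forall c x y, prt (c *: x + y) = c *: prt x + prt y;
  prt1 : prt 1 = 1;
  prtM : forall x y, prt (x * y) = prt x * prt y;
  prt_gen : forall g, prt (gen g) = (-1) ^+ par g *: gen g;
  derP : forall h c x y, der h (c *: x + y) = c *: der h x + der h y;
  derM : forall h x y,
    der h (x * y) = der h x * y + iter (par h) prt x * der h y;
  der_gen : forall h g, der h (gen g) = (g == h)%:R;
  evP : forall (B : algType K) (f : G -> B),
    (forall g h, f g * f h = (-1) ^+ (par g && par h) *: (f h * f g)) ->
    [/\ forall c x y, ev f (c *: x + y) = c *: ev f x + ev f y,
        forall x y, ev f (x * y) = ev f x * ev f y,
        ev f 1 = 1 & forall g, ev f (gen g) = f g]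
}.

Section Sfree.
Variables (K : fieldType) (G : choiceType) (par : G -> bool).
Local Notation A := (sfree K par).
Local Notation pi := (\pi_(sfree K par)).

Lemma piD (x y : freeAlg K G) : pi (x + y) = pi x + pi y.
Proof. exact: algQuot_piD. Qed.

Lemma piZ c (x : freeAlg K G) : pi (c *: x) = c *: pi x.
Proof. exact: algQuot_piZ. Qed.

Lemma piM (x y : freeAlg K G) : pi (x * y) = pi x * pi y.
Proof. exact: algQuot_piM. Qed.

Lemma sfree_ind (Q : A -> Prop) : Q 1 -> (forall g x, Q x -> Q (sgen K par g * x)) ->
    (forall c x y, Q x -> Q y -> Q (c *: x + y)) -> forall x, Q x.
Proof.
move=> Q1 Qg Ql x; elim/quotW: x => x; elim/freeAlg_ind: x => [w|c x y Qx Qy].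
  elim: w => [|g w IH]; first by rewrite word0; apply: Q1.
  by rewrite (_ : word K (g :: w) = word K [:: g] * word K w) ?piM ?wordM //; apply: Qg.
by rewrite piD piZ; apply: Ql.
Qed.

Lemma sparityP c (x y : A) : sparity (c *: x + y) = c *: sparity x + sparity y.
Proof.
elim/quotW: x => x; elim/quotW: y => y.
by rewrite -piZ -piD !sparity_pi linextP piD piZ.
Qed.

Lemma sparityM (x y : A) : sparity (x * y) = sparity x * sparity y.
Proof.
elim/quotW: x => x; elim/quotW: y => y.
by rewrite -piM !sparity_pi linext_signM piM.
Qed.

Lemma sparity1 : sparity (1 : A) = 1.
Proof.
rewrite -[1]/(pi 1) -word0 sparity_pi linext_word /word_sign piZ.
exact: scale1r.
Qed.

Lemma sparity_gen g : sparity (sgen K par g) = (-1) ^+ par g *: sgen K par g.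
Proof.
rewrite /sgen sparity_pi linext_word /word_sign piZ /word_par /=.
by rewrite addn0 oddb.
Qed.

Lemma slderivP h c (x y : A) : slderiv h (c *: x + y) = c *: slderiv h x + slderiv h y.
Proof.
elim/quotW: x => x; elim/quotW: y => y.
by rewrite -piZ -piD !slderiv_pi linextP piD piZ.
Qed.

Lemma slderivM h (x y : A) :
  slderiv h (x * y) = slderiv h x * y + iter (par h) (@sparity K G par) x * slderiv h y.
Proof.
elim/quotW: x => x; elim/quotW: y => y.
have -> : iter (par h) (@sparity K G par) (pi x)
    = pi (iter (par h) (linext (@word_sign K G par)) x).
  by case: (par h); first exact: sparity_pi.
rewrite -piM !slderiv_pi linext_lderivM piD.
by congr (_ + _); apply: piM.
Qed.

Lemma slderiv_gen h g : slderiv h (sgen K par g) = (g == h)%:R.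
Proof.
rewrite /sgen slderiv_pi linext_word /= mulr0 scaler0 addr0 word0 piZ.
exact: scaler_nat.
Qed.

Lemma sevalP (B : algType K) (f : G -> B) :
  (forall g h, f g * f h = (-1) ^+ (par g && par h) *: (f h * f g)) ->
    [/\ forall c (x y : A), seval f (c *: x + y) = c *: seval f x + seval f y,
        forall (x y : A), seval f (x * y) = seval f x * seval f y,
        seval f (1 : A) = 1 & forall g, seval f (sgen K par g) = f g].
Proof.
move=> fC; split.
- move=> c x y; elim/quotW: x => x; elim/quotW: y => y.
  by rewrite -piZ -piD !(seval_pi _ fC) linextP.
- move=> x y; elim/quotW: x => x; elim/quotW: y => y.
  rewrite -piM !(seval_pi _ fC).
  apply: (bilin_mul (@freeAlg_ind K G)) x y; first exact: linextP.
  by move=> v w; rewrite wordM !linext_word big_cat.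
- rewrite -[1]/(pi 1) (seval_pi _ fC) -word0 linext_word; exact: big_nil.
- move=> g; rewrite /sgen (seval_pi _ fC) linext_word big_cons big_nil.
  exact: mulr1.
Qed.

Definition sfree_super : freeSuper K par :=
  FreeSuper sfree_ind (@sgen_comm K G par) sparityP sparity1 sparityM sparity_gen slderivP
    slderivM slderiv_gen sevalP.
End Sfree.

Section SuperToolkit.
Variables (K : fieldType) (G : choiceType) (par : G -> bool).
Variable A : freeSuper K par.
Implicit Types (x y z : A) (g h : G) (e f : bool).
Local Notation prt := (@prt K G par A).
Local Notation gen := (@gen K G par A).

Lemma prtD x y : prt (x + y) = prt x + prt y.
Proof. by rewrite -[x]scale1r prtP !scale1r. Qed.

Lemma prt0 : prt 0 = 0.
Proof. by apply: (addrI (prt 0)); rewrite -prtD !addr0. Qed.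

Lemma prtZ c x : prt (c *: x) = c *: prt x.
Proof. by rewrite -[c *: x]addr0 prtP prt0 addr0. Qed.

Lemma prtK : involutive prt.
Proof.
move=> x; elim/gen_ind: x => [|g x IH|c x y IHx IHy]; first by rewrite !prt1.
  rewrite prtM prt_gen -scalerAl prtZ prtM prt_gen IH -scalerAl scalerA.
  by rewrite -signr_addb addbb scale1r.
by rewrite !prtP IHx IHy.
Qed.

(** Parity as an eigenvalue of the involution, so that signs are obtained by
    rewriting; 0 has both parities. *)
Definition homog e x := prt x = (-1) ^+ e *: x.

Lemma homogM e f x y : homog e x -> homog f y -> homog (e (+) f) (x * y).
Proof.
rewrite /homog prtM => -> ->.
by rewrite -scalerAl -scalerAr scalerA signr_addb.
Qed.

Lemma homogMb a e f x y :
  homog e x -> homog f y -> a = e (+) f -> homog a (x * y).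
Proof. by move=> hx hy ->; apply: homogM. Qed.

Lemma homog1 : homog false 1.
Proof. by rewrite /homog prt1 scale1r. Qed.

Lemma homog0 e : homog e 0.
Proof. by rewrite /homog prt0 scaler0. Qed.

Lemma homogD e x y : homog e x -> homog e y -> homog e (x + y).
Proof. by rewrite /homog prtD scalerDr => -> ->. Qed.

Lemma homogZ e c x : homog e x -> homog e (c *: x).
Proof. by rewrite /homog prtZ => ->; rewrite !scalerA mulrC. Qed.

Lemma homogN e x : homog e x -> homog e (- x).
Proof. by rewrite -scaleN1r; apply: homogZ. Qed.

Lemma homogB e x y : homog e x -> homog e y -> homog e (x - y).
Proof. by move=> hx hy; apply/homogD/homogN. Qed.

Lemma homog_sum (I : Type) (r : seq I) (P : pred I) (F : I -> A) e :
  (forall i, P i -> homog e (F i)) -> homog e (\sum_(i <- r | P i) F i).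
Proof.
by move=> hF; apply: (big_ind (homog e)) => //;
  [apply: homog0 | apply: homogD].
Qed.

Lemma homog_gen g : homog (par g) (gen g).
Proof. exact: prt_gen. Qed.

Lemma homog_delta e (t : bool) x : (t -> homog e x) -> homog e (t%:R *: x).
Proof. by case: t => [/(_ isT) | _]; [apply: homogZ | rewrite scale0r; apply: homog0]. Qed.

(** The automorphism x |-> (-1)^(e[x]) x, which records the sign for moving
    an element of parity [e] past [x]. *)
Definition twist e x := iter e prt x.

Lemma twistP e c x y : twist e (c *: x + y) = c *: twist e x + twist e y.
Proof. by rewrite /twist; case: e => //=; rewrite prtP. Qed.

Lemma twistM e x y : twist e (x * y) = twist e x * twist e y.
Proof. by rewrite /twist; case: e => //=; rewrite prtM. Qed.

Lemma twist1 e : twist e 1 = 1.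
Proof. by rewrite /twist; case: e => //=; rewrite prt1. Qed.

Lemma twist0 e : twist e 0 = 0.
Proof. by rewrite /twist; case: e => //=; rewrite prt0. Qed.

Lemma twistD e x y : twist e (x + y) = twist e x + twist e y.
Proof. by rewrite /twist; case: e => //=; rewrite prtD. Qed.

Lemma twist_homog e f x : homog f x -> twist e x = (-1) ^+ (e && f) *: x.
Proof. by rewrite /twist; case: e => //= _; rewrite scale1r. Qed.

Lemma twistK e : involutive (twist e).
Proof. by rewrite /twist; case: e => // x; apply: prtK. Qed.

Lemma homog_twist e f x : homog f x -> homog f (twist e x).
Proof. by move=> hx; rewrite (twist_homog _ hx); apply: homogZ. Qed.

Lemma gen_mul_twist g x : gen g * x = twist (par g) x * gen g.
Proof.
elim/gen_ind: x => [|h x IH|c x y IHx IHy].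
- by rewrite twist1 mulr1 mul1r.
- rewrite mulrA gen_comm -scalerAl -mulrA IH twistM mulrA.
  by rewrite (twist_homog _ (homog_gen h)) -!scalerAl.
- by rewrite twistP mulrDr mulrDl -scalerAr -scalerAl IHx IHy.
Qed.

Lemma homog_comm f x y : homog f y -> x * y = y * twist f x.
Proof.
move=> hy; elim/gen_ind: x => [|g x IH|c x z IHx IHz].
- by rewrite twist1 mulr1 mul1r.
- rewrite -mulrA IH mulrA gen_mul_twist (twist_homog _ hy).
  rewrite twistM (twist_homog _ (homog_gen g)) -!scalerAl -scalerAr -mulrA.
  by rewrite andbC.
- by rewrite twistP mulrDr mulrDl -scalerAr -scalerAl IHx IHz.
Qed.

Lemma homog_commE e f x y : homog e x -> homog f y ->
  x * y = (-1) ^+ (e && f) *: (y * x).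
Proof.
by move=> hx hy; rewrite (homog_comm x hy) (twist_homog _ hx) andbC -scalerAr.
Qed.

(** The combinations of homogeneous elements which satisfy [Q] are stable
    under the multiplication by generators, hence fill the algebra. *)
Lemma homog_ind (Q : A -> Prop) :
  Q 1 -> (forall g e x, homog e x -> Q x -> Q (gen g * x)) ->
  (forall c x y, Q x -> Q y -> Q (c *: x + y)) -> forall x, Q x.
Proof.
move=> Q1 Qg Ql x.
pose Q' x := exists (s : seq (K * {e : bool & {y | homog e y /\ Q y}})),
  x = \sum_(u <- s) u.1 *: sval (tagged u.2).
suff [s ->] : Q' x.
  elim: s => [|[c [e [y [hy Qy]]]] s IH].
    by rewrite big_nil -(addNr 1) -scaleN1r; apply: Ql.
  by rewrite big_cons; apply: Ql.
elim/gen_ind: x => [|g x [s ->]|c x y [s ->] [t ->]].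
- exists [:: (1, existT _ false (exist _ 1 (conj homog1 Q1)))].
  by rewrite big_seq1 scale1r.
- pose f (u : {e : bool & {y | homog e y /\ Q y}}) : {e : bool & {y | homog e y /\ Q y}} :=
    let: existT e (exist y (conj hy Qy)) := u in
    existT _ (par g (+) e) (exist _ (gen g * y) (conj (homogM (homog_gen g) hy) (Qg g e y hy Qy))).
  exists [seq (u.1, f u.2) | u <- s]; rewrite big_map mulr_sumr.
  by apply: eq_bigr => -[c [e [y [hy Qy]]]] _ /=; rewrite scalerAr.
- exists ([seq (c * u.1, u.2) | u <- s] ++ t).
  rewrite big_cat big_map scaler_sumr; congr (_ + _).
  by apply: eq_bigr => u _; rewrite scalerA.
Qed.

Lemma derD h x y : der h (x + y) = der h x + der h y.
Proof. by rewrite -[x]scale1r derP !scale1r. Qed.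

Lemma der0 h : der h (0 : A) = 0.
Proof. by apply: (addrI (der h 0)); rewrite -derD !addr0. Qed.

Lemma derZ h c x : der h (c *: x) = c *: der h x.
Proof. by rewrite -[c *: x]addr0 derP der0 addr0. Qed.

Lemma derMt h x y :
  der h (x * y) = der h x * y + twist (par h) x * der h y.
Proof. exact: derM. Qed.

Lemma der1 h : der h (1 : A) = 0.
Proof.
by apply: (addrI (der h 1)); rewrite addr0 -[in RHS](mulr1 1) derMt mulr1 twist1 mul1r.
Qed.

Lemma prt_der h x : prt (der h x) = (-1) ^+ par h *: der h (prt x).
Proof.
elim/gen_ind: x => [|g x IH|c x y IHx IHy].
- by rewrite prt1 der1 prt0 scaler0.
- rewrite prtM !derMt prtD !prtM IH prt_gen derZ der_gen scalerDr.
  rewrite (twist_homog _ (homog_gen g)) -scalerAl.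
  rewrite -[twist _ (_ *: gen g)]/(twist _ (_ *: gen g)).
  rewrite (twist_homog _ (homogZ _ (homog_gen g))) prtZ prt_gen !scalerA.
  congr (_ + _).
    case: eqP => [->|_]; last by rewrite prt0 !mul0r scaler0.
    by rewrite prt1 -signr_addb addbb scale1r.
  by rewrite -!scalerAl -!scalerAr !scalerA mulrC mulrA.
- by rewrite !(prtP, derP) IHx IHy scalerDr !scalerA mulrC.
Qed.

Lemma homog_der h e x : homog e x -> homog (e (+) par h) (der h x).
Proof. by move=> hx; rewrite /homog prt_der hx derZ scalerA signr_addb mulrC. Qed.

(** The right derivative, which differs from the left one by the sign
    (-1)^([g]([x] + [g])) on homogeneous elements. *)
Definition rder g x := iter (par g) prt (der g x).

Lemma rderE g x : rder g x = twist (par g) (der g x).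
Proof. by []. Qed.

Lemma rderP g c x y : rder g (c *: x + y) = c *: rder g x + rder g y.
Proof. by rewrite !rderE derP twistP. Qed.

Lemma rderM g x y :
  rder g (x * y) = rder g x * twist (par g) y + x * rder g y.
Proof. by rewrite !rderE derMt twistD !twistM twistK. Qed.

Lemma rder_gen h g : rder h (gen g) = (g == h)%:R.
Proof. by rewrite rderE der_gen; case: eqP; rewrite ?twist1 ?twist0. Qed.

Lemma homog_rder h e x : homog e x -> homog (e (+) par h) (rder h x).
Proof. by move=> /(homog_der h); rewrite rderE; apply: homog_twist. Qed.

(** Only the letters of a finite alphabet contribute to a derivative, which
    makes the sum over all pairs of generators in the bracket finite. *)
Definition alphabet (s : seq G) x := forall h, h \notin s -> der h x = 0.

Lemma alphabet_ex x : exists s, alphabet s x.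
Proof.
elim/gen_ind: x => [|g x [s hs]|c x y [s hs] [t ht]].
- by exists [::] => h _; rewrite der1.
- exists (g :: s) => h; rewrite inE negb_or eq_sym => /andP[/negPf gh /hs hx].
  by rewrite derMt hx der_gen gh mul0r mulr0 addr0.
- exists (s ++ t) => h; rewrite mem_cat negb_or => /andP[/hs hx /ht hy].
  by rewrite derP hx hy scaler0 addr0.
Qed.

Lemma alphabetS (s t : seq G) x : {subset s <= t} -> alphabet s x -> alphabet t x.
Proof. by move=> st hs h ht; apply/hs/contra/ht/st. Qed.

Lemma alphabet2 x y : exists s, [/\ uniq s, alphabet s x & alphabet s y].
Proof.
have [s hs] := alphabet_ex x; have [t ht] := alphabet_ex y.
exists (undup (s ++ t)); split; first exact: undup_uniq.
- by apply: alphabetS hs => g gs; rewrite mem_undup mem_cat gs.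
- by apply: alphabetS ht => g gs; rewrite mem_undup mem_cat gs orbT.
Qed.

Lemma alphabet3 x y z :
  exists s, [/\ uniq s, alphabet s x, alphabet s y & alphabet s z].
Proof.
have [s [us hx hy]] := alphabet2 x y; have [t ht] := alphabet_ex z.
exists (undup (s ++ t)); split; first exact: undup_uniq.
- by apply: alphabetS hx => g gs; rewrite mem_undup mem_cat gs.
- by apply: alphabetS hy => g gs; rewrite mem_undup mem_cat gs.
- by apply: alphabetS ht => g gs; rewrite mem_undup mem_cat gs orbT.
Qed.

Lemma alphabetP s c x y :
  alphabet s x -> alphabet s y -> alphabet s (c *: x + y).
Proof. by move=> hx hy h hs; rewrite derP hx // hy // scaler0 addr0. Qed.

Lemma alphabetM s x y :
  alphabet s x -> alphabet s y -> alphabet s (x * y).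
Proof. by move=> hx hy h hs; rewrite derMt hx // hy // mul0r mulr0 addr0. Qed.

Definition br (b : G -> G -> A) x y : A :=
  \sum_(u \in [set: G * G]) rder u.1 x * b u.1 u.2 * der u.2 y.

Variable b : G -> G -> A.

Lemma brE s x y : uniq s -> alphabet s x -> alphabet s y ->
  br b x y = \sum_(g <- s) \sum_(h <- s) rder g x * b g h * der h y.
Proof.
move=> us hx hy; rewrite /br.
rewrite (fsbigE [seq (g, h) | g <- s, h <- s]).
- rewrite (eq_bigl xpredT) => [|i]; last by rewrite in_setT.
  exact: big_allpairs.
- by apply: allpairs_uniq => // -[g h] [g' h'].
- by [].
- move=> [g h] /= _; apply: contraNeq => gh0.
  apply/allpairsP; exists (g, h); split=> //=.
    by apply/negPn/negP => /hx g0; rewrite rderE g0 twist0 !mul0r eqxx in gh0.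
  by apply/negPn/negP => /hy h0; rewrite h0 mulr0 eqxx in gh0.
Qed.

Lemma brPl c x y z : br b (c *: x + y) z = c *: br b x z + br b y z.
Proof.
have [s [us hx hy hz]] := alphabet3 x y z.
rewrite !(@brE s) //; last exact: alphabetP.
rewrite scaler_sumr -big_split; apply: eq_bigr => g _ /=.
rewrite scaler_sumr -big_split; apply: eq_bigr => h _ /=.
by rewrite rderP !mulrDl !scalerAl.
Qed.

Lemma brPr c x y z : br b z (c *: x + y) = c *: br b z x + br b z y.
Proof.
have [s [us hx hy hz]] := alphabet3 x y z.
rewrite !(@brE s) //; last exact: alphabetP.
rewrite scaler_sumr -big_split; apply: eq_bigr => g _ /=.
rewrite scaler_sumr -big_split; apply: eq_bigr => h _ /=.
by rewrite derP !mulrDr !scalerAr.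
Qed.

Lemma br_gen g h : br b (gen g) (gen h) = b g h.
Proof.
have [s [us gs hs]] := alphabet2 (gen g) (gen h).
have mem k : alphabet s (gen k) -> (1 : A) != 0 -> k \in s.
  move=> ks nz; apply/negPn/negP => /ks; rewrite der_gen eqxx => /eqP.
  by rewrite (negPf nz).
have /mem/(_ (oner_neq0 _)) {}mg := gs; have /mem/(_ (oner_neq0 _)) {}mh := hs.
rewrite (brE us) // (bigD1_seq g) //= [X in _ + X]big1 => [|k /negPf gk].
  rewrite addr0 (bigD1_seq h) //= rder_gen der_gen !eqxx.
  rewrite big1 => [|k /negPf hk]; last by rewrite der_gen eq_sym hk mulr0.
  by rewrite mul1r mulr1 addr0.
by apply: big1 => l _; rewrite rder_gen eq_sym gk !mul0r.
Qed.

Hypothesis hb : forall g h, homog (par g (+) par h) (b g h).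

Lemma brMr e f x y z : homog e x -> homog f y ->
  br b x (y * z) = br b x y * z + (-1) ^+ (e && f) *: (y * br b x z).
Proof.
move=> hx hy; have [s [us ax ay az]] := alphabet3 x y z.
rewrite !(@brE s) //; last exact: alphabetM.
rewrite mulr_suml mulr_sumr scaler_sumr -big_split; apply: eq_bigr => g _ /=.
rewrite mulr_suml mulr_sumr scaler_sumr -big_split; apply: eq_bigr => h _ /=.
rewrite derMt mulrDr !mulrA; congr (_ + _).
rewrite (twist_homog _ hy) -scalerAr -scalerAl.
rewrite (homog_commE (homogM (homog_rder g hx) (hb g h)) hy) -scalerAl scalerA.
rewrite -signr_addb !mulrA.
by congr (_ ^+ _ *: _); case: (e) (f) (par g) (par h) => [] [] [] [].
Qed.

Lemma brMl e f x y z : homog e y -> homog f z ->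
  br b (x * y) z = x * br b y z + (-1) ^+ (e && f) *: (br b x z * y).
Proof.
move=> hy hz; have [s [us ax ay az]] := alphabet3 x y z.
rewrite !(@brE s) //; last exact: alphabetM.
rewrite mulr_suml mulr_sumr scaler_sumr -big_split; apply: eq_bigr => g _ /=.
rewrite mulr_suml mulr_sumr scaler_sumr -big_split; apply: eq_bigr => h _ /=.
rewrite rderM !mulrDl addrC !mulrA; congr (_ + _).
rewrite (twist_homog _ hy) -scalerAr -!scalerAl -!mulrA.
rewrite (homog_commE hy (homogM (hb g h) (homog_der h hz))) -!scalerAr scalerA -signr_addb.
by rewrite -!mulrA; congr (_ ^+ _ *: _); case: (e) (f) (par g) (par h) => [] [] [] [].
Qed.

Lemma homog_br e f x y : homog e x -> homog f y -> homog (e (+) f) (br b x y).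
Proof.
move=> hx hy; have [s [us ax ay]] := alphabet2 x y.
rewrite (brE us) //; apply: homog_sum => g _; apply: homog_sum => h _.
apply: homogMb (homogM (homog_rder g hx) (hb g h)) (homog_der h hy) _.
by case: (e) (f) (par g) (par h) => [] [] [] [].
Qed.
End SuperToolkit.

(** * Morphisms and biderivations *)

Record algHom (K : nzRingType) (A B : algType K) (f : A -> B) : Prop := AlgHom {
  homP : forall c x y, f (c *: x + y) = c *: f x + f y;
  homM : forall x y, f (x * y) = f x * f y;
  hom1 : f 1 = 1
}.

Section AlgHomTheory.
Variables (K : nzRingType) (A B : algType K) (f : A -> B).
Hypothesis hf : algHom f.

Lemma homD x y : f (x + y) = f x + f y.
Proof. by rewrite -[x]scale1r (homP hf) !scale1r. Qed.

Lemma hom0 : f 0 = 0.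
Proof. by apply: (addrI (f 0)); rewrite -homD !addr0. Qed.

Lemma homZ c x : f (c *: x) = c *: f x.
Proof. by rewrite -[c *: x]addr0 (homP hf) hom0 addr0. Qed.

Lemma homN x : f (- x) = - f x.
Proof. by rewrite -scaleN1r homZ scaleN1r. Qed.

Lemma homB x y : f (x - y) = f x - f y.
Proof. by rewrite homD homN. Qed.

Lemma hom_sum (I : Type) (r : seq I) (P : pred I) (F : I -> A) :
  f (\sum_(i <- r | P i) F i) = \sum_(i <- r | P i) f (F i).
Proof. exact: (big_morph f homD hom0). Qed.
End AlgHomTheory.

Lemma algHom_id (K : nzRingType) (A : algType K) : algHom (@id A).
Proof. by []. Qed.

Lemma algHom_comp (K : nzRingType) (A B C : algType K) (f : B -> C) (g : A -> B) :
  algHom f -> algHom g -> algHom (f \o g).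
Proof.
move=> hf hg; split=> [c x y|x y|] /=.
- by rewrite (homP hg) (homP hf).
- by rewrite (homM hg) (homM hf).
- by rewrite (hom1 hg) (hom1 hf).
Qed.

Section HomogLin.
Variables (K : fieldType) (G : choiceType) (par : G -> bool) (A : freeSuper K par).

Lemma homog_lin_ind (Q : A -> Prop) : (forall e x, homog e x -> Q x) ->
  (forall c x y, Q x -> Q y -> Q (c *: x + y)) -> forall x, Q x.
Proof.
move=> Qh Ql; elim/homog_ind => [|g e x hx _|c x y Qx Qy].
- exact/Qh/homog1.
- exact/Qh/(homogM (homog_gen _ g) hx).
- exact: Ql.
Qed.

Lemma algHom_eq (B : algType K) (f g : A -> B) : algHom f -> algHom g ->
  (forall u, f (gen A u) = g (gen A u)) -> f =1 g.
Proof.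
move=> hf hg fg; elim/gen_ind => [|u x IH|c x y IHx IHy].
- by rewrite (hom1 hf) (hom1 hg).
- by rewrite (homM hf) (homM hg) fg IH.
- by rewrite (homP hf) (homP hg) IHx IHy.
Qed.

Lemma ev_hom (B : algType K) (f : G -> B) :
  (forall g h, f g * f h = (-1) ^+ (par g && par h) *: (f h * f g)) ->
  algHom (@ev _ _ _ A B f).
Proof. by move=> /(evP A)[fP fM f1 _]. Qed.

Lemma ev_gen (B : algType K) (f : G -> B) :
  (forall g h, f g * f h = (-1) ^+ (par g && par h) *: (f h * f g)) ->
  forall g, @ev _ _ _ A B f (gen A g) = f g.
Proof. by move=> /(evP A)[_ _ _]. Qed.
End HomogLin.

Section EvHomog.
Variables (K : fieldType) (G H : choiceType) (par : G -> bool) (par' : H -> bool).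
Variables (A : freeSuper K par) (B : freeSuper K par').

Definition homog_pres (f : A -> B) := forall e x, homog e x -> homog e (f x).

(** Such a morphism commutes with the parity involutions, as it does on the
    generators. *)
Lemma homog_presP (f : A -> B) : algHom f ->
  (forall g, homog (par g) (f (gen A g))) -> homog_pres f.
Proof.
move=> hf fg.
have main x : f (prt x) = prt (f x).
  elim/gen_ind: x => [|g x IH|c x y IHx IHy].
  - by rewrite prt1 (hom1 hf) prt1.
  - by rewrite prtM !(homM hf) prtM IH prt_gen (homZ hf) fg.
  - by rewrite prtP !(homP hf) prtP IHx IHy.
by move=> e x hx; rewrite /homog -main hx (homZ hf).
Qed.

Lemma homog_ev_comm (f : G -> B) : (forall g, homog (par g) (f g)) ->
  forall g h, f g * f h = (-1) ^+ (par g && par h) *: (f h * f g).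
Proof. by move=> fg g h; apply: homog_commE. Qed.
End EvHomog.

Section Biderivation.
Variables (K : fieldType) (G : choiceType) (par : G -> bool) (P : freeSuper K par).

(** A biderivation along a morphism [h]. A bracket followed by a restriction
    map, or preceded by an extension map, is again of this kind, so that
    brackets which live on different algebras can be compared on generators. *)
Record bider (B : algType K) (h : P -> B) (beta : P -> P -> B) : Prop := Bider {
  bdPl : forall c x y z, beta (c *: x + y) z = c *: beta x z + beta y z;
  bdPr : forall c x y z, beta z (c *: x + y) = c *: beta z x + beta z y;
  bdMl : forall e f x y z, homog e y -> homog f z ->
    beta (x * y) z = h x * beta y z + (-1) ^+ (e && f) *: (beta x z * h y);
  bdMr : forall e f x y z, homog e x -> homog f y ->
    beta x (y * z) = beta x y * h z + (-1) ^+ (e && f) *: (h y * beta x z)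
}.

Section Theory.
Variables (B : algType K) (h : P -> B) (beta : P -> P -> B).
Hypothesis hh : algHom h.
Hypothesis hb : bider h beta.

Lemma bd0l z : beta 0 z = 0.
Proof. by rewrite -(addNr 0) -scaleN1r (bdPl hb) scaleN1r addNr. Qed.

Lemma bd0r z : beta z 0 = 0.
Proof. by rewrite -(addNr 0) -scaleN1r (bdPr hb) scaleN1r addNr. Qed.

Lemma bdZl c x z : beta (c *: x) z = c *: beta x z.
Proof. by rewrite -[c *: x]addr0 (bdPl hb) bd0l addr0. Qed.

Lemma bdZr c x z : beta z (c *: x) = c *: beta z x.
Proof. by rewrite -[c *: x]addr0 (bdPr hb) bd0r addr0. Qed.

Lemma bdDl x y z : beta (x + y) z = beta x z + beta y z.
Proof. by rewrite -[x]scale1r (bdPl hb) !scale1r. Qed.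

Lemma bdDr x y z : beta z (x + y) = beta z x + beta z y.
Proof. by rewrite -[x]scale1r (bdPr hb) !scale1r. Qed.

Lemma bd_suml (I : Type) (r : seq I) (Q : pred I) (F : I -> P) z :
  beta (\sum_(i <- r | Q i) F i) z = \sum_(i <- r | Q i) beta (F i) z.
Proof. exact: (big_morph (beta^~ z) (fun x y => bdDl x y z) (bd0l z)). Qed.

Lemma bd_sumr (I : Type) (r : seq I) (Q : pred I) (F : I -> P) z :
  beta z (\sum_(i <- r | Q i) F i) = \sum_(i <- r | Q i) beta z (F i).
Proof. exact: (big_morph (beta z) (fun x y => bdDr x y z) (bd0r z)). Qed.

Lemma bd1l z : beta 1 z = 0.
Proof.
elim/homog_lin_ind: z => [e z hz|c x y IHx IHy]; last first.
  by rewrite (bdPr hb) IHx IHy scaler0 addr0.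
apply: (addrI (beta 1 z)); rewrite addr0 -[in RHS](mulr1 1).
by rewrite (bdMl hb _ (homog1 P) hz) scale1r (hom1 hh) mulr1 mul1r.
Qed.

Lemma bd1r z : beta z 1 = 0.
Proof.
elim/homog_lin_ind: z => [e z hz|c x y IHx IHy]; last first.
  by rewrite (bdPl hb) IHx IHy scaler0 addr0.
apply: (addrI (beta z 1)); rewrite addr0 -[in RHS](mulr1 1).
by rewrite (bdMr hb _ hz (homog1 P)) andbF scale1r (hom1 hh) mulr1 mul1r.
Qed.

Lemma bd_scalarl c z : beta (c%:A) z = 0.
Proof. by rewrite bdZl bd1l scaler0. Qed.

Lemma bd_scalarr c z : beta z (c%:A) = 0.
Proof. by rewrite bdZr bd1r scaler0. Qed.
End Theory.

(** By the Leibniz rules, both sides are determined by their values on the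
    generators. *)
Lemma bider_eq (B : algType K) (h : P -> B) (b b' : P -> P -> B) :
  algHom h -> bider h b -> bider h b' ->
  (forall u v, b (gen P u) (gen P v) = b' (gen P u) (gen P v)) ->
  forall x y, b x y = b' x y.
Proof.
move=> hh hb hb' bb' x y.
have bg u z : b (gen P u) z = b' (gen P u) z.
  elim/gen_ind: z => [|g z IH|c z z' IHx IHy].
  - by rewrite (bd1r hh hb) (bd1r hh hb').
  - rewrite (bdMr hb _ (homog_gen P u) (homog_gen P g)).
    by rewrite (bdMr hb' _ (homog_gen P u) (homog_gen P g)) IH bb'.
  - by rewrite (bdPr hb) (bdPr hb') IHx IHy.
elim/homog_lin_ind: y => [f y hy|c z z' IHx IHy]; last first.
  by rewrite (bdPr hb) (bdPr hb') IHx IHy.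
elim/homog_ind: x => [|g e x hx IH|c z z' IHx IHy].
- by rewrite (bd1l hh hb) (bd1l hh hb').
- by rewrite (bdMl hb _ hx hy) (bdMl hb' _ hx hy) bg IH.
- by rewrite (bdPl hb) (bdPl hb') IHx IHy.
Qed.

Lemma bider_post (B C : algType K) (h : P -> B) (b : P -> P -> B) (f : B -> C) :
  algHom f -> bider h b -> bider (f \o h) (fun x y => f (b x y)).
Proof.
move=> hf hb; split.
- by move=> c x y z; rewrite (bdPl hb) (homP hf).
- by move=> c x y z; rewrite (bdPr hb) (homP hf).
- move=> e e' x y z hy hz.
  by rewrite (bdMl hb x hy hz) (homD hf) (homZ hf) !(homM hf).
- move=> e e' x y z hx hy.
  by rewrite (bdMr hb z hx hy) (homD hf) (homZ hf) !(homM hf).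
Qed.

Lemma bider_br (b : G -> G -> P) :
  (forall g h, homog (par g (+) par h) (b g h)) -> bider id (br b).
Proof.
move=> hb; split.
- exact: brPl.
- exact: brPr.
- by move=> e f x y z hy hz; apply: (brMl hb).
- by move=> e f x y z hx hy; apply: (brMr hb).
Qed.
End Biderivation.

Lemma bider_pre (K : fieldType) (G H : choiceType) (par : G -> bool)
    (par' : H -> bool) (P : freeSuper K par) (Q : freeSuper K par')
    (B : algType K) (h : P -> B) (b : P -> P -> B) (k : Q -> P) :
  algHom k -> homog_pres k -> bider h b ->
  bider (h \o k) (fun x y => b (k x) (k y)).
Proof.
move=> hk pk hb; split.
- by move=> c x y z; rewrite (homP hk) (bdPl hb).
- by move=> c x y z; rewrite (homP hk) (bdPr hb).
- by move=> e f x y z hy hz; rewrite (homM hk) (bdMl hb _ (pk _ _ hy) (pk _ _ hz)).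
- by move=> e f x y z hx hy; rewrite (homM hk) (bdMr hb _ (pk _ _ hx) (pk _ _ hy)).
Qed.

(** * The Dirac bracket *)

Section Dirac.
Variables (K : fieldType) (G H : choiceType) (par : G -> bool) (par' : H -> bool).
Variables (P : freeSuper K par) (A : freeSuper K par').
Variables (b : G -> G -> P).
Hypothesis hb : forall g h, homog (par g (+) par h) (b g h).
Variables (rho : P -> A).
Hypotheses (hrho : algHom rho) (prho : homog_pres rho).
Variables (n : nat) (phi : 'I_n -> P) (ep : 'I_n -> bool).
Hypothesis hphi : forall i, homog (ep i) (phi i).

Definition constraint_mx : 'M[A]_n := \matrix_(i, j) rho (br b (phi i) (phi j)).

Variable D : 'M[A]_n.
Hypotheses (DE : constraint_mx *m D = 1%:M) (ED : D *m constraint_mx = 1%:M).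

Lemma homog_constraint i j : homog (ep i (+) ep j) (constraint_mx i j).
Proof. by rewrite mxE; apply/prho/homog_br. Qed.

(** The inverse of the constraint matrix is homogeneous because the parity
    involution carries an inverse to an inverse, and inverses are unique. *)
Lemma homog_inverse i j : homog (ep i (+) ep j) (D i j).
Proof.
pose D' := \matrix_(i, j) ((-1) ^+ (ep i (+) ep j) *: prt (D i j)) : 'M[A]_n.
suff /matrixP/(_ i j) : D' = D.
  by rewrite mxE /homog => {2}<-; rewrite scalerA -signr_addb addbb scale1r.
suff DE' : constraint_mx *m D' = 1%:M.
  by rewrite -[D']mul1mx -ED -mulmxA DE' mulmx1.
apply/matrixP => i' j'; rewrite mxE.
have := congr1 (fun X : 'M[A]_n => (-1) ^+ (ep i' (+) ep j') *: prt (X i' j')) DE.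
rewrite !mxE (big_morph (@prt _ _ _ A) (@prtD _ _ _ A) (@prt0 _ _ _ A)) scaler_sumr => e.
transitivity ((-1) ^+ (ep i' (+) ep j') *: @prt _ _ _ A ((i' == j')%:R)); last first.
  case: eqP => [->|_]; last by rewrite prt0 scaler0.
  by rewrite addbb scale1r prt1.
rewrite -e; apply: eq_bigr => k _; rewrite prtM homog_constraint !mxE.
rewrite -!scalerAr -scalerAl !scalerA -signr_addb.
by congr ((-1) ^+ _ *: _); case: (ep i') (ep j') (ep k) => [] [] [].
Qed.

Definition dbr (F F' : P) : A := rho (br b F F')
  - \sum_(i < n) \sum_(j < n)
      rho (br b F (phi i)) * D i j * rho (br b (phi j) F').

Let hbr := bider_br hb.
Let hrb := bider_post hrho hbr.

Lemma bider_dbr : bider rho dbr.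
Proof.
split.
- move=> c x y z; rewrite /dbr !(brPl, homP hrho) scalerBr [RHS]addrACA -opprD.
  congr (_ - _); rewrite scaler_sumr.
  rewrite -big_split; apply: eq_bigr => i _ /=.
  rewrite scaler_sumr -big_split; apply: eq_bigr => j _ /=.
  by rewrite brPl (homP hrho) !mulrDl -!scalerAl.
- move=> c x y z; rewrite /dbr !(brPr, homP hrho) scalerBr [RHS]addrACA -opprD.
  congr (_ - _); rewrite scaler_sumr.
  rewrite -big_split; apply: eq_bigr => i _ /=.
  rewrite scaler_sumr -big_split; apply: eq_bigr => j _ /=.
  by rewrite brPr (homP hrho) !mulrDr -!scalerAr.
- move=> e f x y z hy hz; rewrite /dbr mulrBr mulrBl scalerBr [RHS]addrACA -opprD.
  congr (_ - _); first by rewrite (bdMl hrb x hy hz).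
  rewrite mulr_sumr mulr_suml scaler_sumr -big_split; apply: eq_bigr => i _ /=.
  rewrite mulr_sumr mulr_suml scaler_sumr -big_split; apply: eq_bigr => j _ /=.
  rewrite (bdMl hrb x hy (hphi i)) /= !mulrDl !mulrA; congr (_ + _).
  rewrite -!scalerAl -!mulrA.
  rewrite [rho y * _](homog_commE (prho hy)
    (homogM (homog_inverse i j) (prho (homog_br hb (hphi j) hz)))).
  rewrite -!scalerAr scalerA -signr_addb !mulrA.
  by congr ((-1) ^+ _ *: _); case: (e) (f) (ep i) (ep j) => [] [] [] [].
- move=> e f x y z hx hy; rewrite /dbr mulrBr mulrBl scalerBr [RHS]addrACA -opprD.
  congr (_ - _); first by rewrite (bdMr hrb z hx hy).
  rewrite mulr_sumr mulr_suml scaler_sumr -big_split; apply: eq_bigr => i _ /=.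
  rewrite mulr_sumr mulr_suml scaler_sumr -big_split; apply: eq_bigr => j _ /=.
  rewrite (bdMr hrb z (hphi j) hy) /= !mulrDr !mulrA; congr (_ + _).
  rewrite -!scalerAr !mulrA.
  rewrite [_ * rho y](homog_commE (homogM (prho (homog_br hb hx (hphi i)))
     (homog_inverse i j)) (prho hy)).
  rewrite -!scalerAl scalerA -signr_addb !mulrA.
  by congr ((-1) ^+ _ *: _); case: (e) (f) (ep i) (ep j) => [] [] [] [].
Qed.

(** Here D is multiplied by a row of the matrix that it inverts: the
    correction term is made in such a way that the constraints become
    central for the bracket. *)
Lemma dbr_phil k F : dbr (phi k) F = 0.
Proof.
rewrite /dbr exchange_big /=; apply/eqP; rewrite subr_eq0; apply/eqP.
transitivity (\sum_(j < n) (1%:M : 'M[A]_n) k j * rho (br b (phi j) F)).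
  rewrite (bigD1 k) //= mxE eqxx mul1r big1 ?addr0 // => j /negPf jk.
  by rewrite mxE eq_sym jk mul0r.
rewrite -DE; apply: eq_bigr => j _; rewrite mxE mulr_suml.
by apply: eq_bigr => i _; rewrite mxE.
Qed.

Lemma dbr_phir k F : dbr F (phi k) = 0.
Proof.
rewrite /dbr; apply/eqP; rewrite subr_eq0; apply/eqP.
transitivity (\sum_(j < n) rho (br b F (phi j)) * (1%:M : 'M[A]_n) j k).
  rewrite (bigD1 k) //= mxE eqxx mulr1 big1 ?addr0 // => j /negPf jk.
  by rewrite mxE jk mulr0.
rewrite -ED; apply: eq_bigr => j _; rewrite mxE mulr_sumr.
by apply: eq_bigr => i _; rewrite mxE !mulrA.
Qed.

Variable lift : A -> P.
Hypotheses (hlift : algHom lift) (plift : homog_pres lift).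
Hypothesis liftK : forall x, rho (lift x) = x.
(* A generator and the extension of its restriction differ by a combination of
   constraints; the induction form avoids naming the coefficients. *)
Hypothesis lift_gen : forall g (Q : P -> Prop), Q (lift (rho (gen P g))) ->
  (forall x c i, Q x -> Q (x + c *: phi i)) -> Q (gen P g).

(** The Dirac bracket of two functions on the constrained manifold may be
    computed from arbitrary extensions, since it vanishes on the constraints. *)
Lemma dbr_lift F F' : dbr (lift (rho F)) (lift (rho F')) = dbr F F'.
Proof.
have hd := bider_dbr.
have hlr : algHom (lift \o rho) := algHom_comp hlift hrho.
have plr : homog_pres (lift \o rho) by move=> e x /prho/plift.
have hd' : bider rho (fun x y => dbr (lift (rho x)) (lift (rho y))).
  have := bider_pre hlr plr hd; rewrite (_ : rho \o (lift \o rho) = rho) //.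
  by apply/funext => x /=; rewrite liftK.
apply: (bider_eq hrho hd' hd) F F' => u v.
have L g F : dbr (lift (rho (gen P g))) F = dbr (gen P g) F.
  apply: (@lift_gen g (fun x => _ = dbr x F)) => // x c i ->.
  by rewrite (bdDl hd) (bdZl hd) dbr_phil scaler0 addr0.
have R g F : dbr F (lift (rho (gen P g))) = dbr F (gen P g).
  apply: (@lift_gen g (fun x => _ = dbr F x)) => // x c i ->.
  by rewrite (bdDr hd) (bdZr hd) dbr_phir scaler0 addr0.
by rewrite L R.
Qed.

Lemma bider_lift : bider id (fun x y => dbr (lift x) (lift y)).
Proof.
have := bider_pre hlift plift bider_dbr; rewrite (_ : rho \o lift = id) //.
by apply/funext => x /=; rewrite liftK.
Qed.
End Dirac.

(** * Powers of a matrix in the adjoint representation *)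

Lemma sum_delta (K : nzRingType) (V : lmodType K) (T : finType) (j : T) (F : T -> V) :
  \sum_e (e == j)%:R *: F e = F j.
Proof.
rewrite (bigD1 j) //= eqxx scale1r big1 ?addr0 // => e /negPf ej.
by rewrite ej scale0r.
Qed.

Lemma sum_delta' (K : nzRingType) (V : lmodType K) (T : finType) (j : T) (F : T -> V) :
  \sum_e (j == e)%:R *: F e = F j.
Proof. by under eq_bigr do rewrite eq_sym; apply: sum_delta. Qed.

Section MatrixPowers.
Variables (K : fieldType) (G : choiceType) (par : G -> bool) (P : freeSuper K par).
Variables (beta : P -> P -> P).
Hypothesis hbeta : bider id beta.
Variables (T : finType) (pt : T -> bool) (y : T -> T -> P).
Hypothesis hy : forall i j, homog (pt i (+) pt j) (y i j).

Definition adj_sign i j k l := ((pt i (+) pt j) && (pt k (+) pt l)) (+) pt l.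

(** [X] transforms in the adjoint representation of the general linear Lie
    superalgebra spanned by the entries of [y]. The sign (-1)^(pt j) of the
    column index is absorbed in the entries [y i j], which makes ordinary
    matrix products transform in the same way. *)
Definition adjoint (X : T -> T -> P) := forall i j k l,
  beta (y i j) (X k l) = (j == k)%:R *: ((-1) ^+ pt j *: X i l)
    - (i == l)%:R *: ((-1) ^+ adj_sign i j k l *: X k j).

Hypothesis y_adj : adjoint y.

Fixpoint pw n (i j : T) : P :=
  if n is n'.+1 then \sum_e y i e * pw n' e j else (i == j)%:R.

Lemma pwD m n i j : pw (m + n) i j = \sum_e pw m i e * pw n e j.
Proof.
elim: m i => [|m IH] i.
  rewrite (bigD1 i) //= eqxx mul1r big1 ?addr0 // => e /negPf ei.
  by rewrite eq_sym ei mul0r.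
rewrite addSn /=; under eq_bigr do rewrite IH mulr_sumr.
rewrite exchange_big; apply: eq_bigr => e _ /=.
by rewrite mulr_suml; apply: eq_bigr => k _; rewrite mulrA.
Qed.

Lemma pw1 i j : pw 1 i j = y i j.
Proof.
rewrite /= (bigD1 j) //= eqxx mulr1 big1 ?addr0 // => e /negPf ->.
by rewrite mulr0.
Qed.

Lemma homog_pw n i j : homog (pt i (+) pt j) (pw n i j).
Proof.
elim: n i => [|n IH] i /=.
  by case: eqP => [->|_]; [rewrite addbb; apply: homog1 | apply: homog0].
apply: homog_sum => e _; apply: homogMb (hy i e) (IH e) _.
by case: (pt i) (pt j) (pt e) => [] [] [].
Qed.

(** The Leibniz rule yields four terms; the two which contract the inner
    index cancel. *)
Lemma adjoint_mul (X Y : T -> T -> P) :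
  (forall i j, homog (pt i (+) pt j) (X i j)) ->
  adjoint X -> adjoint Y -> adjoint (fun i j => \sum_e X i e * Y e j).
Proof.
move=> hX aX aY i j k l; rewrite (bd_sumr hbeta).
under eq_bigr => e _.
  rewrite (bdMr hbeta _ (hy i j) (hX k e)) aX aY.
  rewrite mulrBl mulrBr scalerBr -!scalerAl -!scalerAr.
  rewrite ![(-1) ^+ (_ && _) *: (_%:R *: _)]scalerA.
  rewrite ![(-1) ^+ (_ && _) * _%:R]mulrC -!scalerA.
  over.
rewrite big_split /= !sumrB sum_delta' sum_delta' -!scaler_sumr -!addrA.
congr (_ + _); rewrite addrA addrC -[RHS]addr0; congr (_ + _).
  congr (- (_ *: _)); rewrite scaler_sumr; apply: eq_bigr => e _.
  rewrite scalerA -signr_addb; congr ((-1) ^+ _ *: _); rewrite /adj_sign.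
  by case: (pt i) (pt j) (pt k) (pt l) (pt e) => [] [] [] [] [].
rewrite scalerA -signr_addb addrC; apply/eqP; rewrite subr_eq0; apply/eqP.
congr ((-1) ^+ _ *: _); rewrite /adj_sign.
by case: (pt i) (pt j) (pt k) (pt l) => [] [] [] [].
Qed.

Lemma adjoint_pw n : adjoint (pw n).
Proof.
elim: n => [|n IH]; last exact: adjoint_mul.
move=> i j k l; rewrite /= (_ : beta _ _ = 0); last first.
  by case: eqP => _; rewrite ?(bd1r (algHom_id _) hbeta) ?(bd0r hbeta).
have [->|jk] := eqVneq j k; have [->|il] := eqVneq i l;
  rewrite ?scale1r ?scale0r ?subr0 ?sub0r ?eqxx //.
- apply/eqP; rewrite eq_sym subr_eq0; apply/eqP; congr ((-1) ^+ _ *: _).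
  by rewrite /adj_sign; case: (pt k) (pt l) => [] [].
- by rewrite scaler0.
- by rewrite scaler0 oppr0.
Qed.

Definition rtt_sign j k l := (pt k && pt l) (+) (pt j && pt k) (+) (pt j && pt l).

(** The quadratic relation of the classical Yangian, in the form which the
    generating series of the powers of a matrix inherit from the resolvent
    identity. *)
Lemma pw_rtt m n i j k l :
  beta (pw m.+1 i j) (pw n k l) - beta (pw m i j) (pw n.+1 k l)
  = (-1) ^+ rtt_sign j k l *: (pw n i l * pw m k j - pw m i l * pw n k j).
Proof.
(* the Leibniz rule for a factor [y] split off from the power on the left *)
have step m' n' i' : beta (pw m'.+1 i' j) (pw n' k l)
    = (\sum_e y i' e * beta (pw m' e j) (pw n' k l))
      + (-1) ^+ rtt_sign j k l *: (pw n' i' l * pw m' k j)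
      - (i' == l)%:R *: ((-1) ^+ adj_sign i' j k l *: pw (n' + m') k j).
  rewrite /= (bd_suml hbeta) -addrA.
  under [LHS]eq_bigr => e _.
    rewrite (bdMl hbeta _ (homog_pw m' e j) (homog_pw n' k l)) adjoint_pw.
    rewrite mulrBl scalerBr -!scalerAl.
    rewrite ![(-1) ^+ (_ && _) *: (_%:R *: _)]scalerA.
    rewrite ![(-1) ^+ (_ && _) * _%:R]mulrC -!scalerA.
    over.
  rewrite big_split /= sumrB sum_delta; congr (_ + (_ - _)).
    rewrite scalerA -signr_addb; congr ((-1) ^+ _ *: _); rewrite /rtt_sign.
    by case: (pt j) (pt k) (pt l) => [] [] [].
  rewrite -scaler_sumr pwD; congr (_ *: _); rewrite scaler_sumr; apply: eq_bigr => e _.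
  rewrite scalerA -signr_addb; congr ((-1) ^+ _ *: _); rewrite /adj_sign.
  by case: (pt i') (pt j) (pt k) (pt l) (pt e) => [] [] [] [] [].
elim: m i => [|m IH] i.
  rewrite step /= big1 => [|e _]; last first.
    by case: (e == j); rewrite ?(bd1l (algHom_id _) hbeta) ?(bd0l hbeta) mulr0.
  rewrite add0r (_ : beta _ (\sum_(_ : T) _) = 0); last first.
    by case: (i == j); rewrite ?(bd1l (algHom_id _) hbeta) ?(bd0l hbeta).
  rewrite subr0 addn0 scalerBr; congr (_ - _).
  case: eqP => [->|_]; last by rewrite scale0r mul0r scaler0.
  rewrite scale1r mul1r; congr ((-1) ^+ _ *: _); rewrite /adj_sign /rtt_sign.
  by case: (pt j) (pt k) (pt l) => [] [] [].
(* The two terms with [pw (n + m).+1] cancel, since they depend on the sum of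
   the exponents only. *)
rewrite step [X in _ - X]step addSn addnS opprB addrA addrNK.
rewrite opprD addrACA -sumrB.
under eq_bigr => e _ do rewrite -mulrBr IH -scalerAr mulrBr !mulrA.
rewrite -scaler_sumr sumrB -!scalerBr -scalerDr.
by congr (_ *: _); rewrite /= !mulr_suml addrC addrA addrNK.
Qed.
End MatrixPowers.

(** * The inverse of a generating series *)

Lemma scalerCA (K : comNzRingType) (V : lmodType K) (a b : K) (v : V) :
  a *: (b *: v) = b *: (a *: v).
Proof. by rewrite !scalerA mulrC. Qed.

Section InverseSeries.
Variables (K : fieldType) (G : choiceType) (par : G -> bool) (A : freeSuper K par).
Variables (beta : A -> A -> A).
Hypothesis hbeta : bider id beta.
Variables (N : nat) (pt : 'I_N -> bool).
Local Notation adj_sign := (adj_sign pt).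
Local Notation rtt_sign := (rtt_sign pt).
Variables R S : nat -> 'M[A]_N.
Hypothesis hR : forall n a b, homog (pt a (+) pt b) (R n a b).
Hypothesis R0 : R 0 = 1%:M.
Hypothesis RS : forall n, \sum_(i < n.+1) R i *m S (n - i) = if n is 0 then 1%:M else 0.
Hypothesis R_rtt : forall m n a b c d,
  beta (R m.+1 a b) (R n c d) - beta (R m a b) (R n.+1 c d)
  = (-1) ^+ rtt_sign b c d *: (R n a d * R m c b - R m a d * R n c b).

Lemma inverse0 : S 0 = 1%:M.
Proof. by have := RS 0; rewrite big_ord_recl big_ord0 addr0 R0 mul1mx. Qed.

Lemma inverse_rec n : S n.+1 = - \sum_(i < n.+1) R i.+1 *m S (n - i).
Proof.
apply/eqP; rewrite -addr_eq0; have := RS n.+1.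
rewrite big_ord_recl R0 mul1mx subn0 => e; rewrite -[X in _ == X]e.
by apply/eqP; congr (_ + _); apply: eq_bigr => i _; rewrite lift0 subSS.
Qed.

Lemma homog_inverse_series n a b : homog (pt a (+) pt b) (S n a b).
Proof.
elim/ltn_ind: n a b => -[|n] IH a b.
  rewrite inverse0 mxE; case: eqP => [->|_]; last exact: homog0.
  by rewrite addbb; apply: homog1.
rewrite inverse_rec mxE summxE; apply/homogN/homog_sum => i _.
rewrite mxE; apply: homog_sum => e _.
apply: homogMb (hR _ _ _) (IH _ _ e b) _; first by rewrite ltnS leq_subr.
by case: (pt a) (pt b) (pt e) => [] [] [].
Qed.

(** Left convolution with the series [R]; the sign [s c f] is that of a
    bracket whose first argument is moved past [R i c f]. *)
Definition conv (s : 'I_N -> 'I_N -> bool) (F : nat -> 'I_N -> A) n c :=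
  \sum_(i < n.+1) \sum_f (-1) ^+ s c f *: (R i c f * F (n - i)%N f).

Lemma convB s F F' n c :
  conv s (fun n c => F n c - F' n c) n c = conv s F n c - conv s F' n c.
Proof.
rewrite /conv -sumrB; apply: eq_bigr => i _; rewrite -sumrB; apply: eq_bigr => f _.
by rewrite mulrBr scalerBr.
Qed.

Lemma convD s F F' n c :
  conv s (fun n c => F n c + F' n c) n c = conv s F n c + conv s F' n c.
Proof.
rewrite /conv -big_split; apply: eq_bigr => i _; rewrite -big_split; apply: eq_bigr => f _.
by rewrite mulrDr scalerDr.
Qed.

(** As the constant term of [R] is the identity, the lowest nonzero term of
    [F] would survive in the convolution. *)
Lemma conv_inj s F : (forall c, s c c = false) ->
  (forall n c, conv s F n c = 0) -> forall n c, F n c = 0.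
Proof.
move=> s0 cF; elim/ltn_ind => n IH c; have := cF n c.
rewrite /conv big_ord_recl [X in _ + X]big1 ?addr0 => [|i _]; last first.
  apply: big1 => f _; rewrite IH ?mulr0 ?scaler0 //.
  by rewrite lift0 /= subnS -ltnS prednK ?ltnS ?leq_subr // subn_gt0.
rewrite (bigD1 c) //= [X in _ + X]big1 ?addr0 => [|f /negPf fc]; last first.
  by rewrite R0 mxE eq_sym fc mul0r scaler0.
by rewrite R0 mxE eqxx mul1r s0 scale1r subn0.
Qed.

Lemma conv_shift s F n c : (forall f, F 0 f = 0) ->
  conv s (fun n => F n.+1) n c = conv s F n.+1 c.
Proof.
move=> F0; rewrite [RHS]/conv big_ord_recr /= subnn [X in _ = _ + X]big1 ?addr0.
  by apply: eq_bigr => i _; apply: eq_bigr => f _; rewrite subSn // -ltnS.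
by move=> f _; rewrite F0 mulr0 scaler0.
Qed.

Let beta_delta (t : bool) y : beta (t%:R) y = 0 /\ beta y (t%:R) = 0.
Proof.
case: t; first by rewrite (bd1l (algHom_id _) hbeta) (bd1r (algHom_id _) hbeta).
by rewrite (bd0l hbeta) (bd0r hbeta).
Qed.

Let RSE n a d : \sum_(i < n.+1) (R i *m S (n - i)) a d = ((n == 0) && (a == d))%:R.
Proof. by rewrite -summxE RS; case: n => [|n]; rewrite mxE. Qed.

Let R_rtt' m n a b c d :
  beta (R m.+1 a b) (R n c d) - beta (R m a b) (R n.+1 c d)
  = (-1) ^+ rtt_sign a b c *: (R m c b * R n a d - R n c b * R m a d).
Proof.
rewrite R_rtt.
rewrite (homog_commE (hR n a d) (hR m c b)) (homog_commE (hR m a d) (hR n c b)).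
rewrite -scalerBr scalerA -signr_addb; congr ((-1) ^+ _ *: _).
by rewrite /rtt_sign; case: (pt a) (pt b) (pt c) (pt d) => [] [] [] [].
Qed.

(** The derivative of the identity R S = 1. *)
Lemma conv_RS m a b c d n :
  conv (fun c f => (pt a (+) pt b) && (pt c (+) pt f))
       (fun n f => beta (R m a b) (S n f d)) n c
  = - \sum_(i < n.+1) \sum_f beta (R m a b) (R i c f) * S (n - i) f d.
Proof.
have e : \sum_(i < n.+1) beta (R m a b) ((R i *m S (n - i)) c d) = 0.
  by rewrite -(bd_sumr hbeta) RSE (proj2 (beta_delta _ _)).
apply/eqP; rewrite -addr_eq0 -[X in _ == X]e.
apply/eqP; rewrite /conv -big_split; apply: eq_bigr => i _ /=.
rewrite mxE (bd_sumr hbeta) -big_split; apply: eq_bigr => f _ /=.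
by rewrite addrC (bdMr hbeta _ (hR m a b) (hR i c f)).
Qed.

(** The value of the mixed bracket of [R] and [S]: the inverse cancels one
    of the two factors [R] on the right hand side of the quadratic relation. *)
Definition cross m n a b c d : A :=
  (b == c)%:R *: ((-1) ^+ pt b *: (R m *m S n) a d)
  - (a == d)%:R *: ((-1) ^+ adj_sign a b c d *: (S n *m R m) c b).

(** Both sides have the same convolution with [R], by the relation for [R]
    and the derivative of R S = 1. *)
Lemma rtt_cross m n a b c d :
  beta (R m.+1 a b) (S n c d) - beta (R m a b) (S n.+1 c d) = cross m n a b c d.
Proof.
apply/eqP; rewrite -subr_eq0; apply/eqP; move: n c.
pose s c f := (pt a (+) pt b) && (pt c (+) pt f).
apply: (@conv_inj s (fun n c => beta (R m.+1 a b) (S n c d)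
  - beta (R m a b) (S n.+1 c d) - cross m n a b c d)) => [c|n c].
  by rewrite /s addbb andbF.
rewrite convB (convB s (fun n c => beta (R m.+1 a b) (S n c d))).
rewrite (conv_shift _ _ _ (F := fun n c => beta (R m a b) (S n c d))); last first.
  by move=> f; rewrite inverse0 mxE; case: (beta_delta (f == d) (R m a b)).
have e1 : (\sum_(i < n.+1) \sum_f beta (R m.+1 a b) (R i c f) * S (n - i) f d)
    - \sum_(i < n.+1) \sum_f beta (R m a b) (R i.+1 c f) * S (n - i) f d
    = (-1) ^+ rtt_sign a b c *: ((a == d)%:R *: ((n == 0)%:R *: R m c b)
        - \sum_(i < n.+1) R i c b * (R m *m S (n - i)) a d).
  have -> : (a == d)%:R *: ((n == 0)%:R *: R m c b)
      = R m c b * ((n == 0) && (a == d))%:R.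
    by rewrite scalerA -natrM mulnb andbC scaler_nat mulr_natr.
  rewrite -RSE mulr_sumr -!sumrB scaler_sumr; apply: eq_bigr => i _.
  rewrite !mxE !mulr_sumr -!sumrB scaler_sumr; apply: eq_bigr => f _.
  by rewrite -mulrBl R_rtt' -scalerAl mulrBl -!mulrA.
have e2 : conv s (fun n c => cross m n a b c d) n c
    = (-1) ^+ rtt_sign a b c *: (\sum_(i < n.+1) R i c b * (R m *m S (n - i)) a d
        - (a == d)%:R *: ((n == 0)%:R *: R m c b)).
  have -> : (n == 0)%:R *: R m c b = \sum_(i < n.+1) (R i *m S (n - i) *m R m) c b.
    rewrite -summxE -mulmx_suml RS; case: (n) => [|n']; rewrite ?mul1mx ?scale1r //.
    by rewrite mul0mx mxE scale0r.
  rewrite /conv scaler_sumr -sumrB scaler_sumr; apply: eq_bigr => i _.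
  rewrite scalerBr; under eq_bigr => f _ do rewrite /cross mulrBr scalerBr -!scalerAr.
  rewrite sumrB; congr (_ - _).
    under eq_bigr => f _ do rewrite (scalerCA _ (b == f)%:R).
    rewrite sum_delta' scalerA -signr_addb; congr ((-1) ^+ _ *: _).
    by rewrite /s /rtt_sign; case: (pt a) (pt b) (pt c) => [] [] [].
  under eq_bigr => f _ do rewrite (scalerCA _ (a == d)%:R).
  rewrite -scaler_sumr (scalerCA _ (a == d)%:R).
  case: eqP => [ad|_]; last by rewrite !scale0r.
  rewrite -mulmxA [in RHS]mxE; congr (_ *: _); rewrite [RHS]scaler_sumr; apply: eq_bigr => f _.
  rewrite scalerA -signr_addb; congr ((-1) ^+ _ *: _).
  rewrite /s /adj_sign /rtt_sign ad.
  by case: (pt d) (pt b) (pt c) (pt f) => [] [] [] [].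
have e3 : \sum_(i < n.+2) \sum_f beta (R m a b) (R i c f) * S (n.+1 - i) f d
    = \sum_(i < n.+1) \sum_f beta (R m a b) (R i.+1 c f) * S (n - i) f d.
  rewrite big_ord_recl [X in X + _]big1 ?add0r; last first.
    by move=> f _; rewrite R0 mxE (proj2 (beta_delta _ _)) mul0r.
  by apply: eq_bigr => i _; rewrite lift0 subSS.
by rewrite !conv_RS e3 e2 -opprD -opprD e1 -scalerDr addrA addrNK subrr scaler0 oppr0.
Qed.

Lemma conv_RSl m b n c d a :
  conv (fun _ _ => false) (fun m a => beta (S m a b) (S n c d)) m a
  = - \sum_(i < m.+1) \sum_f (-1) ^+ ((pt f (+) pt b) && (pt c (+) pt d)) *:
        (beta (R i a f) (S n c d) * S (m - i) f b).
Proof.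
have e : \sum_(i < m.+1) beta ((R i *m S (m - i)) a b) (S n c d) = 0.
  by rewrite -(bd_suml hbeta) RSE (proj1 (beta_delta _ _)).
apply/eqP; rewrite -addr_eq0 -[X in _ == X]e.
apply/eqP; rewrite /conv -big_split; apply: eq_bigr => i _ /=.
rewrite mxE (bd_suml hbeta) -big_split; apply: eq_bigr => f _ /=.
rewrite scale1r.
by rewrite (bdMl hbeta _ (homog_inverse_series _ f b) (homog_inverse_series n c d)).
Qed.

(** The same argument again, applied to the first entry of the bracket and
    starting from [rtt_cross]. *)
Lemma inverse_rtt m n a b c d :
  beta (S m.+1 a b) (S n c d) - beta (S m a b) (S n.+1 c d)
  = - ((-1) ^+ rtt_sign b c d *: (S n a d * S m c b - S m a d * S n c b)).
Proof.
apply/eqP; rewrite -addr_eq0; apply/eqP; move: m a.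
pose E n m a := beta (S m a b) (S n c d).
pose Q m a := (-1) ^+ rtt_sign b c d *: (S n a d * S m c b - S m a d * S n c b).
apply: (@conv_inj (fun _ _ => false) (fun m a => E n m.+1 a - E n.+1 m a + Q m a)) => // m a.
rewrite convD (convB _ (fun m a => E n m.+1 a)).
rewrite (conv_shift _ _ _ (F := E n)); last first.
  by move=> f; rewrite /E inverse0 mxE (proj1 (beta_delta _ _)).
have e1 : (\sum_(i < m.+1) \sum_f (-1) ^+ ((pt f (+) pt b) && (pt c (+) pt d)) *:
        (beta (R i.+1 a f) (S n c d) * S (m - i) f b))
    - (\sum_(i < m.+1) \sum_f (-1) ^+ ((pt f (+) pt b) && (pt c (+) pt d)) *:
        (beta (R i a f) (S n.+1 c d) * S (m - i) f b))
    = (-1) ^+ rtt_sign b c d *: (\sum_(i < m.+1) (R i *m S n) a d * S (m - i) c b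
        - (a == d)%:R *: ((m == 0)%:R *: S n c b)).
  have -> : (m == 0)%:R *: S n c b = \sum_(i < m.+1) (S n *m R i *m S (m - i)) c b.
    under eq_bigr => i _ do rewrite -mulmxA.
    rewrite -summxE -mulmx_sumr RS; case: (m) => [|m']; rewrite ?mulmx1 ?scale1r //.
    by rewrite mulmx0 mxE scale0r.
  rewrite scaler_sumr -!sumrB scaler_sumr; apply: eq_bigr => i _; rewrite -sumrB.
  under eq_bigr => f _ do
    rewrite -scalerBr -mulrBl rtt_cross /cross mulrBl scalerBr -!scalerAl.
  rewrite sumrB scalerBr; congr (_ - _).
    under eq_bigr => f _ do rewrite (scalerCA _ (f == c)%:R).
    rewrite sum_delta scalerA -signr_addb; congr ((-1) ^+ _ *: _).
    by rewrite /rtt_sign; case: (pt b) (pt c) (pt d) => [] [] [].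
  under eq_bigr => f _ do rewrite (scalerCA _ (a == d)%:R).
  rewrite -scaler_sumr (scalerCA _ (a == d)%:R).
  case: eqP => [ad|_]; last by rewrite !scale0r.
  rewrite [in RHS]mxE; congr (_ *: _); rewrite [RHS]scaler_sumr; apply: eq_bigr => f _.
  rewrite scalerA -signr_addb; congr ((-1) ^+ _ *: _).
  rewrite /adj_sign /rtt_sign ad.
  by case: (pt d) (pt b) (pt c) (pt f) => [] [] [] [].
have e2 : conv (fun _ _ => false) Q m a
    = (-1) ^+ rtt_sign b c d *: (\sum_(i < m.+1) (R i *m S n) a d * S (m - i) c b
        - (a == d)%:R *: ((m == 0)%:R *: S n c b)).
  have -> : (a == d)%:R *: ((m == 0)%:R *: S n c b)
      = ((m == 0) && (a == d))%:R * S n c b.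
    by rewrite scalerA -natrM mulnb andbC scaler_nat mulr_natl.
  rewrite -RSE mulr_suml -!sumrB scaler_sumr; apply: eq_bigr => i _.
  rewrite !mxE !mulr_suml -!sumrB scaler_sumr; apply: eq_bigr => f _.
  by rewrite scale1r /Q -scalerAr mulrBr !mulrA.
have e3 : \sum_(i < m.+2) \sum_f (-1) ^+ ((pt f (+) pt b) && (pt c (+) pt d)) *:
        (beta (R i a f) (S n c d) * S (m.+1 - i) f b)
    = \sum_(i < m.+1) \sum_f (-1) ^+ ((pt f (+) pt b) && (pt c (+) pt d)) *:
        (beta (R i.+1 a f) (S n c d) * S (m - i) f b).
  rewrite big_ord_recl [X in X + _]big1 ?add0r; last first.
    by move=> f _; rewrite R0 mxE (proj1 (beta_delta _ _)) mul0r scaler0.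
  by apply: eq_bigr => i _; rewrite lift0 subSS.
by rewrite !conv_RSl e3 e2 -opprD e1 addNr.
Qed.
End InverseSeries.

(** * The bracket of the super-Yangian *)

Section YangianRelation.
Variables (K : fieldType) (G : choiceType) (par : G -> bool) (A : freeSuper K par).
Variables (beta : A -> A -> A).
Hypothesis hbeta : bider id beta.
Variables (N : nat) (pt : 'I_N -> bool).
Local Notation rtt_sign := (rtt_sign pt).
Variables S : nat -> 'M[A]_N.
Hypothesis hS : forall n a b, homog (pt a (+) pt b) (S n a b).
Hypothesis S0 : S 0 = 1%:M.
Hypothesis S_rtt : forall m n a b c d,
  beta (S m.+1 a b) (S n c d) - beta (S m a b) (S n.+1 c d)
  = - ((-1) ^+ rtt_sign b c d *: (S n a d * S m c b - S m a d * S n c b)).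

(** The sign of the level reverses the sign of the quadratic bracket, and
    the sign of the column index undoes the one that was absorbed in the
    entries of the matrix. *)
Definition yser n a b : A := (-1) ^+ (pt b + n) *: S n a b.
Local Notation T := yser.

Lemma homog_yser n a b : homog (pt a (+) pt b) (T n a b).
Proof. exact/homogZ/hS. Qed.

Lemma yser0 a b : T 0 a b = ((-1) ^+ pt a * (a == b)%:R)%:A.
Proof.
rewrite /T addn0 S0 mxE; case: eqP => [->|_]; first by rewrite mulr1.
by rewrite scaler0 mulr0 scale0r.
Qed.

Lemma yser_rtt m n a b c d :
  beta (T m.+1 a b) (T n c d) - beta (T m a b) (T n.+1 c d)
  = (-1) ^+ rtt_sign a b c *: (T m c b * T n a d - T n c b * T m a d).
Proof.
transitivity (- ((-1) ^+ (pt b + m + (pt d + n)) *: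
    (beta (S m.+1 a b) (S n c d) - beta (S m a b) (S n.+1 c d)))).
  rewrite /T !(bdZl hbeta) !(bdZr hbeta) !scalerA -!exprD !addnS !addSn !exprS.
  by rewrite !mulN1r !scaleNr opprK scalerBr opprB addrC.
rewrite S_rtt scalerN opprK scalerA.
rewrite (homog_commE (hS n a d) (hS m c b)) (homog_commE (hS m a d) (hS n c b)).
rewrite /T -!scalerAl -!scalerAr !scalerA -!exprD.
rewrite [in X in _ = _ *: (_ - X)]addnACA [(n + m)%N]addnC -addnACA -!scalerBr.
rewrite !scalerA; congr (_ *: _).
rewrite exprD -mulrA -signr_addb mulrC; congr (_ * _).
congr ((-1) ^+ _).
by rewrite /rtt_sign; case: (pt a) (pt b) (pt c) (pt d) => [] [] [] [].
Qed.

Definition ysum m n a b c d := \sum_(0 <= r < minn m n)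
  (T r c b * T (m + n - 1 - r) a d - T (m + n - 1 - r) c b * T r a d).

Lemma ysum_rec m n a b c d :
  ysum m.+1 n a b c d
  = ysum m n.+1 a b c d + (T m c b * T n a d - T n c b * T m a d).
Proof.
rewrite /ysum addSn addnS; have [mn|nm|->] := ltngtP m n.
- rewrite (minn_idPl mn) (minn_idPl (leqW (ltnW mn))) big_nat_recr //=.
  by rewrite subn1 addKn.
- rewrite (minn_idPr (leqW (ltnW nm))) (minn_idPr nm) big_nat_recr //=.
  by rewrite subn1 addnK -addrA -[X in _ = _ + (X + _)]opprB addNr addr0.
- rewrite (minn_idPr (leqnSn _)) (minn_idPl (leqnSn _)).
  by rewrite subrr addr0.
Qed.

(** A recursion on [m] by means of the difference relation, which starts
    because the elements of level 0 are constants. *)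
Lemma yser_bracket m n a b c d :
  beta (T m a b) (T n c d) = (-1) ^+ rtt_sign a b c *: ysum m n a b c d.
Proof.
elim: m n => [|m IH] n.
  rewrite yser0 (bd_scalarl (algHom_id _) hbeta) /ysum min0n big_geq //.
  by rewrite scaler0.
have := yser_rtt m n a b c d; rewrite IH => /eqP; rewrite subr_eq => /eqP ->.
by rewrite -scalerDr ysum_rec addrC.
Qed.

(** The term r = 0 of the sum contains the constants of level 0; it is the
    part of the bracket which is linear in the generators. *)
Lemma yser_bracketS m n a b c d :
  beta (T m.+1 a b) (T n.+1 c d)
  = (c == b)%:R *: T (m.+1 + n.+1 - 1) a d
  - ((-1) ^+ ((pt a (+) pt b) && (pt c (+) pt d)) * (a == d)%:R) *:
      T (m.+1 + n.+1 - 1) c b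
  + (-1) ^+ ((pt c && (pt a (+) pt b)) (+) (pt a && pt b)) *:
    \sum_(1 <= r < minn m.+1 n.+1)
      (T r c b * T (m.+1 + n.+1 - 1 - r) a d
       - T (m.+1 + n.+1 - 1 - r) c b * T r a d).
Proof.
rewrite yser_bracket /ysum minnSS big_ltn // subn0 scalerDr; congr (_ + _ *: _).
  rewrite !yser0; move: (T _ a d) (T _ c b) => x y.
  rewrite scalerBr -!scalerAl -!scalerAr mul1r mulr1 !scalerA.
  rewrite !mulrA -!signr_addb /rtt_sign; congr (_ *: _ - _ *: _).
    case: eqP => [->|_]; rewrite ?mulr1 ?mulr0 //.
    by case: (pt a) (pt b) => [] [].
  case: eqP => [->|_]; rewrite ?mulr1 ?mulr0 //.
  by congr ((-1) ^+ _); case: (pt b) (pt c) (pt d) => [] [] [].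
by congr ((-1) ^+ _); rewrite /rtt_sign; case: (pt a) (pt b) (pt c) => [] [] [].
Qed.
End YangianRelation.

(** * A standard basis for the principal sl(2) *)

Section StandardBasis.
Variables (K : fieldType).
Hypothesis char0 : forall n, n.+1%:R != 0 :> K.

Lemma natr_eq0' n : (n%:R == 0 :> K) = (n == 0).
Proof. by case: n => [|n]; rewrite ?eqxx // (negPf (char0 n)). Qed.

Lemma natr_inj m n : m%:R = n%:R :> K -> m = n.
Proof.
wlog le_mn : m n / (m <= n)%N => [W e|].
  by case/orP: (leq_total m n) => ?; [apply: W | apply/esym/W].
move=> /esym/eqP; rewrite -subr_eq0 -natrB // natr_eq0' subn_eq0 => nm.
by apply/eqP; rewrite eqn_leq le_mn.
Qed.

(** A matrix has boundedly many eigenvalues, so a sequence of vectors on which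
    it acts with pairwise distinct scalars has to reach zero. *)
Lemma eigen_chain n (L : 'M[K]_n) (v : nat -> 'rV[K]_n) (lam : nat -> K) :
  injective lam -> (forall k, v k *m L = lam k *: v k) ->
  exists2 k, (k <= n)%N & v k = 0.
Proof.
move=> lamI vL; have [/forallP v0|] := boolP [forall k : 'I_n.+1, v k != 0]; last first.
  rewrite negb_forall => /existsP[k]; rewrite negbK => /eqP vk.
  by exists k => //; rewrite -ltnS.
have rt (k : 'I_n.+1) : root (char_poly L) (lam k).
  by rewrite -eigenvalue_root_char; apply/eigenvalueP; exists (v k).
have := @max_poly_roots _ (char_poly L) [seq lam (val k) | k <- enum 'I_n.+1].
rewrite size_map size_enum_ord size_char_poly ltnn => F; suff: false by [].
apply: F.
- by rewrite -size_poly_gt0 size_char_poly.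
- by apply/allP => _ /mapP[k _ ->]; apply: rt.
- by rewrite map_inj_uniq ?enum_uniq // => i j /lamI/val_inj.
Qed.

Variables (p : nat).
Hypotheses (p_gt0 : (0 < p)%N).

(** This is 2 e_+ on the basis v, e_- v, e_-^2 v, ... of the irreducible
    representation of dimension [p] with highest weight vector v. *)
Definition up_chain_mx : 'M[K]_p := \matrix_(k, l) ((k.+1 == l) * (l * (p - l)))%:R.
Definition down_mx : 'M[K]_p := \matrix_(k, l) (val k == l.+1)%:R.

(** The chain generated by a highest weight vector; it is written with row
    vectors, hence for the transposed matrices, so that it applies both to the
    rows and to the columns of the representation. *)
Section Chain.
Variables (a b h : 'M[K]_p) (v : 'rV[K]_p) (mu : K).
Hypotheses (hb : b *m h = h *m b - b) (ba : b *m a = a *m b + h).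
Hypotheses (va : v *m a = 0) (vh : v *m h = mu *: v).

Definition chain i := iter i (mulmxr b) v.

Lemma chainS i : chain i.+1 = chain i *m b. Proof. by []. Qed.

Lemma chain_weight i : chain i *m h = (mu - i%:R) *: chain i.
Proof.
elim: i => [|i IH]; first by rewrite subr0.
rewrite chainS -mulmxA hb mulmxBr mulmxA IH -scalemxAl -[X in _ - X]scale1r.
by rewrite -scalerBl -addrA -opprD natr1.
Qed.

Lemma chain_raise i :
  2%:R *: (chain i.+1 *m a) = (i.+1%:R * (2%:R * mu - i%:R)) *: chain i.
Proof.
elim: i => [|i IH].
  rewrite chainS -mulmxA ba mulmxDr mulmxA va mul0mx add0r chain_weight.
  by rewrite scalerA subr0 mul1r subr0.
rewrite chainS -mulmxA ba mulmxDr mulmxA scalerDr scalemxAl IH chain_weight.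
rewrite -scalemxAl -chainS scalerA -scalerDl; congr (_ *: _).
by rewrite -[i.+2]addn1 -[i.+1]addn1 !natrD; ring.
Qed.

(** The weights along the chain are pairwise distinct, so it terminates;
    raising its first vanishing term then determines the weight [mu]. *)
Lemma chain_length : v != 0 ->
  exists2 d, (0 < d <= p)%N & chain d = 0 /\ 2%:R * mu = d.-1%:R.
Proof.
move=> v0; have [k kp ck] : exists2 k, (k <= p)%N & chain k = 0.
  apply: (eigen_chain (lam := fun k => mu - k%:R)) chain_weight.
  by move=> i j /addrI/oppr_inj/natr_inj.
have ex : exists k, chain k == 0 by exists k; apply/eqP.
case: (ex_minnP ex) => -[|d] /eqP cd mind; first by rewrite -[chain 0]/v in cd; rewrite cd eqxx in v0.
exists d.+1; first by rewrite /= (leq_trans _ kp) // mind // ck.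
split=> //; have := chain_raise d; rewrite cd mul0mx scaler0 => /esym/eqP.
rewrite scaler_eq0 mulf_eq0 natr_eq0' /= subr_eq0.
case/orP=> [/eqP -> //|/mind]; by rewrite ltnn.
Qed.
End Chain.

(** The row kernel of [ep] is a line because of the rank, and [e0] preserves
    it. *)
Lemma left_highest (ep e0 : 'M[K]_p) :
  e0 *m ep - ep *m e0 = ep -> \rank ep = p.-1 -> exists l : 'rV[K]_p, exists nu : K,
  [/\ l != 0, l *m ep = 0, l *m e0 = nu *: l & forall u : 'rV_p, u *m ep = 0 -> exists c, u = c *: l].
Proof.
move=> h0p rk; have rk1 : \rank (kermx ep) = 1 by rewrite mxrank_ker rk; lia.
have k0 : kermx ep != 0 by rewrite -mxrank_eq0 rk1.
have /rowV0Pn[l lk l0] := k0.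
have lep : l *m ep = 0 by apply/sub_kermxP.
have span u : u *m ep = 0 -> exists c, u = c *: l.
  move=> /sub_kermxP uk; apply/sub_rVP; apply: submx_trans uk _.
  have /mxrank_leqif_sup[_] := lk; rewrite rk1 rank_rV l0 eqxx.
  by move=> <-.
have [|nu e] := span (l *m e0).
  have /eqP := h0p; rewrite subr_eq => /eqP e.
  by rewrite -mulmxA e mulmxDr lep mulmxA lep mul0mx addr0.
by exists l, nu.
Qed.

Section Nilpotent.
Variables (ep e0 : 'M[K]_p).
Hypotheses (h0p : e0 *m ep - ep *m e0 = ep) (rk : \rank ep = p.-1).

Let mulmx_scaler c (X Y : 'M[K]_p) : X * (c *: Y) = c *: (X * Y).
Proof. exact/esym/scalemxAr. Qed.

Lemma weight_exp k : e0 * ep ^+ k - ep ^+ k * e0 = k%:R *: ep ^+ k.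
Proof.
have h0 : e0 * ep = ep * e0 + ep by apply/eqP; rewrite addrC -subr_eq; apply/eqP.
elim: k => [|k /eqP]; first by rewrite expr0 mul1r mulr1 subrr scale0r.
rewrite subr_eq => /eqP IH; rewrite exprS mulrA h0 mulrDl -!mulrA IH mulrDr.
by rewrite mulmx_scaler -natr1 scalerDl scale1r addrAC addrK.
Qed.

(** As the kernel of [ep] is a line, each further power loses at most 1 in
    rank. *)
Lemma rank_exp k : (p - k <= \rank (ep ^+ k))%N.
Proof.
elim: k => [|k IH]; first by rewrite expr0 mxrank1 subn0.
have := mxrank_mul_ker (ep ^+ k) ep; rewrite exprSr.
have : (\rank (ep ^+ k :&: kermx ep)%MS <= \rank (kermx ep))%N.
  by apply/mxrankS/capmxSr.
rewrite mxrank_ker rk -[_ *m _]/(_ * _); lia.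
Qed.

Lemma exp_neq0 k : (k < p)%N -> ep ^+ k != 0.
Proof. by move=> kp; rewrite -mxrank_eq0; have := rank_exp k; lia. Qed.

(** The powers of [ep] have pairwise distinct weights under the commutator
    with [e0], so that one of them is zero. *)
Lemma top_power : exists m, [/\ (p <= m.+1)%N, ep ^+ m != 0 & ep ^+ m.+1 = 0].
Proof.
pose L := lin_mulmx e0 - lin_mulmxr e0 : 'M[K]_(p * p).
have [k _ vk] : exists2 k, (k <= p * p)%N & mxvec (ep ^+ k) = 0.
  apply: (@eigen_chain _ L _ (fun k => k%:R)) => [i j /natr_inj //|k].
  rewrite mulmxBr !mul_vec_lin -linearB -linearZ; congr mxvec.
  exact: weight_exp.
have ex : exists k, ep ^+ k == 0.
  by exists k; rewrite -[ep ^+ k]mxvecK vk linear0.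
case: (ex_minnP ex) => -[|m] /eqP em0 mmin.
  by have := exp_neq0 p_gt0; rewrite em0 eqxx.
exists m; split=> //; first by rewrite leqNgt; apply/negP => /exp_neq0; rewrite em0 eqxx.
by apply/negP => /mmin; rewrite ltnn.
Qed.
End Nilpotent.

Variables (ep em e0 : 'M[K]_p).
Hypotheses (h0p : e0 *m ep - ep *m e0 = ep) (h0m : e0 *m em - em *m e0 = - em).
Hypotheses (hpm : ep *m em - em *m ep = e0) (rk : \rank ep = p.-1).

(** The columns of [g] are the chain of a vector killed by [ep], and the rows of
    [g'] are, up to a scalar and in reverse order, the chain of a covector killed
    by [ep]. Let [ep ^+ m] be the last nonzero power of [ep]: then m >= p - 1
    because of the rank, while the two chains have lengths at most p with sum
    2m + 2; hence all these inequalities are equalities. *)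
Lemma standard_basis : exists g, exists g' : 'M[K]_p,
  [/\ g' *m g = 1%:M, g *m g' = 1%:M, em *m g = g *m down_mx
    & (2%:R *: ep) *m g = g *m up_chain_mx].
Proof.
have [m [pm epm epm1]] := top_power h0p rk.
have [l [nu [l0 lep le0 lspan]]] := left_highest h0p rk.
have [||w [mu' [w0 wep we0 wspan]]] := @left_highest ep^T (- e0^T).
- by rewrite mulNmx mulmxN opprK addrC -!trmx_mul -linearB h0p.
- by rewrite mxrank_tr.
have wE : w *m e0^T = - mu' *: w by rewrite scaleNr -we0 mulmxN opprK.
have lE : l *m - e0 = - nu *: l by rewrite mulmxN le0 scaleNr.
have hm : e0 *m em = em *m e0 - em.
  by apply/eqP; rewrite -subr_eq0 opprB addrCA h0m addrN.
have hp : ep *m em = em *m ep + e0.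
  by apply/eqP; rewrite addrC -subr_eq hpm.
have cb : em^T *m e0^T = e0^T *m em^T - em^T by rewrite -!trmx_mul hm linearB.
have ca : em^T *m ep^T = ep^T *m em^T + e0^T by rewrite -!trmx_mul hp linearD.
have rb : em *m - e0 = - e0 *m em - em by rewrite mulmxN mulNmx hm opprB addrAC addrN add0r.
have ra : em *m ep = ep *m em + - e0 by rewrite hp addrK.
have [d dp [cd mud]] := chain_length cb ca wep wE w0.
have [d' dp' [rd nud]] := chain_length rb ra lep lE l0.
have [c epmE] : exists c, ep ^+ m = c *: (w^T *m l).
  have [C CE] : exists C : 'cV[K]_p, ep ^+ m = C *m l.
    have rowE k : exists c, row k (ep ^+ m) = c *: l.
      apply: lspan; rewrite -row_mul -[ep ^+ m *m ep]/(ep ^+ m * ep) -exprSr epm1.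
      exact: row0.
    have [f fE] : exists f : 'I_p -> K, forall k, row k (ep ^+ m) = f k *: l.
      exact: (fin_all_exists rowE).
    exists (\col_k f k); apply/row_matrixP => k; rewrite fE row_mul.
    by apply/rowP => r; rewrite !mxE big_ord1 !mxE.
  have [c cE] : exists c, C^T = c *: w.
    apply: wspan; rewrite -trmx_mul; apply/trmx_inj; rewrite trmxK trmx0.
    have /eqP : (ep *m C) *m l = 0 by rewrite -mulmxA -CE -[ep *m _]/(ep * _) -exprS.
    move: (ep *m C) => X /eqP Xl; apply/colP => k; rewrite mxE.
    have /rV0Pn[r lr] := l0.
    have /matrixP/(_ k r) := Xl; rewrite !mxE big_ord1 => /eqP.
    by rewrite mulf_eq0 (negPf lr) orbF => /eqP.
  by exists c; rewrite CE -[C]trmxK cE linearZ /= -scalemxAl.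
have mE : - mu' - nu = m%:R.
  have := weight_exp h0p m; rewrite epmE.
  have -> : e0 * (c *: (w^T *m l)) = - mu' *: (c *: (w^T *m l)).
    rewrite -[e0 * _]/(e0 *m _) -scalemxAr scalerA mulrC -scalerA; congr (_ *: _).
    rewrite mulmxA -[e0]trmxK -trmx_mul wE linearZ /=.
    by rewrite scalemxAl.
  have -> : (c *: (w^T *m l)) * e0 = nu *: (c *: (w^T *m l)).
    rewrite -[_ * e0]/(_ *m e0) -scalemxAl scalerA mulrC -scalerA; congr (_ *: _).
    by rewrite -mulmxA le0 scalemxAr.
  rewrite -scalerBl -epmE => /eqP; rewrite -subr_eq0 -scalerBl scaler_eq0.
  by rewrite (negPf epm) orbF subr_eq0 => /eqP.
have mdd : (2 * m = d.-1 + d'.-1)%N.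
  by apply: natr_inj; rewrite natrD -mud -nud -mulrDr mE natrM.
have [dE dE' mp] : [/\ d = p, d' = p & m = p.-1] by split; lia.
subst d d'; pose v := chain em^T w; pose u := chain em l.
have e0w : e0 *m w^T = - mu' *: w^T.
  by rewrite -[e0]trmxK -trmx_mul wE linearZ.
(* The chains are orthogonal except for opposite weights, and the nonzero products
   are all equal. *)
have uv i j : u i *m (v j)^T
    = if (i + j == p.-1)%N then u p.-1 *m w^T else 0.
  have shift k r : u k.+1 *m (v r)^T = u k *m (v r.+1)^T.
    by rewrite /u /v !chainS trmx_mul trmxK mulmxA.
  have -> : u i *m (v j)^T = u (i + j)%N *m w^T.
    by elim: j i => [|j IH] i; [rewrite addn0 | rewrite -shift IH addSnnS].
  case: eqP => [-> //|ne]; set x := (_ *m _).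
  have : (- nu - (i + j)%:R) *: x = mu' *: x.
    rewrite {1}/x scalemxAl -(chain_weight rb lE) -mulmxA mulNmx e0w mulmxN.
    by rewrite -scalemxAr -/x scaleNr opprK.
  move/eqP; rewrite -subr_eq0 -scalerBl scaler_eq0.
  rewrite addrAC [- nu - mu']addrC mE mp subr_eq0 => /orP[/eqP/natr_inj|/eqP //].
  by move=> e; case: ne.
set kap := (u p.-1 *m w^T) 0 0.
have kapE : u p.-1 *m w^T = kap%:M by rewrite [LHS]mx11_scalar.
have top k : (k < p)%N -> exists2 c, c != 0 & (v k) *m ep^T ^+ k = c *: w.
  elim: k => [|k IH] kp; first by exists 1; rewrite ?oner_neq0 // expr0 mulmx1 scale1r.
  have [c' c'0 cE] := IH (ltnW kp).
  exists (2%:R^-1 * (k.+1%:R * (p.-1%:R - k%:R)) * c').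
    rewrite !mulf_neq0 ?invr_neq0 ?char0 // -natrB; last by lia.
    by rewrite natr_eq0' subn_eq0 -ltnNge; lia.
  have aE : v k.+1 *m ep^T = (2%:R^-1 * (k.+1%:R * (p.-1%:R - k%:R))) *: v k.
    apply: (scalerI (char0 1)); rewrite (chain_raise cb ca wep wE) mud scalerA.
    by rewrite mulrA mulfV ?char0 // mul1r.
  by rewrite exprS -[_ * _]/(_ *m _) mulmxA aE -scalemxAl cE scalerA.
have kap0 : kap != 0.
  have [c' c'0] := top p.-1 (ltac:(lia)); rewrite -mp => /(congr1 trmx).
  have -> : (v m *m ep^T ^+ m)^T = ep ^+ m *m (v m)^T.
    rewrite trmx_mul; congr (_ *m _); apply: trmx_inj; rewrite trmxK.
    elim: (m) => [|k IH]; first by rewrite !expr0 [RHS]trmx1.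
    by rewrite exprSr IH exprS [RHS]trmx_mul.
  rewrite epmE -scalemxAl -mulmxA (_ : l *m _ = u 0 *m (v m)^T) // uv add0n mp eqxx kapE.
  move=> e; apply/eqP => k0; move: e; rewrite k0 raddf0 mulmx0 scaler0 => /esym/eqP.
  rewrite -trmx0 (inj_eq trmx_inj) scaler_eq0 (negPf c'0) (negPf w0) //.
pose g : 'M[K]_p := \matrix_(k, j) v j 0 k.
pose g' : 'M[K]_p := \matrix_(j, k) (kap^-1 * u (p.-1 - j)%N 0 k).
have gg : g' *m g = 1%:M.
  apply/matrixP => i j; rewrite !mxE.
  transitivity (kap^-1 * (u (p.-1 - i)%N *m (v j)^T) 0 0).
    by rewrite [in RHS]mxE mulr_sumr; apply: eq_bigr => k _; rewrite !mxE mulrA.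
  rewrite uv (_ : (p.-1 - i + j == p.-1)%N = (i == j)).
    by case: eqP => _; rewrite ?kapE mxE ?mulr0 // mulVf.
  have := ltn_ord i; have := ltn_ord j => jp ip.
  by apply/eqP/eqP => [e|->]; [apply: val_inj; rewrite /=; lia | lia].
exists g, g'; split=> //; first exact: mulmx1C.
- apply/matrixP => i j; rewrite !mxE.
  transitivity (v j.+1 0 i).
    by rewrite /v chainS !mxE; apply: eq_bigr => k _; rewrite !mxE mulrC.
  have [jp|] := ltnP j.+1 p.
    rewrite (bigD1 (Ordinal jp)) //= [X in _ + X]big1 ?addr0 => [|k kj].
      by rewrite !mxE eqxx mulr1.
    by rewrite -val_eqE /= in kj; rewrite !mxE (negPf kj) mulr0.
  move=> pj; have -> : j.+1 = p by have := ltn_ord j; lia.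
  rewrite {1}/v cd mxE big1 // => k _; rewrite !mxE.
  case: eqP => /= [e|_]; rewrite ?mulr0 //; exfalso.
  by have := ltn_ord k; lia.
- apply/matrixP => i j; rewrite !mxE.
  transitivity ((2%:R *: (v j *m ep^T)) 0 i).
    rewrite !mxE mulr_sumr; apply: eq_bigr => k _; rewrite !mxE; ring.
  have [j0|j0] := posnP j.
    rewrite j0 {1}/v wep scaler0 mxE big1 // => k _.
    by rewrite !mxE j0 mulr0.
  have jp : (j.-1 < p)%N by have := ltn_ord j; lia.
  rewrite -[val j](prednK j0) (chain_raise cb ca wep wE) mud.
  rewrite [RHS](bigD1 (Ordinal jp)) //= [X in _ = _ + X]big1 ?addr0 => [|k kj].
    rewrite !mxE prednK // eqxx mul1n mulrC natrM; congr (_ * (_ * _)).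
    by rewrite -natrB; [congr (_%:R); lia | have := ltn_ord j; lia].
  rewrite !mxE (_ : (k.+1 == j) = false) ?mulr0 //; apply/negP => /eqP e.
  by case/eqP: kj; apply: val_inj; rewrite /= -e.
Qed.
End StandardBasis.

(** * The decomposition of gl(p) under the principal sl(2) *)

Section SpinBasis.
Variables (K : fieldType).
Hypothesis char0 : forall n, n.+1%:R != 0 :> K.
Variables (p : nat) (ep em e0 : 'M[K]_p).
Hypothesis p_gt0 : (0 < p)%N.
Hypothesis psl2 : principal_sl2 ep em e0.
Local Notation M := (sl2mx ep em).
Local Notation up := (up_chain_mx K p).
Local Notation down := (down_mx K p).

Let h0p : e0 * ep - ep * e0 = ep. Proof. by case: psl2. Qed.
Let h0m : e0 * em - em * e0 = - em. Proof. by case: psl2. Qed.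
Let hpm : ep * em - em * ep = e0. Proof. by case: psl2. Qed.
Let rk : \rank ep = p.-1. Proof. by case: psl2. Qed.

Definition cm (X Y : 'M[K]_p) := X * Y - Y * X.

Lemma mxZr c (X Y : 'M[K]_p) : X * (c *: Y) = c *: (X * Y).
Proof. exact/esym/scalemxAr. Qed.

Lemma mxZl c (X Y : 'M[K]_p) : c *: X * Y = c *: (X * Y).
Proof. exact/esym/scalemxAl. Qed.

Lemma cmZ c X Y : cm X (c *: Y) = c *: cm X Y.
Proof. by rewrite /cm mxZr mxZl scalerBr. Qed.

Lemma cm0 X : cm X 0 = 0.
Proof. by rewrite /cm mulr0 mul0r subrr. Qed.

Lemma cm_jacobi X Y Z : cm X (cm Y Z) = cm (cm X Y) Z + cm Y (cm X Z).
Proof.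
rewrite /cm !mulrBr !mulrBl !mulrA.
move: (X * Y * Z) (X * Z * Y) (Y * X * Z) (Y * Z * X) (Z * X * Y) (Z * Y * X).
by move=> a b c d e f; apply/matrixP => i j; rewrite !mxE; ring.
Qed.

Lemma sl2mxS j i : M j i.+1 = cm em (M j i).
Proof. by []. Qed.

Lemma cm_anti X Y : cm X Y = - cm Y X.
Proof. by rewrite /cm opprB. Qed.

Lemma cmZl c X Y : cm (c *: X) Y = c *: cm X Y.
Proof. by rewrite cm_anti cmZ -scalerN -cm_anti. Qed.

Lemma cmNl X Y : cm (- X) Y = - cm X Y.
Proof. by rewrite -scaleN1r cmZl scaleN1r. Qed.

Lemma sl2mx_weight j i : cm e0 (M j i) = (j%:R - i%:R) *: M j i.
Proof.
elim: i => [|i IH].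
  rewrite subr0 /= cmZ scalerA mulrC -scalerA; congr (_ *: _).
  exact: (weight_exp h0p j).
rewrite !sl2mxS cm_jacobi [cm e0 em]h0m IH cmZ -scaleN1r cmZl -scalerDl.
by congr (_ *: _); rewrite -natr1; ring.
Qed.

(** The action of e_+ on the chain of the highest weight vector M_(j,j), as
    in any representation of sl(2). *)
Lemma sl2mx_raise j i :
  2%:R *: cm ep (M j i.+1) = (i.+1%:R * ((2 * j)%:R - i%:R)) *: M j i.
Proof.
elim: i => [|i IH]; rewrite sl2mxS cm_jacobi [cm ep em]hpm scalerDr sl2mx_weight scalerA.
  rewrite (_ : cm ep (M j 0) = 0); last first.
    by rewrite /= cmZ /cm -exprS -exprSr subrr scaler0.
  by rewrite cm0 scaler0 addr0 subr0 mul1r subr0 natrM.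
rewrite -cmZ IH cmZ -sl2mxS -scalerDl; congr (_ *: _).
by rewrite natrM -[i.+2]addn1 natrD -natr1; ring.
Qed.

Lemma sl2mx0_neq0 j : (j < p)%N -> M j 0 != 0.
Proof.
move=> jp; rewrite scaler_eq0 expf_eq0 (negPf (char0 1)) andbF /=.
exact: (exp_neq0 p_gt0 rk jp).
Qed.

Lemma sl2mx_neq0 j i : (j < p)%N -> (i <= 2 * j)%N -> M j i != 0.
Proof.
move=> jp; elim: i => [|i IH] ij; first exact: sl2mx0_neq0.
apply: contraNneq (IH (ltnW ij)) => Mi.
have /eqP := sl2mx_raise j i; rewrite Mi cm0 scaler0 eq_sym scaler_eq0 mulf_eq0.
by rewrite (negPf (char0 _)) -natrB 1?ltnW // natr_eq0' // subn_eq0 leqNgt ij.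
Qed.

Section Coordinates.
Variables (g g' : 'M[K]_p).
Hypotheses (g'g : g' * g = 1) (gg' : g * g' = 1).
Hypotheses (emg : em * g = g * down) (epg : (2%:R *: ep) * g = g * up).

Definition std j i := g' * M j i * g.

(** The product of the coefficients of 2 e_+ along [j] steps which end at
    the basis vector [k]. *)
Fixpoint raise_coef j k := if j is j'.+1 then (k.+1 * (p - k.+1) * raise_coef j' k.+1)%N else 1%N.

Lemma raise_coef_gt0 j k : (k + j < p)%N -> (0 < raise_coef j k)%N.
Proof.
elim: j k => //= j IH k kj; rewrite !muln_gt0 /= subn_gt0 IH; last by lia.
by rewrite andbT; lia.
Qed.

Lemma std0 j k l : std j 0 k l = ((val l == k + j)%N * raise_coef j k)%:R.
Proof.
have stdS i : std i.+1 0 = up * std i 0.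
  rewrite /std /=.
  have -> : 2%:R ^+ i.+1 *: ep ^+ i.+1 = (2%:R *: ep) * (2%:R ^+ i *: ep ^+ i).
    by rewrite !exprS mxZl mxZr scalerA.
  have g'p : g' * (2%:R *: ep) = up * g'.
    by rewrite -[LHS]mulr1 -gg' mulrA -[_ * g]mulrA epg mulrA g'g mul1r.
  by rewrite !mulrA g'p.
elim: j k l => [|j IH] k l.
  by rewrite /std /= scale1r expr0 mulr1 g'g mxE addn0 muln1 eq_sym.
rewrite stdS mxE; have [kp|kp] := ltnP k.+1 p; last first.
  rewrite big1 => [|r _]; first by rewrite /= (eqP (_ : p - k.+1 == 0)%N) ?subn_eq0 // muln0 mul0n muln0.
  by rewrite mxE; case: eqP => /= [e|_]; rewrite ?mul0r //; have := ltn_ord r; lia.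
rewrite (bigD1 (Ordinal kp)) //= [X in _ + X]big1 ?addr0 => [|r rk']; last first.
  by rewrite -val_eqE /= in rk'; rewrite mxE eq_sym (negPf rk') mul0r.
by rewrite mxE eqxx mul1n IH /= -natrM addSnnS; congr (_%:R); rewrite mulnCA.
Qed.

Lemma stdS j i : std j i.+1 = down * std j i - std j i * down.
Proof.
have g'm : g' * em = down * g'.
  by rewrite -[LHS]mulr1 -gg' mulrA -[_ * g]mulrA emg mulrA g'g mul1r.
by rewrite /std sl2mxS /cm mulrBr mulrBl !mulrA g'm -!mulrA emg.
Qed.

Lemma stdSE j i (k l : 'I_p) : std j i.+1 k l
  = (\sum_r down k r * std j i r l) - \sum_r std j i k r * down r l.
Proof.
rewrite stdS; move: (std j i) => X; rewrite !mxE.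
by congr (_ - _); apply: eq_bigr => r _; rewrite ?mxE.
Qed.

Lemma std_support j i (k l : 'I_p) : (l + i != k + j)%N -> std j i k l = 0.
Proof.
elim: i k l => [|i IH] k l; first by rewrite std0 addn0 => /negPf ->.
move=> ne; rewrite stdSE big1 => [|r _]; last first.
  rewrite [down k r]mxE; case: eqP => /= [kr|_]; last by rewrite mul0r.
  by rewrite IH ?mulr0 //; lia.
rewrite big1 ?subr0 // => r _; rewrite [down r l]mxE; case: eqP => /= [rl|_]; last by rewrite mulr0.
by rewrite IH ?mul0r //; lia.
Qed.

Lemma sl2mxE j i : M j i = g * std j i * g'.
Proof. by rewrite /std !mulrA gg' mul1r -mulrA gg' mulr1. Qed.

(** For large [i] the matrix vanishes by [std_support]; by [sl2mx_raise], the
    vanishing goes back along the chain as long as i > 2j. *)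
Lemma sl2mx_eq0 j i : (2 * j < i)%N -> M j i = 0.
Proof.
move=> ij; have step k : M j (i + k).+1 = 0 -> M j (i + k) = 0.
  move=> Mk; have /eqP := sl2mx_raise j (i + k).
  rewrite Mk cm0 scaler0 eq_sym scaler_eq0 mulf_eq0 (negPf (char0 _)) subr_eq0.
  by case/orP=> [/eqP/(natr_inj char0)|/eqP //]; lia.
suff : M j (i + (j + p)) = 0.
  by elim: (j + p)%N => [|k IH]; rewrite ?addn0 // addnS => /step/IH.
rewrite sl2mxE (_ : std _ _ = 0) ?mulr0 ?mul0r //; apply/matrixP => k l.
by rewrite std_support ?mxE //; have := ltn_ord k; lia.
Qed.

Lemma trC (X Y : 'M[K]_p) : \tr (X * Y) = \tr (Y * X).
Proof. exact: mxtrace_mulC. Qed.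

Definition trm j i j' i' := \tr (M j i * M j' i').

Lemma trm_shift j i j' i' : trm j i.+1 j' i' = - trm j i j' i'.+1.
Proof.
rewrite /trm !sl2mxS /cm mulrBl mulrBr !linearB /= opprB; congr (_ - _).
  by rewrite -mulrA trC -mulrA.
by rewrite mulrA.
Qed.

Lemma trmC j i j' i' : trm j i j' i' = trm j' i' j i.
Proof. exact: mxtrace_mulC. Qed.

Lemma trm_weight j i j' i' : (j + j' != i + i')%N -> trm j i j' i' = 0.
Proof.
move=> ne; have : \tr (cm e0 (M j i) * M j' i') + \tr (M j i * cm e0 (M j' i')) = 0.
  rewrite /cm mulrBl mulrBr !linearB /= mulrA addrA addrNK.
  by rewrite -mulrA trC -mulrA subrr.
rewrite !sl2mx_weight mxZl mxZr !linearZ /= -mulrDl => /eqP; rewrite mulf_eq0.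
case/orP => [|/eqP //]; rewrite addrACA -opprD -!natrD subr_eq0 => /eqP/(natr_inj char0) e.
by rewrite e eqxx in ne.
Qed.

Lemma trm_shiftn j i j' i' : trm j i j' i' = (-1) ^+ i' * trm j (i + i') j' 0.
Proof.
elim: i' i => [|i' IH] i; first by rewrite addn0 mul1r.
by rewrite -[LHS]opprK -trm_shift IH addSnnS exprS mulN1r mulNr.
Qed.

(** By invariance under [em], all lowering operators can be moved to either
    factor, where they give zero as soon as their number exceeds twice its
    spin; by invariance under [e0], the weights have to be opposite. *)
Lemma trm_ortho j i j' i' : (j != j') || (i + i' != 2 * j)%N -> trm j i j' i' = 0.
Proof.
have [e ne|/trm_weight //] := eqVneq (j + j')%N (i + i')%N.
have [jj|jj|jj] := ltngtP j j'.
- by rewrite trm_shiftn /trm sl2mx_eq0 ?mul0r ?linear0 ?mulr0 //; lia.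
- by rewrite trmC trm_shiftn /trm sl2mx_eq0 ?mul0r ?linear0 ?mulr0 //; lia.
- by rewrite jj eqxx /= in ne; lia.
Qed.

(** In the standard basis, the lowest weight vector commutes with the shift
    matrix, so it is constant along its diagonal, whereas the highest one
    has positive entries along the opposite diagonal. *)
Lemma trm_neq0 j i : (j < p)%N -> (i <= 2 * j)%N -> trm j i j (2 * j - i) != 0.
Proof.
move=> jp ij; rewrite trm_shiftn mulf_neq0 ?signr_eq0 // subnKC //.
have [s sE] : exists s, forall k l : 'I_p, std j (2 * j) k l = s *+ (val k == l + j)%N.
  have cst k l : (k.+1 < p)%N -> forall (a b c d : 'I_p), a = k.+1 :> nat -> b = l.+1 :> nat -> c = k :> nat -> d = l :> nat ->
     std j (2 * j) a b = std j (2 * j) c d.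
    move=> kp a b c d ea eb ec ed.
    have := stdSE j (2 * j) a d.
    rewrite {1}/std sl2mx_eq0 // mulr0 mul0r [X in X = _]mxE.
    rewrite (bigD1 c) //= [X in _ + X - _]big1 => [|r rc]; last first.
      by rewrite [down a r]mxE; case: eqP => /= [e|_]; rewrite ?mul0r //; case/eqP: rc; apply: val_inj => /=; lia.
    rewrite [X in _ - X](bigD1 b) //= [X in _ - (_ + X)]big1 => [|r rb]; last first.
      by rewrite [down r d]mxE; case: eqP => /= [e|_]; rewrite ?mulr0 //; case/eqP: rb; apply: val_inj => /=; lia.
    rewrite [down a c]mxE [down b d]mxE.
    rewrite /= ea ec eb ed !eqxx.
    by rewrite !addr0 mul1r mulr1 => /eqP; rewrite eq_sym subr_eq0 => /eqP ->.
  exists (std j (2 * j) (Ordinal jp) (Ordinal p_gt0)).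
  move=> k l /=; case: eqP => [kl|kl]; last by rewrite std_support //; lia.
  case: l kl => l lp /= ; elim: l lp k => [|l IH] lp k kl.
    by congr (std _ _ _ _); apply: val_inj.
  have k1p : (k.-1 < p)%N by have := ltn_ord k; lia.
  rewrite -(IH (ltnW lp) (Ordinal k1p)) /=; last by lia.
  by apply: (@cst k.-1 l) => //=; have := ltn_ord k; lia.
have s0 : s != 0.
  apply: contra_neq (sl2mx_neq0 jp (leqnn _)) => s0.
  rewrite sl2mxE (_ : std _ _ = 0) ?mulr0 ?mul0r //.
  by apply/matrixP => k l; rewrite sE s0 mul0rn mxE.
have -> : trm j (2 * j) j 0 = \tr (std j (2 * j) * std j 0).
  rewrite /trm !sl2mxE; move: (std _ _) (std _ _) => X Y.
  rewrite -!mulrA trC -!mulrA g'g mulr1.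
  by rewrite [g' * (g * _)]mulrA g'g mul1r.
have -> : \tr (std j (2 * j) * std j 0) = s * (\sum_(k < p) (k + j < p) * raise_coef j k)%:R.
  rewrite trC natr_sum mulr_sumr; apply: eq_bigr => k _.
  rewrite mxE; have [kp|kp] := ltnP (k + j) p; last first.
    rewrite mul0n mulr0 big1 // => l _; rewrite std0 (_ : (val l == _) = false) ?mul0r //.
    by apply/negP => /eqP /=; have := ltn_ord l; lia.
  rewrite (bigD1 (Ordinal kp)) //= big1 ?addr0 => [|l lk]; last first.
    by rewrite -val_eqE /= in lk; rewrite std0 /= (negPf lk) mul0r.
  by rewrite std0 sE eqxx mul1n mulr1n mulrC.
rewrite mulf_neq0 // (natr_eq0' char0) -lt0n (bigD1 (Ordinal p_gt0)) //= ltn_addr //.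
by rewrite add0n jp mul1n raise_coef_gt0.
Qed.
End Coordinates.
End SpinBasis.

Section SpinCoordinates.
Variables (K : fieldType).
Hypothesis char0 : forall n, n.+1%:R != 0 :> K.
Variables (p : nat) (ep em e0 : 'M[K]_p).
Hypothesis p_gt0 : (0 < p)%N.
Hypothesis psl2 : principal_sl2 ep em e0.
Variables (g g' : 'M[K]_p).
Hypotheses (g'g : g' * g = 1) (gg' : g * g' = 1).
Hypotheses (emg : em * g = g * down_mx K p).
Hypotheses (epg : (2%:R *: ep) * g = g * up_chain_mx K p).

Definition spinmx (t : spin p) : 'M[K]_p := sl2mx ep em (tag t) (tagged t).

(** The label (j, - m), because m = j - i and [rev_ord] maps i to 2j - i. *)
Definition spin_dual (t : spin p) : spin p := existT _ (tag t) (rev_ord (tagged t)).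

Definition spin_norm (t : spin p) : K := \tr (spinmx t * spinmx (spin_dual t)).

Lemma spin_norm_neq0 t : spin_norm t != 0.
Proof.
have := trm_neq0 char0 p_gt0 psl2 g'g gg' emg epg (ltn_ord (tag t)) (ltn_ord (tagged t)).
by rewrite /trm /spin_norm /spinmx /= subSS.
Qed.

Lemma tr_spinmx s t : \tr (spinmx s * spinmx (spin_dual t)) = (s == t)%:R * spin_norm t.
Proof.
case: eqP => [->|st]; first by rewrite mul1r.
rewrite mul0r; case: s t st => [j i] [j' i'] st.
rewrite -[LHS]/(trm ep em j i j' (rev_ord i')).
rewrite (trm_ortho char0 p_gt0 psl2 g'g gg' emg epg) //=.
case: eqP => //= jj; move: (val_inj jj) => /= e; subst j'.
rewrite subSS; apply/negP => /eqP e; case: st; congr existT; apply: val_inj => /=.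
by have := ltn_ord i'; have := ltn_ord i; lia.
Qed.

Lemma sl2basis_nth (i : 'I_#|{: spin p}|) : (sl2basis ep em)`_i = spinmx (enum_val i).
Proof. by rewrite -tnth_nth tnth_mktuple. Qed.

Lemma sl2basis_free : free (sl2basis ep em).
Proof.
apply/freeP => k; under eq_bigr => i _ do rewrite sl2basis_nth.
move=> kM i; have /(congr1 (fun X => \tr (X * spinmx (spin_dual (enum_val i))))) := kM.
rewrite mul0r linear0 mulr_suml linear_sum /= (bigD1 i) //= big1 => [|j ji].
  rewrite addr0 mxZl linearZ /= tr_spinmx eqxx mul1r => /eqP.
  by rewrite mulf_eq0 (negPf (spin_norm_neq0 _)) orbF => /eqP.
by rewrite mxZl linearZ /= tr_spinmx (inj_eq enum_val_inj) (negPf ji) mul0r mulr0.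
Qed.

Lemma card_spin : #|{: spin p}| = (p * p)%N.
Proof.
rewrite card_tagged sumnE big_map big_enum /=.
under eq_bigr do rewrite card_ord.
elim: (p) => [|n IH]; first by rewrite big_ord0.
by rewrite big_ord_recr /= IH; lia.
Qed.

Lemma sl2basis_basis : basis_of fullv (sl2basis ep em).
Proof.
rewrite basisEfree sl2basis_free subvf size_tuple dimvf card_spin.
by rewrite [dim _]dim_matrix leqnn.
Qed.

Definition spincoord (t : spin p) (Y : 'M[K]_p) : K :=
  coord (sl2basis ep em) (enum_rank t) Y.

Lemma spincoordE Y : Y = \sum_t spincoord t Y *: spinmx t.
Proof.
have Yf : Y \in <<sl2basis ep em>>%VS by rewrite (span_basis sl2basis_basis) memvf.
rewrite {1}(coord_span Yf) (reindex (@enum_rank (spin p))) /=; last exact: (onW_bij _ (@enum_rank_bij _)).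
by apply: eq_bigr => t _; rewrite sl2basis_nth enum_rankK.
Qed.

Lemma spincoord_tr t Y :
  spincoord t Y = (spin_norm t)^-1 * \tr (Y * spinmx (spin_dual t)).
Proof.
rewrite {2}(spincoordE Y) mulr_suml linear_sum /= (bigD1 t) //= big1 => [|s st].
  rewrite addr0 mxZl linearZ /= tr_spinmx eqxx mul1r.
  by rewrite mulrCA mulVf ?mulr1 // spin_norm_neq0.
by rewrite mxZl linearZ /= tr_spinmx (negPf st) mul0r mulr0.
Qed.
End SpinCoordinates.

(** * Antitriangular matrices *)

Section AntiTriangular.
Variables (K : fieldType) (A : algType K) (n : nat).
Variables (Delta : 'M[A]_n) (tau : 'I_n -> 'I_n) (c : 'I_n -> K) (m : 'I_n -> int).
Hypotheses (tauK : involutive tau) (c0 : forall i, c i != 0).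
Hypothesis mtau : forall i, m (tau i) = - 1 - m i.
Hypothesis DeltaE : forall i j, m i + m j < 0 -> Delta i j = (c i * (j == tau i)%:R)%:A.
Variable B : nat.
Hypothesis mB : forall i j, m j - m i < B%:Z.

Let C : 'M[A]_n := \matrix_(i, j) (c i * (j == tau i)%:R)%:A.
Let C' : 'M[A]_n := \matrix_(i, j) ((c (tau i))^-1 * (j == tau i)%:R)%:A.

Lemma monomial_mulmx (d : 'I_n -> K) (X : 'M[A]_n) i j :
  ((\matrix_(i, j) (d i * (j == tau i)%:R)%:A : 'M[A]_n) *m X) i j = d i *: X (tau i) j.
Proof.
rewrite mxE (bigD1 (tau i)) //= big1 => [|k /negPf kt].
  by rewrite mxE eqxx mulr1 addr0 -scalerAl mul1r.
by rewrite mxE kt mulr0 scale0r mul0r.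
Qed.

Let CC' : C *m C' = 1%:M.
Proof.
apply/matrixP => i j; rewrite monomial_mulmx !mxE tauK scalerA mulrA mulfV // mul1r.
by rewrite eq_sym; case: eqP; rewrite ?scale1r ?scale0r.
Qed.

Let U := 1%:M - C' *m Delta.

Let U0 i j : m j <= m i -> U i j = 0.
Proof.
move=> ji; rewrite /U mxE [X in _ + X]mxE monomial_mulmx mxE.
rewrite DeltaE; last by rewrite mtau; lia.
rewrite tauK scalerA mulrA mulVf // mul1r eq_sym.
by case: eqP => _; rewrite ?scale1r ?scale0r subrr.
Qed.

Let expU0 k i j : m j - m i < k%:Z -> (U ^+ k) i j = 0.
Proof.
elim: k i j => [|k IH] i j ij.
  by rewrite expr0 mxE; case: eqP => // e; rewrite e in ij; lia.
rewrite exprS mxE big1 // => l _; have [li|il] := boolP (m l <= m i).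
  by rewrite U0 ?mul0r.
by rewrite IH ?mulr0 //; lia.
Qed.

Let S := \sum_(k < B) U ^+ k.

Let S0 i j : m j < m i -> S i j = 0.
Proof. by move=> ji; rewrite summxE big1 // => k _; rewrite expU0 //; lia. Qed.

Let expUB : U ^+ B = 0.
Proof. by apply/matrixP => i j; rewrite expU0 ?mxE. Qed.

Let SU : S * (1 - U) = 1.
Proof.
rewrite mulrBr mulr1 -[RHS]subr0 -expUB /S.
elim: (B) => [|k IH]; first by rewrite big_ord0 expr0 mul0r !subrr.
rewrite big_ord_recr /= mulrDl -exprSr opprD addrACA IH.
by rewrite addrA addrNK.
Qed.

Let US : (1 - U) * S = 1.
Proof.
rewrite mulrBl mul1r -[RHS]subr0 -expUB /S.
elim: (B) => [|k IH]; first by rewrite big_ord0 expr0 mulr0 !subrr.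
rewrite big_ord_recr /= mulrDr -exprS opprD addrACA IH.
by rewrite addrA addrNK.
Qed.

Let C'Delta : C' *m Delta = 1 - U.
Proof. by rewrite /U opprB addrC addrNK. Qed.

(** Multiplied by the inverse of its antidiagonal part [C], the matrix
    becomes 1 - U with U strictly triangular for the grading, which is
    inverted by a finite geometric series. *)
Lemma antitriangular_inverse : exists D : 'M[A]_n,
  [/\ Delta *m D = 1%:M, D *m Delta = 1%:M
    & forall i j, 0 <= m i + m j -> D i j = 0].
Proof.
exists (S *m C'); split.
- rewrite -[Delta]mul1mx -CC' -(mulmxA C) C'Delta -mulmxA (mulmxA (1 - U)).
  by rewrite [(1 - U) *m S]US mul1mx.
- by rewrite -mulmxA C'Delta [LHS]SU.
- move=> i j ij; rewrite mxE big1 // => k _; rewrite [C' k j]mxE.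
  have [jk|_] := eqVneq; last by rewrite mulr0 scale0r mulr0.
  rewrite S0 ?mul0r //; move: ij; rewrite jk mtau; lia.
Qed.
End AntiTriangular.

(** * Triangular changes of generators *)

Section Triangular.
Variables (K : fieldType) (G : choiceType) (par : G -> bool) (A : freeSuper K par).
Variable rk : G -> nat.

Inductive low (n : nat) : A -> Prop :=
| low_one : low n 1
| low_gen g : (rk g < n)%N -> low n (gen A g)
| low_lin c x y : low n x -> low n y -> low n (c *: x + y)
| low_mul x y : low n x -> low n y -> low n (x * y).

Lemma low0 n : low n 0.
Proof. by rewrite -(addNr 1) -scaleN1r; apply: low_lin; apply: low_one. Qed.

Lemma lowZ n c x : low n x -> low n (c *: x).
Proof. by move=> lx; rewrite -[_ *: _]addr0; apply/low_lin/low0. Qed.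

Lemma lowD n x y : low n x -> low n y -> low n (x + y).
Proof. by move=> lx ly; rewrite -[x]scale1r; apply: low_lin. Qed.

Lemma lowN n x : low n x -> low n (- x).
Proof. by rewrite -scaleN1r; apply: lowZ. Qed.

Lemma low_sum n (J : Type) (r : seq J) (Q : pred J) (F : J -> A) :
  (forall i, Q i -> low n (F i)) -> low n (\sum_(i <- r | Q i) F i).
Proof. by move=> lF; apply: (big_ind (low n)) => //; [apply: low0 | apply: lowD]. Qed.

Lemma lowW m n x : (m <= n)%N -> low m x -> low n x.
Proof.
move=> mn; elim=> [|g gm|c y z _ ly _ lz|y z _ ly _ lz].
- exact: low_one.
- exact/low_gen/(leq_trans gm).
- exact: low_lin.
- exact: low_mul.
Qed.

Lemma low_eq n (B : algType K) (f h : A -> B) x : algHom f -> algHom h ->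
  (forall g, (rk g < n)%N -> f (gen A g) = h (gen A g)) -> low n x -> f x = h x.
Proof.
move=> hf hh fh; elim=> [|g /fh //|c y z _ IHy _ IHz|y z _ IHy _ IHz].
- by rewrite (hom1 hf) (hom1 hh).
- by rewrite (homP hf) (homP hh) IHy IHz.
- by rewrite (homM hf) (homM hh) IHy IHz.
Qed.

Definition triangular (c : G -> K) (u : G -> A) :=
  forall g, homog (par g) (u g) /\ low (rk g) (u g - c g *: gen A g).

Variable bound : nat.
Hypothesis rk_bound : forall g, (rk g < bound)%N.

Lemma triangular_ev c u n x : triangular c u -> low n x -> low n (ev u x).
Proof.
move=> tu; have uC := homog_ev_comm (fun g => proj1 (tu g)); have hu := ev_hom A uC.
elim=> [|g gn|d y z _ ly _ lz|y z _ ly _ lz].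
- by rewrite (hom1 hu); apply: low_one.
- rewrite (ev_gen A uC) -[u g](subrK (c g *: gen A g)); apply: lowD.
    by apply: lowW (proj2 (tu g)); apply: ltnW.
  exact/lowZ/low_gen.
- by rewrite (homP hu); apply: low_lin.
- by rewrite (homM hu); apply: low_mul.
Qed.

(** Successive approximation, which solves for one more rank at each step. *)
Lemma triangular_right_inverse c u : (forall g, c g != 0) -> triangular c u ->
  exists2 v, triangular (fun g => (c g)^-1) v & forall x, ev u (ev v x) = x.
Proof.
move=> c0 tu; have uC := homog_ev_comm (fun g => proj1 (tu g)); have hu := ev_hom A uC.
have uP : homog_pres (ev u : A -> A).
  by apply: homog_presP hu _ => g; rewrite (ev_gen A uC); case: (tu g).
suff main k : exists2 v, triangular (fun g => (c g)^-1) v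
    & forall g, (rk g < k)%N -> ev u (v g) = gen A g.
  have [v tv vK] := main bound; exists v => //.
  have vC := homog_ev_comm (fun g => proj1 (tv g)); have hv := ev_hom A vC.
  apply: (algHom_eq (algHom_comp hu hv) (algHom_id A)) => g /=.
  by rewrite (ev_gen A vC) vK.
elim: k => [|k [v tv vK]].
  exists (fun g => (c g)^-1 *: gen A g) => // g; rewrite subrr.
  by split; [apply/homogZ/homog_gen | apply: low0].
have vC := homog_ev_comm (fun g => proj1 (tv g)); have hv := ev_hom A vC.
have vP : homog_pres (ev v : A -> A).
  by apply: homog_presP hv _ => g; rewrite (ev_gen A vC); case: (tv g).
exists (fun g => (c g)^-1 *: (gen A g - ev v (u g - c g *: gen A g))) => [g|g gk].
  have [hg lg] := tu g; split.
    apply/homogZ/homogB; first exact: homog_gen.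
    by apply/vP/homogB => //; apply/homogZ/homog_gen.
  rewrite scalerBr addrC addrA addNr add0r; apply/lowN/lowZ.
  exact: triangular_ev tv lg.
rewrite (homZ hu) (homB hu) (ev_gen A uC).
have -> : ev u (ev v (u g - c g *: gen A g)) = u g - c g *: gen A g.
  apply: (low_eq (n := k) (algHom_comp hu hv) (algHom_id A)) => [h hk /=|].
    by rewrite (ev_gen A vC) vK.
  by apply: lowW (proj2 (tu g)); rewrite -ltnS.
by rewrite opprB addrC addrNK scalerA mulVf ?scale1r.
Qed.

(** The right inverse is triangular too, so it has a right inverse of its
    own. *)
Lemma triangular_bij c u : (forall g, c g != 0) -> triangular c u ->
  exists2 v, (forall g, homog (par g) (v g)) &
    cancel (ev u : A -> A) (ev v : A -> A) /\ cancel (ev v : A -> A) (ev u : A -> A).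
Proof.
move=> c0 tu; have [v tv uv] := triangular_right_inverse c0 tu.
have cV0 g : (c g)^-1 != 0 by rewrite invr_eq0.
have [w tw vw] := triangular_right_inverse cV0 tv.
exists v => [g|]; first by case: (tv g).
have uw (x : A) : ev u x = ev w x by rewrite -[in LHS](vw x) uv.
by split=> x //; rewrite uw vw.
Qed.
End Triangular.

(** * The constraints and their Dirac bracket *)

Section Reduction.
Variables (K : fieldType).
Hypothesis char0 : forall n, n.+1%:R != 0 :> K.
Variables (M N p : nat) (ep em e0 : 'M[K]_p).
Hypothesis p_gt0 : (0 < p)%N.
Hypothesis psl2 : principal_sl2 ep em e0.
Variables (g g' : 'M[K]_p).
Hypotheses (g'g : g' * g = 1) (gg' : g * g' = 1).
Hypotheses (emg : em * g = g * down_mx K p).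
Hypotheses (epg : (2%:R *: ep) * g = g * up_chain_mx K p).
Variables (P : freeSuper K (@ppar M N p)) (A : freeSuper K (@wpar M N p)).
Local Notation I := 'I_(M + N).
Local Notation spinmx := (spinmx ep em).
Local Notation spin_norm := (spin_norm ep em).
Local Notation spincoord := (spincoord ep em).
Implicit Types (a b c d : I) (t : spin p) (D E Y : 'M[K]_p).

Definition pbr (u v : pidx M N p) : P :=
  let: (a, b, k, l) := u in let: (c, d, r, s) := v in
  ((b == c) && (l == r))%:R *: gen P (a, d, k, s)
  - ((-1) ^+ (grade2 a b && grade2 c d) * ((a == d) && (k == s))%:R) *:
      gen P (c, b, r, l).

Lemma homog_pbr u v : homog (ppar u (+) ppar v) (pbr u v).
Proof.
case: u v => [[[a b] k] l] [[[c d] r] s] /=.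
apply: homogB; last rewrite mulrC -scalerA.
  apply: homog_delta => /andP[/eqP -> _].
  have := homog_gen P (a, d, k, s); rewrite /ppar /grade2 /=.
  by case: (grade a) (grade c) (grade d) => [] [] [].
apply: homog_delta => /andP[/eqP -> _]; apply: homogZ.
have := homog_gen P (c, b, r, l); rewrite /ppar /grade2 /=.
by case: (grade b) (grade c) (grade d) => [] [] [].
Qed.

Let hbr := bider_br homog_pbr.

(** A linear function on gl(Mp|Np) is given by matrices [D], paired
    entrywise with the blocks of generators; brackets are then computed by
    products of matrices ([br_lincoord]). *)
Definition lincoord a b D : P := \sum_k \sum_l D k l *: gen P (a, b, k, l).
Local Notation X := lincoord.

Lemma homog_lincoord a b D : homog (grade2 a b) (X a b D).
Proof.
apply: homog_sum => k _; apply: homog_sum => l _; apply: homogZ.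
exact: (homog_gen P (a, b, k, l)).
Qed.

Lemma lincoordP a b x D E : X a b (x *: D + E) = x *: X a b D + X a b E.
Proof.
rewrite /X scaler_sumr -big_split; apply: eq_bigr => k _ /=.
rewrite scaler_sumr -big_split; apply: eq_bigr => l _ /=.
by rewrite !mxE scalerDl scalerA.
Qed.

Lemma lincoord0 a b : X a b 0 = 0.
Proof. by rewrite /X big1 // => k _; rewrite big1 // => l _; rewrite mxE scale0r. Qed.

Lemma lincoordZ a b x D : X a b (x *: D) = x *: X a b D.
Proof. by rewrite -[x *: D]addr0 lincoordP lincoord0 addr0. Qed.

Lemma lincoord_sum (T : Type) (r : seq T) (Q : pred T) (F : T -> 'M[K]_p) a b :
  X a b (\sum_(i <- r | Q i) F i) = \sum_(i <- r | Q i) X a b (F i).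
Proof.
apply: (big_morph (X a b) _ (lincoord0 a b)) => D E.
by rewrite -[D]scale1r lincoordP !scale1r.
Qed.

Lemma lincoord_delta a b k l : X a b (delta_mx k l) = gen P (a, b, k, l).
Proof.
rewrite /X (bigD1 k) //= [X in _ + X]big1 => [|r /negPf rk]; last first.
  by rewrite big1 // => s _; rewrite mxE rk scale0r.
rewrite addr0 (bigD1 l) //= big1 => [|s /negPf sl]; last first.
  by rewrite mxE sl andbF scale0r.
by rewrite mxE !eqxx scale1r addr0.
Qed.

Lemma br_lincoord a b c d D E :
  br pbr (X a b D) (X c d E)
  = (b == c)%:R *: X a d (D * E)
    - ((-1) ^+ (grade2 a b && grade2 c d) * (a == d)%:R) *: X c b (E * D).
Proof.
have delta k l r (s : 'I_p) : br pbr (gen P (a, b, k, l)) (gen P (c, d, r, s))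
    = (b == c)%:R *: X a d (delta_mx k l * delta_mx r s)
    - ((-1) ^+ (grade2 a b && grade2 c d) * (a == d)%:R) *:
      X c b (delta_mx r s * delta_mx k l).
  rewrite br_gen /= -[delta_mx k l * _]/(_ *m _) -[delta_mx r s * _]/(_ *m _).
  rewrite !mul_delta_mx_cond -!scaler_nat !lincoordZ !lincoord_delta !scalerA.
  by rewrite -!mulnb !natrM mulrA [s == k]eq_sym.
rewrite {1}/X (bd_suml hbr) [D in RHS]matrix_sum_delta.
rewrite !(mulr_suml, mulr_sumr) !lincoord_sum !scaler_sumr -sumrB.
apply: eq_bigr => k _; rewrite (bd_suml hbr).
rewrite !(mulr_suml, mulr_sumr) !lincoord_sum !scaler_sumr -sumrB.
apply: eq_bigr => l _; rewrite (bdZl hbr) mxZl mxZr !lincoordZ.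
rewrite {1}/X (bd_sumr hbr) scaler_sumr [E in RHS]matrix_sum_delta.
rewrite !(mulr_suml, mulr_sumr) !lincoord_sum !scaler_sumr -sumrB.
apply: eq_bigr => r _; rewrite (bd_sumr hbr) scaler_sumr.
rewrite !(mulr_suml, mulr_sumr) !lincoord_sum !scaler_sumr -sumrB.
apply: eq_bigr => s _; rewrite (bdZr hbr) mxZl mxZr !lincoordZ delta.
rewrite !scalerBr !scalerA; congr (_ *: _ - _ *: _).
  by rewrite mulrC mulrA.
by rewrite mulrC mulrA.
Qed.

Definition cgen (u : pidx M N p) : A :=
  let: (a, b, k, l) := u in
  ((-1) ^+ grade a * (a == b)%:R * em k l)%:A
  + \sum_(j < p) sl2mx ep em j 0 k l *: gen A (a, b, j).

Lemma homog_scalar (H : choiceType) (q : H -> bool) (B : freeSuper K q) a b (x : K) :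
  homog (grade2 a b) (((a == b)%:R * x)%:A : B).
Proof.
case: eqP => [->|_]; last by rewrite mul0r scale0r; apply: homog0.
by rewrite /grade2 addbb; apply/homogZ/homog1.
Qed.

Lemma homog_cgen u : homog (ppar u) (cgen u).
Proof.
case: u => [[[a b] k] l]; apply: homogD.
  by rewrite mulrAC mulrC; apply: homog_scalar.
by apply: homog_sum => j _; apply: homogZ; apply: (homog_gen A (a, b, j)).
Qed.

(** The restriction of functions to the constrained manifold. *)
Definition rho : P -> A := ev cgen.

Let cgenC := homog_ev_comm homog_cgen.

Lemma rho_hom : algHom rho. Proof. exact: ev_hom cgenC. Qed.

Lemma rho_gen u : rho (gen P u) = cgen u. Proof. exact: ev_gen. Qed.

Lemma rho_pres : homog_pres rho.
Proof. by apply: homog_presP rho_hom _ => u; rewrite rho_gen; apply: homog_cgen. Qed.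

(** The value at [Y] of the linear function given by [D]. *)
Definition pair D Y : K := \sum_k \sum_l D k l * Y k l.

Lemma pairE D Y : pair D Y = \tr (D^T * Y).
Proof.
rewrite /pair exchange_big; apply: eq_bigr => l _; rewrite mxE.
by apply: eq_bigr => k _; rewrite mxE.
Qed.

Lemma rho_lincoord a b D :
  rho (X a b D) = ((-1) ^+ grade a * (a == b)%:R * pair D em)%:A
    + \sum_(j < p) pair D (sl2mx ep em j 0) *: gen A (a, b, j).
Proof.
rewrite /X (hom_sum rho_hom); under eq_bigr => k _ do rewrite (hom_sum rho_hom).
under eq_bigr => k _ do under eq_bigr => l _ do
  rewrite (homZ rho_hom) rho_gen scalerDr scalerA mulrCA.
under eq_bigr => k _ do rewrite big_split /=.
rewrite big_split /=; congr (_ + _).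
  under eq_bigr => k _ do rewrite -scaler_suml -mulr_sumr.
  by rewrite -scaler_suml -mulr_sumr.
under [RHS]eq_bigr => j _ do rewrite /pair scaler_suml.
rewrite [RHS]exchange_big; apply: eq_bigr => k _ /=.
under [RHS]eq_bigr => j _ do rewrite scaler_suml.
rewrite [RHS]exchange_big; apply: eq_bigr => l _ /=.
by rewrite scaler_sumr; apply: eq_bigr => j _; rewrite scalerA.
Qed.

Let scE := spincoordE char0 p_gt0 psl2 g'g gg' emg epg.
Let sc_tr := spincoord_tr char0 p_gt0 psl2 g'g gg' emg epg.
Let norm0 := spin_norm_neq0 char0 p_gt0 psl2 g'g gg' emg epg.
Let tr_spin := tr_spinmx char0 p_gt0 psl2 g'g gg' emg epg.

(** The linear function which takes the coordinate of spin [t]. *)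
Definition dualmx t : 'M[K]_p := \matrix_(k, l) spincoord t (delta_mx k l).

Lemma dualmxE t : dualmx t = (spin_norm t)^-1 *: (spinmx (spin_dual t))^T.
Proof.
apply/matrixP => k l; rewrite !mxE sc_tr; congr (_ * _).
rewrite /mxtrace (bigD1 k) //= [X in _ + X]big1 => [|i /negPf ik]; last first.
  by rewrite mxE big1 // => j _; rewrite mxE ik mul0r.
rewrite addr0 mxE (bigD1 l) //= big1 => [|j /negPf jl]; last first.
  by rewrite mxE jl andbF mul0r.
by rewrite mxE !eqxx mul1r addr0.
Qed.

Lemma pair_dualmx t Y : pair (dualmx t) Y = spincoord t Y.
Proof.
by rewrite pairE dualmxE linearZ /= trmxK mxZl linearZ /= sc_tr trC.
Qed.

Lemma pair_dualmx2 t (s : spin p) Y : pair (dualmx t * dualmx s) Y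
  = (spin_norm t)^-1 * (spin_norm s)^-1
    * \tr (spinmx (spin_dual s) * spinmx (spin_dual t) * Y).
Proof.
rewrite pairE !dualmxE mxZl mxZr scalerA linearZ /= mxZl linearZ /=.
by rewrite -[_^T * _^T]/(_ *m _) trmx_mul !trmxK.
Qed.

Lemma spincoord_spinmx t (s : spin p) : spincoord t (spinmx s) = (s == t)%:R.
Proof. by rewrite sc_tr tr_spin mulrCA mulVf ?mulr1. Qed.

(** The generator J^(ab)_(jm). *)
Definition spingen a b t : P :=
  \sum_(k < p) \sum_(l < p)
    coord (sl2basis ep em) (enum_rank t) (delta_mx k l) *: gen P (a, b, k, l).

Lemma spingenE a b t : spingen a b t = X a b (dualmx t).
Proof. by apply: eq_bigr => k _; apply: eq_bigr => l _; rewrite mxE. Qed.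

Lemma homog_spingen a b t : homog (grade2 a b) (spingen a b t).
Proof. by rewrite spingenE; apply: homog_lincoord. Qed.

Lemma gen_spingen a b k l : gen P (a, b, k, l) = \sum_t spinmx t k l *: spingen a b t.
Proof.
rewrite -lincoord_delta; under eq_bigr => t _ do rewrite spingenE -lincoordZ.
rewrite -lincoord_sum; congr (X a b _); apply/matrixP => r s.
transitivity ((delta_mx r s : 'M[K]_p) k l).
  by rewrite !mxE [r == k]eq_sym [s == l]eq_sym.
rewrite {1}(scE (delta_mx r s)) !summxE.
by apply: eq_bigr => t _; rewrite !mxE mulrC.
Qed.

Definition cval (a b : I) (t : spin p) : K :=
  2^-1 * (-1) ^+ grade a
     * [&& a == b, tag t == 1%N :> nat & tagged t == 2 :> nat]%:R.

Lemma sl2mx_em : sl2mx ep em 1 2 = - 2%:R *: em.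
Proof.
have [_ h0m hpm _] := psl2.
rewrite !sl2mxS /= !expr1 !cmZ scaleNr -scalerN; congr (_ *: _).
rewrite [cm em ep]cm_anti [cm ep em]hpm cm_anti cmNl opprK.
exact: h0m.
Qed.

Lemma spincoord_em t :
  spincoord t em = - (2^-1 * ((tag t == 1%N :> nat) && (tagged t == 2 :> nat))%:R).
Proof.
have [p1|p2] := leqP p 1.
  have em0 : em = 0.
    rewrite -[em]mulr1 -gg' mulrA emg (_ : down_mx K p = 0) ?mulr0 ?mul0r //.
    apply/matrixP => k l; rewrite !mxE; case: eqP => //= kl.
    by have := ltn_ord k; lia.
  rewrite [X in spincoord _ X]em0 sc_tr mul0r linear0 mulr0 (_ : _ && _ = false) ?mulr0 ?oppr0 //.
  by apply/negP => /andP[/eqP j1 _]; have := ltn_ord (tag t); lia.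
pose t1 : spin p := existT (fun j : 'I_p => 'I_(2 * j).+1) (Ordinal p2) (inord 2).
have emE : em = - 2^-1 *: spinmx t1.
  rewrite /spinmx /= inordK // sl2mx_em scalerA mulrNN mulVf ?scale1r //.
rewrite [X in spincoord _ X]emE sc_tr mxZl linearZ /= mulrCA -sc_tr spincoord_spinmx mulNr.
congr (- (_ * (nat_of_bool _)%:R)); apply/esym; case: t => j i /=.
apply/andP/eqP => [[/eqP j1 /eqP i2]|e].
  have ej : j = Ordinal p2 by apply: val_inj.
  by subst j; congr existT; apply: val_inj; rewrite /= inordK.
split; first by apply/eqP; have := congr1 (fun t : spin p => val (tag t)) e.
by have := congr1 (fun t : spin p => nat_of_ord (tagged t)) e; rewrite /= inordK // => e2; apply/eqP; exact: (esym e2).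
Qed.

Definition phi (c : cidx M N p) : P :=
  let: (a, b, t) := val c in spingen a b t + (cval a b t)%:A.

(** Functions of the W^(ab)_j, seen as functions of the highest weight
    coordinates J^(ab)_(jj) that do not depend on the other coordinates. *)
Definition extend : A -> P := ev (fun u : widx M N p => spingen u.1.1 u.1.2 (highest u.2)).

Let extendC := @homog_ev_comm K _ _ (@wpar M N p) _ P
  (fun u => spingen u.1.1 u.1.2 (highest u.2))
  (fun u => homog_spingen u.1.1 u.1.2 (highest u.2)).

Lemma extend_hom : algHom extend. Proof. exact: (@ev_hom K _ _ A P _ extendC). Qed.

Lemma extend_gen a b j : extend (gen A (a, b, j)) = spingen a b (highest j).
Proof. exact: (@ev_gen K _ _ A P _ extendC). Qed.

Lemma extend_pres : homog_pres extend.
Proof.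
apply: (homog_presP extend_hom) => -[[a b] j]; rewrite extend_gen.
exact: homog_spingen.
Qed.

Lemma rho_spingen a b t : rho (spingen a b t)
  = (- cval a b t)%:A + \sum_(j < p) (highest j == t)%:R *: gen A (a, b, j).
Proof.
rewrite spingenE rho_lincoord pair_dualmx spincoord_em; congr (_%:A + _).
  rewrite mulrN /cval; congr (- _); rewrite -!mulnb !natrM; ring.
apply: eq_bigr => j _; rewrite pair_dualmx -spincoord_spinmx.
by [].
Qed.

Lemma extendK x : rho (extend x) = x.
Proof.
have h := algHom_comp rho_hom extend_hom.
apply: (algHom_eq h (algHom_id A)) => -[[a b] j] /=.
rewrite extend_gen rho_spingen /cval /= !andbF mulr0 oppr0 scale0r add0r.
rewrite (bigD1 j) //= eqxx scale1r big1 ?addr0 // => k kj.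
rewrite (_ : (_ == _) = false) ?scale0r //.
by apply/negP => /eqP/(congr1 tag) /= e; rewrite e eqxx in kj.
Qed.

Lemma homog_phi (z : cidx M N p) :
  homog (grade2 (val z).1.1 (val z).1.2) (phi z).
Proof.
rewrite /phi; case: (val z) => -[a b] t /=; apply: homogD.
  exact: homog_spingen.
have -> : cval a b t = (a == b)%:R * (2^-1 * (-1) ^+ grade a
    * ((tag t == 1%N :> nat) && (tagged t == 2 :> nat))%:R).
  by rewrite /cval -!mulnb !natrM; ring.
exact: homog_scalar.
Qed.

(** Expand the generator in the J^(ab)_(jm): the labels with m = j make up
    the extension of its restriction, and the others contribute a constraint
    each. *)
Lemma phi_extend_gen (u : pidx M N p) (Q : P -> Prop) : Q (extend (rho (gen P u))) ->
  (forall x (k : K) (c : cidx M N p), Q x -> Q (x + k *: phi c)) -> Q (gen P u).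
Proof.
case: u => [[[a b] k] l] Q0 QS.
have emE : (-1) ^+ grade a * (a == b)%:R * em k l = - \sum_t spinmx t k l * cval a b t.
  rewrite {1}(scE em) summxE mulr_sumr -sumrN; apply: eq_bigr => t _.
  by rewrite mxE spincoord_em /cval -!mulnb !natrM; ring.
pose F t := if tagged t == 0 :> nat then 0 else spinmx t k l *: (spingen a b t + (cval a b t)%:A).
suff -> : gen P (a, b, k, l) = extend (rho (gen P (a, b, k, l))) + \sum_t F t.
  elim: (index_enum _) (extend _) Q0 => [|t r IH] x Qx; first by rewrite big_nil addr0.
  rewrite big_cons addrA; apply: IH; rewrite /F; case: eqP => [_|/eqP t0].
    by rewrite addr0.
  have ct : (0 < tagged (a, b, t).2)%N by rewrite lt0n.
  exact: (QS _ _ (exist _ (a, b, t) ct)).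
rewrite rho_gen /= (homD extend_hom) (homZ extend_hom) (hom1 extend_hom) (hom_sum extend_hom).
under [X in _ = _ + X + _]eq_bigr => j _ do rewrite (homZ extend_hom) extend_gen.
have -> : \sum_(j < p) sl2mx ep em j 0 k l *: spingen a b (highest j)
    = \sum_(t : spin p) (if tagged t == 0 :> nat then spinmx t k l *: spingen a b t else 0).
  rewrite -big_mkcond /= (reindex_onto (fun j : 'I_p => highest j) (fun t => tag t)) /=.
    by apply: eq_big => j //=; rewrite !eqxx.
  by case=> j i /= /eqP i0; congr existT; apply: val_inj.
rewrite gen_spingen emE scaleNr scaler_suml -addrA -big_split -sumrN -big_split.
apply: eq_bigr => t _ /=; rewrite /F; case: eqP => [t0|_].
  by rewrite addr0 /cval t0 !andbF !mulr0 scale0r oppr0 add0r.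
by rewrite add0r scalerDr scalerA addrC addrK.
Qed.

Definition weight (z : cidx M N p) : int :=
  (tag (val z).2)%:Z - (tagged (val z).2)%:Z.

(** The label (j, - 1 - m). The invariant form pairs (j, m) with (j, - m),
    and one of the two weights is lowered by the constant value [em] of the
    generator matrix. *)
Definition conj_spin t : spin p :=
  existT _ (tag t) (inord ((2 * tag t).+1 - tagged t)).

Definition conj_idx (z : I * I * spin p) : I * I * spin p :=
  (z.1.2, z.1.1, conj_spin z.2).

Lemma conj_spin_val t : (0 < tagged t)%N ->
  tagged (conj_spin t) = ((2 * tag t).+1 - tagged t)%N :> nat.
Proof. by move=> t0; rewrite /= inordK //; lia. Qed.

Lemma conj_idx_gt0 (z : cidx M N p) : (0 < tagged (conj_idx (val z)).2)%N.
Proof.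
case: z => -[[a b] t] /= t0; rewrite conj_spin_val //.
by have := ltn_ord (tagged t); lia.
Qed.

Definition conj_cidx (z : cidx M N p) : cidx M N p :=
  exist (fun x : I * I * spin p => (0 < tagged x.2)%N) (conj_idx (val z)) (conj_idx_gt0 z).

Lemma conj_cidxK : involutive conj_cidx.
Proof.
move=> z; apply: val_inj => /=; case: z => -[[a b] t] /= t0.
rewrite /conj_idx /=; congr (_, _); case: t t0 => j i /= i0.
rewrite /conj_spin /=; congr existT; apply: val_inj => /=.
by have := ltn_ord i => ij; rewrite !inordK //; lia.
Qed.

Lemma weight_conj z : weight (conj_cidx z) = - 1 - weight z.
Proof.
case: z => -[[a b] t] /= t0; rewrite /weight conj_spin_val //=.
by have := ltn_ord (tagged t); lia.
Qed.

Lemma tr_cm (Y Z : 'M[K]_p) : \tr (cm Y Z) = 0.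
Proof. by rewrite /cm linearB /= [\tr (Z * _)]trC subrr. Qed.

Lemma tr_weight (Z1 Z2 Z3 : 'M[K]_p) (w1 w2 w3 : K) :
  cm e0 Z1 = w1 *: Z1 -> cm e0 Z2 = w2 *: Z2 -> cm e0 Z3 = w3 *: Z3 ->
  w1 + w2 + w3 != 0 -> \tr (Z1 * Z2 * Z3) = 0.
Proof.
move=> h1 h2 h3 w0.
have : \tr (cm e0 (Z1 * Z2 * Z3)) = (w1 + w2 + w3) * \tr (Z1 * Z2 * Z3).
  have -> : cm e0 (Z1 * Z2 * Z3)
      = cm e0 Z1 * Z2 * Z3 + Z1 * cm e0 Z2 * Z3 + Z1 * Z2 * cm e0 Z3.
    rewrite /cm !(mulrBl, mulrBr) !mulrA.
    by rewrite !addrA !addrNK.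
  by rewrite h1 h2 h3 !(mxZl, mxZr) -!scalerDl linearZ.
rewrite tr_cm => /esym/eqP; rewrite mulf_eq0 (negPf w0).
by move/eqP.
Qed.

(** The trace of a product of weight vectors vanishes unless the weights add
    up to zero; here the dual weights add up to a positive number and [j] is
    not negative. *)
Lemma pair_weight (z z' : cidx M N p) (j : 'I_p) : weight z + weight z' < 0 ->
  pair (dualmx (val z).2 * dualmx (val z').2) (sl2mx ep em j 0) = 0.
Proof.
rewrite /weight; move: (val z).2 (val z').2 => t s w.
rewrite pair_dualmx2 /spinmx (@tr_weight _ _ _ _ _ _ (sl2mx_weight psl2 _ _)
  (sl2mx_weight psl2 _ _) (sl2mx_weight psl2 _ _)) ?mulr0 //.
have := ltn_ord (tagged t); have := ltn_ord (tagged s) => sj tj.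
rewrite /= !subSS; set w0 := (X in X != 0).
have -> : w0 = (tagged s + tagged t + j)%:R - (tag s + tag t)%:R.
  by rewrite /w0 !natrB ?natrM ?natrD //; try (rewrite -ltnS //); ring.
by rewrite subr_eq0; apply/negP => /eqP/(natr_inj char0); lia.
Qed.

(** The commutator with [em] sends the dual vector of [t] to a multiple of
    the dual vector of its conjugate. *)
Lemma pair_em t (s : spin p) : (0 < tagged t)%N ->
  pair (dualmx t * dualmx s) em - pair (dualmx s * dualmx t) em
  = - (spin_norm t)^-1 * (s == conj_spin t)%:R.
Proof.
move=> t0; have conjE : spinmx (conj_spin t) = cm em (spinmx (spin_dual t)).
  rewrite -sl2mxS /spinmx conj_spin_val //= subSS subSn //.
  by have := ltn_ord (tagged t); lia.
rewrite !pair_dualmx2 [(spin_norm s)^-1 * _]mulrC -mulrBr.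
have -> : \tr (spinmx (spin_dual s) * spinmx (spin_dual t) * em)
    - \tr (spinmx (spin_dual t) * spinmx (spin_dual s) * em)
    = - \tr (spinmx (conj_spin t) * spinmx (spin_dual s)).
  rewrite conjE /cm mulrBl linearB /= opprB; congr (_ - _).
    by rewrite -mulrA trC.
  by rewrite trC mulrA.
rewrite tr_spin eq_sym mulrN mulNr -mulrA; congr (- (_ * _)).
by rewrite mulrCA mulVf ?mulr1.
Qed.

Definition antidiag (z : cidx M N p) : K :=
  - ((-1) ^+ grade (val z).1.1 * (spin_norm (val z).2)^-1).

Lemma antidiag_neq0 z : antidiag z != 0.
Proof. by rewrite oppr_eq0 mulf_neq0 ?signr_eq0 // invr_eq0. Qed.

(** The bracket of two constraints is linear in the generators. When the
    weights add up to a negative number, its part along the W^(ab)_j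
    vanishes by [pair_weight], and what is left comes from the constant
    [em]. *)
Lemma rho_br_phi (z z' : cidx M N p) : weight z + weight z' < 0 ->
  rho (br pbr (phi z) (phi z')) = (antidiag z * (z' == conj_cidx z)%:R)%:A.
Proof.
move=> w; have W0 := @pair_weight z z' ^~ w.
have W0' := @pair_weight z' z ^~ (eq_ind _ (fun x => x < 0) w _ (addrC _ _)).
have -> : (z' == conj_cidx z) = (val z' == conj_idx (val z)) by [].
rewrite /phi /antidiag; have z0 := valP z.
move: W0 W0' z0; case: (val z) (val z') => [[a b] t] [[c d] s] /= W0 W0' z0.
rewrite (bdDl hbr) (bd_scalarl (algHom_id _) hbr) addr0.
rewrite (bdDr hbr) (bd_scalarr (algHom_id _) hbr) addr0.
rewrite !spingenE br_lincoord (homB rho_hom) !(homZ rho_hom) !rho_lincoord.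
have Z0 x y : \sum_(j < p) pair (dualmx t * dualmx s) (sl2mx ep em j 0)
    *: gen A (x, y, j) = 0 by apply: big1 => j _; rewrite W0 scale0r.
have Z0' x y : \sum_(j < p) pair (dualmx s * dualmx t) (sl2mx ep em j 0)
    *: gen A (x, y, j) = 0 by apply: big1 => j _; rewrite W0' scale0r.
rewrite Z0 Z0' !addr0 !scalerA -scalerBl; congr (_%:A).
rewrite /conj_idx /= !xpair_eqE [c == b]eq_sym [d == a]eq_sym.
have [->|_] := eqVneq b c; have [->|_] := eqVneq a d; rewrite ?(mulr0, mul0r, subrr) //.
rewrite !mul1r !mulr1 mulrA -signr_addb.
have -> : (grade2 d c && grade2 c d) (+) grade c = grade d.
  by rewrite /grade2; case: (grade c) (grade d) => [] [].
by rewrite -mulrBr pair_em // mulNr mulrN mulrA mulNr.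
Qed.

Definition constr (i : 'I_#|{: cidx M N p}|) : P := phi (enum_val i).

Lemma constraint_mx_inverse : exists D : 'M[A]_#|{: cidx M N p}|,
  [/\ constraint_mx pbr rho constr *m D = 1%:M,
      D *m constraint_mx pbr rho constr = 1%:M
    & forall i j, 0 <= weight (enum_val i) + weight (enum_val j) -> D i j = 0].
Proof.
apply: (@antitriangular_inverse K A _ _ (fun i => enum_rank (conj_cidx (enum_val i)))
  (fun i => antidiag (enum_val i)) (fun i => weight (enum_val i)) _ _ _ _ (2 * p)).
- by move=> i; rewrite enum_rankK conj_cidxK enum_valK.
- by move=> i; apply: antidiag_neq0.
- by move=> i; rewrite enum_rankK weight_conj.
- move=> i j w; rewrite mxE rho_br_phi //; congr ((_ * (nat_of_bool _)%:R)%:A).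
  by rewrite -(inj_eq enum_val_inj) enum_rankK.
- move=> i j; rewrite /weight; move: (val _).2 (val _).2 => t s.
  have := ltn_ord (tagged t); have := ltn_ord (tagged s).
  by have := ltn_ord (tag t); have := ltn_ord (tag s); lia.
Qed.

(** * Corner entries of powers and their Dirac bracket *)

(** The linear function which extracts the entry (k, l) in the standard
    basis ([pair_unitF]). The transposes come from the entrywise pairing. *)
Definition unitF (k l : 'I_p) : 'M[K]_p := g'^T * delta_mx k l * g^T.

Let gg'T : g'^T * g^T = 1.
Proof. by rewrite -[_ * _]/(_ *m _) -trmx_mul [g *m g']gg' [LHS]trmx1. Qed.

Let g'gT : g^T * g'^T = 1.
Proof. by rewrite -[_ * _]/(_ *m _) -trmx_mul [g' *m g]g'g [LHS]trmx1. Qed.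

Lemma unitFM k l r s : unitF k l * unitF r s = (l == r)%:R *: unitF k s.
Proof.
rewrite /unitF -mulrA !(mulrA g^T) g'gT mul1r !mulrA -(mulrA _ _ (delta_mx r s)).
rewrite [delta_mx k l * _]mul_delta_mx_cond -scaler_nat mxZr mxZl.
by case: (l == r); rewrite ?scale1r ?scale0r.
Qed.

Lemma unitF_sum D : D = \sum_k \sum_l (g^T * D * g'^T) k l *: unitF k l.
Proof.
have DE : D = g'^T * (g^T * D * g'^T) * g^T.
  by rewrite !mulrA gg'T mul1r -mulrA gg'T mulr1.
rewrite {1}DE; move: (g^T * D * g'^T) => E.
rewrite {1}(matrix_sum_delta E) mulr_sumr mulr_suml; apply: eq_bigr => k _.
rewrite mulr_sumr mulr_suml; apply: eq_bigr => l _.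
by rewrite mxZr mxZl.
Qed.

Lemma pair_unitF k l Y : pair (unitF k l) Y = (g' * Y * g) k l.
Proof.
have FT : (unitF k l)^T = g * (delta_mx l k * g').
  rewrite /unitF -[_ * g^T]/(_ *m _) trmx_mul trmxK; congr (g *m _).
  by rewrite -[_ * delta_mx k l]/(_ *m _) trmx_mul trmxK trmx_delta.
rewrite pairE FT -!mulrA trC -!mulrA.
rewrite (mulrA g'); move: (g' * Y * g) => Z; rewrite /mxtrace (bigD1 l) //= [X in _ + X]big1 => [|i /negPf il].
  rewrite addr0 mxE (bigD1 k) //= [X in _ + X]big1 => [|i /negPf ik].
    by rewrite mxE !eqxx mul1r addr0.
  by rewrite mxE ik andbF mul0r.
by rewrite mxE big1 // => j _; rewrite mxE il mul0r.
Qed.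

Local Notation T := (I * 'I_p)%type.
Definition tpar (x : T) := grade x.1.

(** The entries of the generator matrix in the standard basis, with the sign
    of the column index absorbed as [adjoint] requires. *)
Definition ygen_std (x y : T) : P := (-1) ^+ tpar y *: X x.1 y.1 (unitF x.2 y.2).

Lemma homog_ygen_std x y : homog (tpar x (+) tpar y) (ygen_std x y).
Proof. exact/homogZ/homog_lincoord. Qed.

Lemma ygen_std_adj : adjoint (br pbr) tpar ygen_std ygen_std.
Proof.
move=> [a k] [b l] [c r] [d s]; rewrite /ygen_std /=.
rewrite (bdZl hbr) (bdZr hbr) br_lincoord !unitFM !lincoordZ !scalerBr !scalerA.
rewrite !xpair_eqE /tpar /adj_sign /grade2 /=; congr (_ *: _ - _ *: _).
  by rewrite -mulnb natrM; ring.
have -> : ((a == d) && (k == s))%:R = (a == d)%:R * (k == s)%:R :> K.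
  by rewrite -natrM mulnb.
by rewrite [s == k]eq_sym signr_addb; ring.
Qed.

Definition last_idx : 'I_p := Ordinal (ltac:(by rewrite ltn_predL) : (p.-1 < p)%N).
Definition first_idx : 'I_p := Ordinal p_gt0.

Local Notation pwy := (pw ygen_std).

(** Matrix coefficients between a lowest weight row and a highest weight
    column, which lower triangular transformations do not change. *)
Definition corner n a b : P := pwy n (a, last_idx) (b, first_idx).

Lemma homog_corner n a b : homog (grade2 a b) (corner n a b).
Proof. exact: (homog_pw homog_ygen_std n (a, last_idx) (b, first_idx)). Qed.

Let pw_const (z : P) (x y : T) :
  br pbr (pwy 0 x y) z = 0 /\ br pbr z (pwy 0 x y) = 0.
Proof.
rewrite /=; case: eqP => _; rewrite ?(bd0l hbr) ?(bd0r hbr) //.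
by rewrite (bd1l (algHom_id _) hbr) (bd1r (algHom_id _) hbr).
Qed.

(** Neither of the two terms of the adjoint action occurs: the column of a
    strictly lower entry cannot be the last index, nor its row the first
    one. The second bracket is not deduced from the first by antisymmetry
    but from the quadratic relation with n = 0. *)
Lemma br_lower_corner a b (k l : 'I_p) n c d : (l < k)%N ->
  br pbr (X a b (unitF k l)) (corner n c d) = 0 /\
  br pbr (corner n c d) (X a b (unitF k l)) = 0.
Proof.
move=> lk; have kl := ltn_ord k.
have XE : X a b (unitF k l) = (-1) ^+ grade b *: ygen_std (a, k) (b, l).
  by rewrite /ygen_std scalerA -signr_addb addbb scale1r.
have ne x : ((x, l) == (c, last_idx) :> T) = false.
  by apply/negbTE/negP => /eqP/(congr1 (fun u : T => nat_of_ord u.2)) /=; lia.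
have ne' x : ((x, k) == (d, first_idx) :> T) = false.
  by apply/negbTE/negP => /eqP/(congr1 (fun u : T => nat_of_ord u.2)) /=; lia.
split; rewrite XE.
  rewrite (bdZl hbr) (adjoint_pw hbr homog_ygen_std ygen_std_adj).
  by rewrite ne ne' !scale0r subrr scaler0.
rewrite (bdZr hbr).
have := pw_rtt hbr homog_ygen_std ygen_std_adj n 0 (c, last_idx) (d, first_idx) (a, k) (b, l).
rewrite (proj2 (pw_const _ _ _)) pw1 sub0r => /(canRL (@opprK _)) ->.
rewrite [pwy 0 _ _]/= eq_sym ne [pwy 0 _ _]/= ne'.
by rewrite mul0r mulr0 subrr scaler0 oppr0 scaler0.
Qed.

(** The constraints of negative weight are combinations of strictly lower
    triangular functions; they are the first class constraints. *)
Lemma br_phi_corner (z : cidx M N p) n c d : weight z < 0 ->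
  br pbr (phi z) (corner n c d) = 0 /\ br pbr (corner n c d) (phi z) = 0.
Proof.
rewrite /weight /phi; case: (val z) => -[a b] t /= w.
rewrite (bdDl hbr) (bdDr hbr) (bd_scalarl (algHom_id _) hbr).
rewrite (bd_scalarr (algHom_id _) hbr) !addr0 spingenE.
rewrite (unitF_sum (dualmx t)) lincoord_sum (bd_suml hbr) (bd_sumr hbr).
have main k l : br pbr (X a b ((g^T * dualmx t * g'^T) k l *: unitF k l)) (corner n c d) = 0
   /\ br pbr (corner n c d) (X a b ((g^T * dualmx t * g'^T) k l *: unitF k l)) = 0.
  rewrite lincoordZ (bdZl hbr) (bdZr hbr).
  have [lk|kl] := ltnP l k.
    by have [-> ->] := br_lower_corner a b n c d lk; rewrite scaler0.
  rewrite (_ : (g^T * _ * _) k l = 0) ?scale0r //.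
  have -> : g^T * dualmx t * g'^T
      = (spin_norm t)^-1 *: (std ep em g g' (tag t) (2 * tag t - tagged t))^T.
    have trM (Y Z : 'M[K]_p) : (Y * Z)^T = Z^T * Y^T by apply: trmx_mul.
    by rewrite dualmxE mxZr mxZl /std !trM mulrA /spinmx /= subSS.
  rewrite mxE [X in _ * X]mxE (std_support p_gt0 psl2 g'g gg' emg epg) ?mulr0 //.
  by have := ltn_ord (tagged t); lia.
split; apply: big1 => k _; rewrite lincoord_sum ?(bd_suml hbr) ?(bd_sumr hbr);
  by apply: big1 => l _; case: (main k l).
Qed.

Section DiracBracket.
Variable D : 'M[A]_#|{: cidx M N p}|.
Hypotheses (DE : constraint_mx pbr rho constr *m D = 1%:M).
Hypotheses (ED : D *m constraint_mx pbr rho constr = 1%:M).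

Lemma inverse_weight i j :
  0 <= weight (enum_val i) + weight (enum_val j) -> D i j = 0.
Proof.
have [D' [DE' _ D0]] := constraint_mx_inverse.
suff -> : D = D' by apply: D0.
by rewrite -[D]mulmx1 -DE' mulmxA ED mul1mx.
Qed.

Definition beta (x y : A) : A := dbr pbr rho constr D (extend x) (extend y).

Let hconstr i : homog (grade2 (val (enum_val i)).1.1 (val (enum_val i)).1.2) (constr i)
  := homog_phi (enum_val i).

Lemma beta_bider : bider id beta.
Proof. exact: (bider_lift homog_pbr rho_hom rho_pres hconstr DE ED extend_hom extend_pres extendK). Qed.

Let beta_rho F F' : beta (rho F) (rho F') = dbr pbr rho constr D F F'.
Proof.
apply: (dbr_lift homog_pbr rho_hom rho_pres hconstr DE ED extend_hom extend_pres extendK).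
move=> u Q Q0 QS; apply: phi_extend_gen Q0 _ => x k z Qx.
by rewrite -[z]enum_rankK; apply: QS.
Qed.

(** In each correction term the weights of the two constraints add up to a
    negative number, so one of them is first class and commutes with its
    corner entry. *)
Lemma beta_corner m n a b c d :
  beta (rho (corner m a b)) (rho (corner n c d))
  = rho (br pbr (corner m a b) (corner n c d)).
Proof.
rewrite beta_rho /dbr big1 ?subr0 // => i _; rewrite big1 // => j _.
have [wi|wi] := boolP (weight (enum_val i) < 0).
  by rewrite (proj2 (br_phi_corner _ _ _ wi)) (hom0 rho_hom) !mul0r.
have [wj|wj] := boolP (weight (enum_val j) < 0).
  by rewrite (proj1 (br_phi_corner _ _ _ wj)) (hom0 rho_hom) mulr0.
by rewrite inverse_weight ?mulr0 ?mul0r // addr_ge0 // leNgt.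
Qed.

Definition Rmx n : 'M[A]_(M + N) := \matrix_(a, b) rho (corner (p.-1 + n) a b).

Lemma homog_Rmx n a b : homog (grade a (+) grade b) (Rmx n a b).
Proof. by rewrite mxE; apply/rho_pres/homog_corner. Qed.

Lemma Rmx_rtt m n a b c d :
  beta (Rmx m.+1 a b) (Rmx n c d) - beta (Rmx m a b) (Rmx n.+1 c d)
  = (-1) ^+ rtt_sign (@grade M N) b c d
      *: (Rmx n a d * Rmx m c b - Rmx m a d * Rmx n c b).
Proof.
rewrite !mxE !beta_corner !addnS -(homB rho_hom).
by rewrite (pw_rtt hbr homog_ygen_std ygen_std_adj) (homZ rho_hom) (homB rho_hom) !(homM rho_hom).
Qed.
End DiracBracket.

(** * The generator matrix on the constraints *)

Definition wgen (x y : T) : A := rho (ygen_std x y).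

Lemma wgenE a b (k l : 'I_p) : wgen (a, k) (b, l)
  = ((a == b) && (k == l.+1 :> nat))%:R
    + (-1) ^+ grade b *: \sum_(j < p)
        ((l == k + j :> nat)%N * raise_coef p j k)%:R *: gen A (a, b, j).
Proof.
rewrite /wgen /ygen_std (homZ rho_hom) rho_lincoord scalerDr; congr (_ + _).
  rewrite pair_unitF -(mulrA g') emg (mulrA g') g'g mul1r mxE /tpar /= scalerA.
  have [->|_] := eqVneq a b; last by rewrite mulr0 mul0r mulr0 scale0r.
  by rewrite mulr1 mulrA -signr_addb addbb mul1r scaler_nat andTb.
congr (_ *: _); apply: eq_bigr => j _; rewrite pair_unitF.
by rewrite -[g' * _ * g]/(std ep em g g' j 0) (std0 p_gt0 psl2 g'g gg' epg).
Qed.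

Local Notation Q := (pw wgen).

Lemma rho_pw n x y : rho (pwy n x y) = Q n x y.
Proof.
elim: n x => [|n IH] x /=.
  by case: eqP => _; rewrite ?(hom1 rho_hom) ?(hom0 rho_hom).
rewrite (hom_sum rho_hom); apply: eq_bigr => e _.
by rewrite (homM rho_hom) IH.
Qed.

Lemma wgen_eq0 a b (k l : 'I_p) : (l.+1 < k)%N -> wgen (a, k) (b, l) = 0.
Proof.
move=> lk; rewrite wgenE (_ : (k == l.+1 :> nat) = false) ?andbF ?add0r; last by lia.
rewrite big1 ?scaler0 // => j _; rewrite (_ : (l == _ :> nat) = false) ?mul0n ?scale0r //.
by apply/negbTE/negP => /eqP; lia.
Qed.

(** The restricted matrix has a single lower diagonal, filled with 1; so its
    n-th power reaches exactly n diagonals below the main one, and the last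
    of them is filled with 1. *)
Lemma pw_hess n a b (k l : 'I_p) : (l + n <= k)%N ->
  Q n (a, k) (b, l) = ((a == b) && (k == l + n :> nat)%N)%:R.
Proof.
elim: n a k => [|n IH] a k lk /=; first by rewrite addn0 xpair_eqE.
have k0 : (k.-1 < p)%N by have := ltn_ord k; lia.
rewrite (bigD1 (a, Ordinal k0)) //= [X in _ + X]big1 => [|[e q] eq].
  rewrite addr0 IH /=; last by lia.
  rewrite wgenE eqxx /= prednK ?eqxx; last by lia.
  rewrite big1 => [|j _]; last first.
    by rewrite (_ : (_ == _ :> nat) = false) ?mul0n ?scale0r //; lia.
  rewrite scaler0 addr0 mul1r; congr ((_ && _)%:R).
  by apply/eqP/eqP; lia.
have [kq|kq] := leqP k q.
  by rewrite IH 1?(_ : (q == _ :> nat) = false) ?andbF ?mulr0 //; lia.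
have [kq'|kq'] := ltnP q.+1 k; first by rewrite wgen_eq0 ?mul0r.
have kE : k = q.+1 :> nat by lia.
rewrite wgenE kE eqxx andbT big1 => [|j _]; last first.
  by rewrite (_ : (_ == _ :> nat) = false) ?mul0n ?scale0r //; lia.
rewrite scaler0 addr0; have [ae|] := eqVneq a e; last by rewrite mul0r.
by case/eqP: eq; rewrite ae; congr (_, _); apply: val_inj; rewrite /= kE.
Qed.

Definition Qmx n (k l : 'I_p) : 'M[A]_(M + N) := \matrix_(a, b) Q n (a, k) (b, l).

Lemma QmxD m n k l : Qmx (m + n) k l = \sum_r Qmx m k r *m Qmx n r l.
Proof.
apply/matrixP => a b; rewrite mxE pwD summxE.
under [RHS]eq_bigr => r _ do rewrite mxE.
rewrite exchange_big pair_bigA; apply: eq_bigr => -[e r] _ /=.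
by rewrite !mxE.
Qed.

Lemma Qmx_hess n (k : 'I_p) : (n <= k)%N ->
  Qmx n k first_idx = if (k == n :> nat) then 1%:M else 0.
Proof.
move=> nk; apply/matrixP => a b; rewrite mxE pw_hess //.
rewrite /= add0n.
by case: (_ == n :> nat); rewrite mxE ?andbT ?andbF.
Qed.

(** The first block columns of the first [p] powers form a unitriangular
    system by [Qmx_hess], so they can be eliminated one after the other. *)
Lemma cyclic_span m (V : 'I_p -> 'M[A]_(M + N)) : (m <= p)%N ->
  (forall k : 'I_p, (m <= k)%N -> V k = 0) ->
  exists s : nat -> 'M[A]_(M + N),
    forall k, V k = \sum_(i < m) Qmx i k first_idx *m s i.
Proof.
elim: m V => [|m IH] V mp V0.
  by exists (fun=> 0) => k; rewrite big_ord0 V0.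
pose km := Ordinal mp; have [k mk|s sE] := IH (fun k => V k - Qmx m k first_idx *m V km) (ltnW mp).
  rewrite Qmx_hess //; have [e|ne] := eqVneq (k : nat) m.
    by rewrite mul1mx (_ : k = km) ?subrr //; apply: val_inj.
  by rewrite mul0mx subr0 V0 // ltn_neqAle eq_sym ne.
exists (fun i => if i == m then V km else s i) => k.
rewrite big_ord_recr /= eqxx -[LHS](subrK (Qmx m k first_idx *m V km)) sE.
congr (_ + _); apply: eq_bigr => i _.
by rewrite (_ : (i == m :> nat) = false) //; apply/negbTE; rewrite neq_ltn ltn_ord.
Qed.

Definition Cmx n := Qmx n last_idx first_idx.

Lemma RmxE n : Rmx n = Cmx (p.-1 + n).
Proof. by apply/matrixP => a b; rewrite !mxE rho_pw. Qed.

Lemma Cmx_small n : (n < p.-1)%N -> Cmx n = 0.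
Proof.
move=> np; rewrite /Cmx (@Qmx_hess n last_idx (ltnW np)).
by rewrite (negbTE (_ : p.-1 != n)) //; lia.
Qed.

Lemma Rmx0 : Rmx 0 = 1%:M.
Proof.
rewrite RmxE addn0 /Cmx (@Qmx_hess p.-1 last_idx (leqnn _)).
by rewrite (eqxx (p.-1)).
Qed.

(** The p-th power applied to the first block column is a combination of the
    previous ones; multiply by the n-th power from the left. *)
Lemma Cmx_rec : exists s : nat -> 'M[A]_(M + N), forall n, Cmx (n + p) = \sum_(i < p) Cmx (n + i) *m s i.
Proof.
have [k pk|s sE] := @cyclic_span p (fun k => Qmx p k first_idx) (leqnn p).
  by have := ltn_ord k; lia.
exists s => n; rewrite /Cmx QmxD.
under eq_bigr => r _ do rewrite sE mulmx_sumr.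
rewrite exchange_big; apply: eq_bigr => i _ /=; rewrite QmxD mulmx_suml.
by apply: eq_bigr => r _; rewrite mulmxA.
Qed.

(** By [Cmx_rec], the generating series of the [Rmx n] becomes 1 when it is
    multiplied by a polynomial of degree [p]. *)
Lemma Rmx_inverse : exists S : nat -> 'M[A]_(M + N),
  (forall n, \sum_(i < n.+1) Rmx i *m S (n - i)%N = if n is 0 then 1%:M else 0)
  /\ forall n, (p < n)%N -> S n = 0.
Proof.
have [s sE] := Cmx_rec.
exists (fun n => if n is j.+1 then (if (j < p)%N then - s (p.-1 - j)%N else 0) else 1%:M).
split=> [n|[|n] //]; last by rewrite ltnS leqNgt => /negbTE ->.
rewrite (reindex_inj rev_ord_inj) big_ord_recl /= subn1 subnn mulmx1 /=.
case: n => [|n]; first by rewrite big_ord0 addr0 Rmx0.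
rewrite [X in X + _]RmxE (_ : (p.-1 + n.+1 = n + p)%N) ?sE; last by lia.
pose f i : 'M[A]_(M + N) := Cmx (n + p.-1 - i)%N *m s (p.-1 - i)%N.
have -> : \sum_(i < p) Cmx (n + i) *m s i = \sum_(i < p) f i.
  rewrite (reindex_inj rev_ord_inj); apply: eq_bigr => i _; rewrite /f /=.
  by have := ltn_ord i => ip; congr (Cmx _ *m s _); lia.
have -> : \sum_(i < p) f i = \sum_(i < n.+1 | (i < p)%N) f i.
  have [np|pn] := leqP n.+1 p.
    rewrite [LHS](bigID (fun i : 'I_p => (i < n.+1)%N)) /=.
    rewrite [X in _ + X]big1 ?addr0 => [|i]; last first.
      by rewrite -leqNgt /f => ni; rewrite Cmx_small ?mul0mx //; have := ltn_ord i; lia.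
    by rewrite (big_ord_widen_cond p (fun i => i < p)%N f np); apply: eq_bigl => i; rewrite ltn_ord.
  by rewrite (big_ord_widen n.+1 f (ltnW pn)).
rewrite big_mkcond -big_split big1 // => i _ /=.
have ni := ltn_ord i; rewrite (_ : n.+2 - (bump 0 i).+1 = n - i)%N; last by rewrite /bump; lia.
rewrite (_ : n.+1 - (n - i) = i.+1)%N; last by lia.
case: ifP => _; last by rewrite mulmx0 addr0.
rewrite mulmxN RmxE /f (_ : p.-1 + (n - i) = n + p.-1 - i)%N ?subrr //; lia.
Qed.

Definition wrank (u : widx M N p) : nat := u.2.

Local Notation low := (@low K _ _ A wrank).

Lemma low_bool n (t : bool) : low n (t%:R).
Proof. by case: t; [apply: low_one | apply: low0]. Qed.

Lemma low_wgen a b (k q : 'I_p) : low (q.+1 - k) (wgen (a, k) (b, q)).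
Proof.
rewrite wgenE; apply: lowD; first exact: low_bool.
apply/lowZ/low_sum => j _; case: eqP => [e|_]; last first.
  by rewrite mul0n scale0r; apply: low0.
by apply/lowZ/low_gen; rewrite /wrank /= e; lia.
Qed.

(** A product of n entries which leads from the index k to the first one
    uses an entry with W_j to go up by j, and lower diagonal entries to come
    down: so k + j <= n - 1. *)
Lemma low_pw n a b (k : 'I_p) : low (n - k) (Q n (a, k) (b, first_idx)).
Proof.
elim: n a k => [|n IH] a k; first by rewrite /= xpair_eqE; apply: low_bool.
rewrite /=; apply: low_sum => -[e q] _; have [nq|qn] := ltnP n q.
  rewrite pw_hess; last by rewrite /= add0n ltnW.
  rewrite (_ : (q == _ :> nat) = false) ?andbF ?mulr0; last by rewrite /=; lia.
  exact: low0.
have [qk|kq] := ltnP q.+1 k; first by rewrite wgen_eq0 ?mul0r //; apply: low0.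
apply: low_mul; first by apply: lowW (low_wgen _ _ _ _); lia.
by apply: lowW (IH _ _); lia.
Qed.

Lemma wgen_up a b (k q j : 'I_p) : q = (k + j)%N :> nat ->
  wgen (a, k) (b, q) = ((raise_coef p j k)%:R * (-1) ^+ grade b) *: gen A (a, b, j).
Proof.
move=> qkj; rewrite wgenE (_ : (k == q.+1 :> nat) = false) ?andbF ?add0r; last by lia.
rewrite (bigD1 j) //= big1 ?addr0 => [|i /negPf ij].
  by rewrite qkj eqxx mul1n scalerA mulrC.
rewrite (_ : (_ == _ :> nat) = false) ?mul0n ?scale0r //.
by rewrite qkj eqn_add2l eq_sym -val_eqE /= in ij *.
Qed.

Lemma wgen_down a b (k q : 'I_p) : k = q.+1 :> nat -> wgen (a, k) (b, q) = (a == b)%:R.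
Proof.
move=> kq; rewrite wgenE kq eqxx andbT big1 ?scaler0 ?addr0 // => j _.
by rewrite (_ : (_ == _ :> nat) = false) ?mul0n ?scale0r //; lia.
Qed.

(** In a product of n = k + j + 1 entries as in [low_pw], an occurrence of
    W_j leaves room for lower diagonal entries only, all equal to 1. The
    coefficients for the possible positions of W_j are natural numbers, one
    of which is positive. *)
Lemma pw_lead n (k j : 'I_p) : n = (k + j.+1)%N ->
  exists2 c : nat, (0 < c)%N & forall a b,
    low j (Q n (a, k) (b, first_idx) - (c%:R * (-1) ^+ grade b) *: gen A (a, b, j)).
Proof.
elim: n k => [|n IH] k nkj; first by lia.
have [c' c'0 Hc'] : exists2 c' : nat, (0 < k -> 0 < c')%N & forall q : 'I_p, k = q.+1 :> nat ->
    forall a b, low j (Q n (a, q) (b, first_idx) - (c'%:R * (-1) ^+ grade b) *: gen A (a, b, j)).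
  have [k0|k0] := posnP k; first by exists 0%N => // q; rewrite k0.
  have kp : (k.-1 < p)%N by have := ltn_ord k; lia.
  have [|c c0 Hc] := IH (Ordinal kp); first by rewrite /=; lia.
  exists c => // q kq a b.
  by rewrite (_ : q = Ordinal kp) //; apply: val_inj; rewrite /= kq.
exists ((0 < k) * c' + (k + j < p) * raise_coef p j k)%N.
  have [k0|k0] := posnP k; last by rewrite mul1n ltn_addr // c'0.
  rewrite k0 mul0n add0n ltn_ord mul1n (raise_coef_gt0 p_gt0 psl2) ?add0n ?ltn_ord //.
move=> a b; pose cst := ((-1) ^+ grade b : K) *: gen A (a, b, j).
pose F1 (x : T) := ((x.2.+1 == k :> nat) && (x.1 == a))%:R *: (c'%:R *: cst).
pose F2 (x : T) := ((x.2 == k + j :> nat)%N && (x.1 == b))%:R *: ((raise_coef p j k)%:R *: cst).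
have E1 : \sum_x F1 x = ((0 < k) * c')%:R *: cst.
  have [k0|k0] := posnP k.
    by rewrite mul0n scale0r big1 // => -[e q] _; rewrite /F1 k0 scale0r.
  have kp : (k.-1 < p)%N by have := ltn_ord k; lia.
  rewrite (bigD1 (a, Ordinal kp)) //= big1 => [|[e q] eq].
    by rewrite /F1 /= prednK // !eqxx scale1r addr0 mul1n.
  rewrite /F1 /=; case: eqP => [qk|_]; rewrite ?scale0r //.
  case: eqP => [ea|_]; rewrite ?scale0r //.
  by case/eqP: eq; rewrite ea; congr (_, _); apply: val_inj; rewrite /= -qk.
have E2 : \sum_x F2 x = ((k + j < p) * raise_coef p j k)%:R *: cst.
  have [kp|kp] := ltnP (k + j) p; last first.
    rewrite mul0n scale0r big1 // => -[e q] _; rewrite /F2 /=.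
    by rewrite (_ : (q == _ :> nat) = false) ?scale0r //; have := ltn_ord q; lia.
  rewrite (bigD1 (b, Ordinal kp)) //= big1 => [|[e q] eq].
    by rewrite /F2 /= !eqxx scale1r addr0 mul1n.
  rewrite /F2 /=; case: eqP => [qk|_]; rewrite ?scale0r //.
  case: eqP => [ea|_]; rewrite ?scale0r //.
  by case/eqP: eq; rewrite ea; congr (_, _); apply: val_inj; rewrite /= -qk.
rewrite -scalerA -/cst natrD scalerDl -E1 -E2 /= -big_split -sumrB.
apply: low_sum => -[e q] _ /=; rewrite /F1 /F2 /=.
have [qk|kq] := ltnP q.+1 k.
  rewrite wgen_eq0 // mul0r (_ : (q.+1 == k :> nat) = false) ?scale0r; last by lia.
  rewrite (_ : (q == _ :> nat) = false) ?scale0r; last by lia.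
  by rewrite addr0 subr0; apply: low0.
have [kE|kq'] := eqVneq (q.+1) (k : nat).
  rewrite wgen_down // (_ : (q == _ :> nat) = false) ?scale0r ?addr0 ?andTb; last by lia.
  rewrite eq_sym; have [->|_] := eqVneq e a; last by rewrite mul0r scale0r subrr; apply: low0.
  by rewrite mul1r scale1r /cst scalerA; apply: Hc'.
rewrite andFb scale0r add0r.
have [nq|qn|qn] := ltngtP n q.
- rewrite pw_hess; last by rewrite ltnW.
  rewrite (_ : (q == (first_idx + n)%N :> nat) = false) ?andbF ?mulr0; last by rewrite /=; lia.
  rewrite (_ : (q == _ :> nat) = false) ?scale0r ?subr0; last by lia.
  exact: low0.
- rewrite (_ : (q == (k + j)%N :> nat) = false) ?scale0r ?subr0; last by lia.
  apply: low_mul; first by apply: lowW (low_wgen _ _ _ _); lia.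
  by apply: lowW (low_pw _ _ _ _); lia.
- rewrite pw_hess; last by rewrite /= qn.
  rewrite (@wgen_up _ _ _ _ j); last by lia.
  rewrite (_ : (q == (first_idx + n)%N :> nat) = true) ?andbT; last by rewrite /= qn add0n eqxx.
  rewrite (_ : (q == (k + j)%N :> nat) = true) ?andTb; last by apply/eqP; lia.
  have [->|_] := eqVneq e b; last by rewrite mulr0 scale0r subrr; apply: low0.
  by rewrite mulr1 scale1r /cst scalerA subrr; apply: low0.
Qed.

Lemma low_Rmx m a b : low m (Rmx m a b).
Proof. by rewrite mxE rho_pw; apply: lowW (low_pw _ _ _ _); rewrite /=; lia. Qed.

Lemma Rmx_lead (j : 'I_p) : exists2 c : nat, (0 < c)%N & forall a b,
    low j (Rmx j.+1 a b - (c%:R * (-1) ^+ grade b) *: gen A (a, b, j)).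
Proof.
have [c c0 Hc] := @pw_lead (p.-1 + j.+1) last_idx j erefl.
by exists c => // a b; rewrite mxE rho_pw.
Qed.
(** By [inverse_rec], each coefficient of the inverse series is minus the
    one of the series itself, up to products of coefficients of lower level;
    so it has the same leading term up to sign, by [Rmx_lead]. *)
Lemma yangian_generators (D : 'M[A]_#|{: cidx M N p}|) :
  constraint_mx pbr rho constr *m D = 1%:M -> D *m constraint_mx pbr rho constr = 1%:M ->
  exists (T : nat -> I -> I -> A) (x : widx M N p -> K),
  [/\ forall n a b, homog (grade2 a b) (T n a b),
      forall m n a b c d, beta D (T m.+1 a b) (T n.+1 c d)
        = (c == b)%:R *: T (m.+1 + n.+1 - 1)%N a d
        - ((-1) ^+ (grade2 a b && grade2 c d) * (a == d)%:R) *: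
            T (m.+1 + n.+1 - 1)%N c b
        + (-1) ^+ ((grade c && grade2 a b) (+) (grade a && grade b)) *:
          \sum_(1 <= r < minn m.+1 n.+1)
            (T r c b * T (m.+1 + n.+1 - 1 - r)%N a d
             - T (m.+1 + n.+1 - 1 - r)%N c b * T r a d),
      forall n a b, (p < n)%N -> T n a b = 0,
      forall u, x u != 0 &
      triangular wrank x (fun u => T u.2.+1 u.1.1 u.1.2)].
Proof.
move=> DE ED; have [S [RS Sp]] := Rmx_inverse; pose pt := @grade M N.
have hb := beta_bider DE ED; have rtt := Rmx_rtt DE ED.
have hS := homog_inverse_series homog_Rmx Rmx0 RS.
have S0 := inverse0 Rmx0 RS; have Sr := inverse_rec Rmx0 RS.
have lS m a b : low m (S m a b).
  elim/ltn_ind: m a b => -[|m] IH a b; first by rewrite S0 mxE; apply: low_bool.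
  rewrite Sr mxE summxE; apply/lowN/low_sum => i _; rewrite mxE; apply: low_sum => e _.
  have im := ltn_ord i; apply: low_mul; first exact: lowW (low_Rmx _ _ _).
  by apply: lowW (IH _ _ _ _); lia.
have lead (j : 'I_p) : exists n : nat, (0 < n)%N /\ forall a b,
    low j (S j.+1 a b + (n%:R * (-1) ^+ grade b) *: gen A (a, b, j)).
  have [n n0 Hn] := Rmx_lead j; exists n; split=> // a b.
  rewrite Sr mxE summxE big_ord_recr /= subnn S0 mulmx1 opprD -addrA [- Rmx _ _ _ + _]addrC.
  apply: lowD; last by rewrite -opprB; apply/lowN/Hn.
  apply/lowN/low_sum => i _; rewrite mxE; apply: low_sum => e _.
  have ij := ltn_ord i; apply: low_mul; first by apply: lowW (low_Rmx _ _ _).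
  by apply: lowW (lS _ _ _); lia.
have [n Hn] := boolp.choice lead.
exists (yser pt S), (fun u : widx M N p => (-1) ^+ u.2 * (n u.2)%:R); split.
- exact: homog_yser.
- exact: (yser_bracketS hb hS S0 (inverse_rtt hb homog_Rmx Rmx0 RS rtt)).
- by move=> m a b pm; rewrite /yser Sp // mxE scaler0.
- move=> u; rewrite mulf_neq0 ?signr_eq0 //.
  by rewrite -(prednK (proj1 (Hn u.2))) char0.
- move=> [[a b] j]; split; first exact: homog_yser.
  have := lowZ ((-1) ^+ (grade b + j.+1)) (proj2 (Hn j) a b); rewrite scalerDr scalerA /yser /=.
  suff -> : (-1) ^+ (grade b + j.+1) * ((n j)%:R * (-1) ^+ grade b) = - ((-1) ^+ j * (n j)%:R) :> K.
    by rewrite scaleNr.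
  by rewrite exprD exprS mulrCA mulrA mulrAC -!mulrA mulN1r; case: (grade b); rewrite ?expr0 ?expr1; ring.
Qed.
End Reduction.

(** * The truncated super-Yangian *)

Section YangianBracket.
Variables (K : fieldType) (M N : nat) (Y : freeSuper K (@ypar M N)).
Local Notation I := 'I_(M + N).
Local Notation ygenY a b n := (gen Y (a, b, n.-1)).

Definition ybr (u v : yidx M N) : Y :=
  let: (a, b, m') := u in let: (c, d, n') := v in
  let m := m'.+1 in let n := n'.+1 in
  (c == b)%:R *: ygenY a d (m + n - 1)
  - ((-1) ^+ (grade2 a b && grade2 c d) * (a == d)%:R) *: ygenY c b (m + n - 1)
  + (-1) ^+ ((grade c && grade2 a b) (+) (grade a && grade b)) *:
    \sum_(1 <= r < minn m n)
      (ygenY c b r * ygenY a d (m + n - 1 - r)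
       - ygenY c b (m + n - 1 - r) * ygenY a d r).

Lemma homog_ybr u v : homog (ypar u (+) ypar v) (ybr u v).
Proof.
case: u v => [[a b] m] [[c d] n]; rewrite /ybr.
have hg e f k : homog (grade2 e f) (gen Y (e, f, k)) by exact: (homog_gen Y (e, f, k)).
have hM k l : homog (grade2 a b (+) grade2 c d) (gen Y (c, b, k) * gen Y (a, d, l)).
  apply: homogMb (hg _ _ _) (hg _ _ _) _; rewrite /grade2.
  by case: (grade a) (grade b) (grade c) (grade d) => [] [] [] [].
apply: homogD; last first.
  apply/homogZ/homog_sum => r _; exact: homogB (hM _ _) (hM _ _).
apply: homogB; last rewrite mulrC -scalerA.
  apply: homog_delta => /eqP e; move: (hg a d (m.+1 + n.+1 - 1).-1); rewrite e /ypar /grade2 /=.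
  by case: (grade a) (grade b) (grade d) => [] [] [].
apply: homog_delta => /eqP e; apply: homogZ; move: (hg c b (m.+1 + n.+1 - 1).-1).
rewrite e /ypar /grade2 /=.
by case: (grade b) (grade c) (grade d) => [] [] [].
Qed.
End YangianBracket.

Section Presentation.
Variables (K : fieldType) (M N p : nat).
Variables (A : freeSuper K (@wpar M N p)) (Y : freeSuper K (@ypar M N)).
Local Notation I := 'I_(M + N).
Variables (beta : A -> A -> A) (T : nat -> I -> I -> A) (x : widx M N p -> K).
Hypothesis hbeta : bider id beta.
Hypothesis hT : forall n a b, homog (grade2 a b) (T n a b).
Hypothesis T_bracket : forall m n a b c d, beta (T m.+1 a b) (T n.+1 c d)
  = (c == b)%:R *: T (m.+1 + n.+1 - 1)%N a d
  - ((-1) ^+ (grade2 a b && grade2 c d) * (a == d)%:R) *: T (m.+1 + n.+1 - 1)%N c b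
  + (-1) ^+ ((grade c && grade2 a b) (+) (grade a && grade b)) *:
    \sum_(1 <= r < minn m.+1 n.+1)
      (T r c b * T (m.+1 + n.+1 - 1 - r)%N a d
       - T (m.+1 + n.+1 - 1 - r)%N c b * T r a d).
Hypothesis T_trunc : forall n a b, (p < n)%N -> T n a b = 0.
Hypothesis x0 : forall u, x u != 0.
Hypothesis T_triangular : triangular (@wrank M N p) x (fun u => T u.2.+1 u.1.1 u.1.2).

Definition yval (u : yidx M N) : A := T u.2.+1 u.1.1 u.1.2.

Let yvalC := homog_ev_comm (par := @ypar M N) (fun u => hT u.2.+1 u.1.1 u.1.2).

Definition realize : Y -> A := ev yval.

Lemma realize_hom : algHom realize. Proof. exact: (ev_hom Y yvalC). Qed.

Lemma realize_gen u : realize (gen Y u) = yval u. Proof. exact: (ev_gen Y yvalC). Qed.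

Lemma realize_pres : homog_pres realize.
Proof. by apply: homog_presP realize_hom _ => u; rewrite realize_gen; apply: hT. Qed.

Lemma realize_prt y : realize (prt y) = prt (realize y).
Proof.
elim/homog_lin_ind: y => [e y hy|c y z IHy IHz].
  by rewrite hy (homZ realize_hom) (realize_pres hy).
by rewrite prtP !(homP realize_hom) prtP IHy IHz.
Qed.

Lemma realize_br y z : realize (br (@ybr K M N Y) y z) = beta (realize y) (realize z).
Proof.
have hr := realize_hom.
apply: (bider_eq hr (bider_post hr (bider_br (@homog_ybr K M N Y)))
  (bider_pre hr realize_pres hbeta)) y z => -[[a b] m] [[c d] n].
rewrite br_gen !realize_gen T_bracket /ybr.
rewrite (homD hr) (homB hr) !(homZ hr) (hom_sum hr) !realize_gen /yval /=.
rewrite !addSn !addnS !subn1 /=; congr (_ + _ *: _).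
apply: eq_big_nat => r /andP[r0 rm]; rewrite (homB hr) !(homM hr) !realize_gen /yval /= !prednK //.
by rewrite subn_gt0; move: rm; rewrite ltn_min => /andP[]; lia.
Qed.

(* the quotient by the generators of level greater than p, with a choice of
   representatives *)
Variables (B : algType K) (pi : Y -> B) (r : B -> Y).
Hypothesis hpi : algHom pi.
Hypothesis piK : forall z, pi (r z) = z.
Hypothesis pi_trunc : forall a b n, (p <= n)%N -> pi (gen Y (a, b, n)) = 0.
Hypothesis pi_eq : forall h : Y -> A, algHom h ->
  (forall a b n, (p <= n)%N -> h (gen Y (a, b, n)) = 0) ->
  forall y z, pi y = pi z -> h y = h z.

(** The morphism [realize] induces the inverse of [f], and it is bijective
    because the elements [T] are free generators by [triangular_bij]. Parity
    and bracket of the quotient, which are computed on representatives, are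
    compared with those of [A] through this injective morphism. *)
Lemma truncation_iso : exists f : A -> B, [/\ algHom f, bijective f,
  forall y, f (prt y) = pi (prt (r (f y))) &
  forall y z, f (beta y z) = pi (br (@ybr K M N Y) (r (f y)) (r (f z)))].
Proof.
have hr := realize_hom; pose g z := realize (r z).
have g_pi y : g (pi y) = realize y.
  apply: (pi_eq hr); last exact: piK.
  by move=> a b n pn; rewrite realize_gen /yval T_trunc.
have hg : algHom g.
  split=> [c y z|y z|].
  - by rewrite -[y]piK -[z]piK -(homP hpi) !g_pi (homP hr).
  - by rewrite -[y]piK -[z]piK -(homM hpi) !g_pi (homM hr).
  - by rewrite -(hom1 hpi) g_pi (hom1 hr).
have rkp (u : widx M N p) : (wrank u < p)%N by apply: ltn_ord.
have [v hv [uv vu]] := triangular_bij rkp x0 T_triangular.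
pose th (u : widx M N p) := pi (gen Y (u.1.1, u.1.2, nat_of_ord u.2)).
have thC u w : th u * th w = (-1) ^+ (wpar u && wpar w) *: (th w * th u).
  by rewrite -!(homM hpi) -(homZ hpi) (gen_comm Y).
have hth := ev_hom A thC; have hev := ev_hom A (homog_ev_comm hv).
pose f (z : A) := ev th (ev v z : A) : B.
have hf : algHom f := algHom_comp hth hev.
have gf z : g (f z) = z.
  rewrite -[RHS]vu /f; move: (ev v z : A) => {}z.
  have uC := homog_ev_comm (fun w => proj1 (T_triangular w)).
  apply: (algHom_eq (algHom_comp hg hth) (ev_hom A uC)) => w /=.
  by rewrite (ev_gen A thC) (ev_gen A uC) /th g_pi realize_gen.
have fg z : f (g z) = z.
  rewrite -[z]piK g_pi; move: (r z) => y.
  apply: (algHom_eq (algHom_comp hf hr) hpi) => -[[a b] n] /=.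
  rewrite realize_gen /yval /=; have [np|pn] := ltnP n p; last first.
    by rewrite T_trunc // (hom0 hf) pi_trunc.
  have uC := homog_ev_comm (fun w => proj1 (T_triangular w)).
  have := ev_gen A uC (a, b, Ordinal np); rewrite /= => <-.
  by rewrite /f uv (ev_gen A thC).
have g_inj := can_inj fg.
exists f; split=> //; first by exists g.
  by move=> y; apply: g_inj; rewrite gf g_pi realize_prt -/(g _) gf.
by move=> y z; apply: g_inj; rewrite gf g_pi realize_br -!/(g _) !gf.
Qed.
End Presentation.

Lemma algHom_lrmorphism (K : nzRingType) (A B : algType K) (f : A -> B) :
  algHom f -> exists h : {lrmorphism A -> B}, h = f :> (A -> B).
Proof.
move=> hf.
pose fL := GRing.isLinear.Build K A B _ f (homP hf).
pose fM := GRing.isMonoidMorphism.Build A B f (conj (hom1 hf) (homM hf)).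
pose h : {lrmorphism A -> B} := HB.pack f fL fM.
by exists h.
Qed.

Section Quotient.
Variables (K : fieldType) (M N p : nat).
Local Notation Y := (sfree_super K (@ypar M N)).
Local Notation B := (ytrunc K M N p).

Definition trunc (y : Y) : B := \pi_(ytrunc K M N p) y.

Lemma trunc_hom : algHom trunc.
Proof.
split=> [c x y|x y|].
- by rewrite /trunc [LHS]algQuot_piD algQuot_piZ.
- exact: algQuot_piM.
- by [].
Qed.

Lemma trunc_gen a b n : (p <= n)%N -> trunc (gen Y (a, b, n)) = 0.
Proof.
move=> pn; rewrite -(hom0 trunc_hom); apply/algQuotP; rewrite subr0.
by apply/genIdealP/ideal_span_gen; exists a, b, n.+1.
Qed.

Lemma trunc_eq (A : algType K) (h : Y -> A) : algHom h ->
  (forall a b n, (p <= n)%N -> h (gen Y (a, b, n)) = 0) ->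
  forall y z, trunc y = trunc z -> h y = h z.
Proof.
move=> hh h0 y z /algQuotP/genIdealP yz; apply/eqP; rewrite -subr_eq0 -(homB hh).
apply/eqP; elim: yz => [_ [a [b [[|n] [// pn ->]]]]||u v _ u0 _ v0|u v _ v0|u v _ v0].
- exact: h0.
- exact: (hom0 hh).
- by rewrite (homB hh) u0 v0 subrr.
- by rewrite (homM hh) v0 mulr0.
- by rewrite (homM hh) v0 mul0r.
Qed.
End Quotient.

Section Concrete.
Variables (K : fieldType) (M N p : nat) (ep em : 'M[K]_p).
Local Notation P := (sfree_super K (@ppar M N p)).
Local Notation A := (sfree_super K (@wpar M N p)).

Lemma lie_poissonE : @lie_poisson K M N p = br (pbr P).
Proof. reflexivity. Qed.

Lemma on_constraintsE : on_constraints ep em = rho ep em A :> (P -> A).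
Proof. reflexivity. Qed.

Lemma unconstrainedE : @unconstrained K M N p ep em = @extend K M N p ep em P A.
Proof. reflexivity. Qed.

Lemma DeltaE : Delta M N ep em = constraint_mx (pbr P) (rho ep em A) (constr ep em P).
Proof. by apply/matrixP => i j; rewrite !mxE. Qed.

Lemma diracE (x y : walg K M N p) :
  dirac ep em x y = beta ep em P (Delta_inv M N ep em : 'M[A]__) x y.
Proof.
rewrite /dirac unconstrainedE lie_poissonE on_constraintsE /beta /dbr.
congr (_ - _); apply: eq_bigr => i _; apply: eq_bigr => j _.
Qed.

Hypothesis char0 : forall n, n.+1%:R != 0 :> K.
Variable e0 : 'M[K]_p.
Hypothesis p_gt0 : (0 < p)%N.
Hypothesis psl2 : principal_sl2 ep em e0.

Lemma W_algebra_iso :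
  poisson_isomorphic (W_algebra M N ep em) (truncated_yangian K M N p).
Proof.
have [h0p h0m hpm rk] := psl2.
have [g [g' [g'g gg' emg epg]]] := standard_basis char0 p_gt0 h0p h0m hpm rk.
have [DE ED] : constraint_mx (pbr P) (rho ep em A) (constr ep em P) *m Delta_inv M N ep em = 1%:M
    /\ Delta_inv M N ep em *m constraint_mx (pbr P) (rho ep em A) (constr ep em P) = 1%:M.
  have [D [DE ED _]] := constraint_mx_inverse char0 p_gt0 psl2 g'g gg' emg epg P A.
  rewrite -DeltaE in DE ED *.
  exact: (@xgetPex _ 0 [set D | Delta M N ep em *m D = 1%:M /\ D *m Delta M N ep em = 1%:M]
    (ex_intro _ D (conj DE ED))).
have hb := beta_bider char0 p_gt0 psl2 g'g gg' emg epg DE ED.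
have [T [x [hT TB T0 x0 tT]]] := yangian_generators char0 p_gt0 psl2 g'g gg' emg epg DE ED.
have piK (z : ytrunc K M N p) : trunc p (repr z) = z by apply: reprK.
have [f [hf bf fP fB]] := @truncation_iso K M N p A (sfree_super K (@ypar M N)) _ _ _
  hb hT TB T0 x0 tT _ _ _ (trunc_hom K M N p) piK (@trunc_gen K M N p)
  (@trunc_eq K M N p A).
have [h hE] := algHom_lrmorphism hf.
exists h; rewrite hE; split; [exact: bf | exact: fP |] => y z.
exact: etrans (congr1 f (diracE y z)) (fB y z).
Qed.
End Concrete.

Theorem theorem4p5 (R : realType) (M N p : nat) (ep em e0 : 'M[R[i]]_p)
    (sgn : bool) (alpha : nat -> seq nat -> R[i]) :
  (0 < M)%N -> (0 < N)%N -> (0 < p)%N ->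
  principal_sl2 ep em e0 ->
  Wbar_recursion M N ep em sgn alpha ->
  (forall j k : nat,
     dirac ep em (Wbar_trace M N p sgn alpha j) (Wbar_trace M N p sgn alpha k)
     = 0) ->
  poisson_isomorphic (W_algebra M N ep em) (truncated_yangian R[i] M N p).
Proof.
move=> _ _ p_gt0 psl2 _ _; apply: W_algebra_iso p_gt0 psl2 => n.
by rewrite pnatr_eq0.
Qed.
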